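(* Let $\mathcal{F}_{nn}$ be the class of depth-$d$ neural networks with parameters in a given parameter set ($\mathcal{W}_F$ or $\mathcal{W}_{1,\infty}$), whose activation functions satisfy Assumptions A and B of the context. Let $\mu,\nu\in\mathcal{P}_{uB}$ and let $\hat\mu_n,\hat\nu_m$ be their empirical measures. Let $\delta\in(0,1)$ satisfy $\sqrt{6h}\,\min\{n,m\}\sqrt{m^{-1}+n^{-1}}\ge4\sqrt{\log(1/\delta)}$. (I) If the parameter set is $\mathcal{W}_F$ and each activation function satisfies $\sigma_i(\alpha x)=\alpha\sigma_i(x)$ for all $\alpha>0$ and $x\in\mathbb{R}$, then with probability at least $1-\delta$ over the randomness of $\hat\mu_n$ and $\hat\nu_m$, $$|d_{\mathcal{F}_{nn}}(\mu,\nu)-d_{\mathcal{F}_{nn}}(\hat\mu_n,\hat\nu_m)|\le2\Gamma_{uB}\prod_{i=1}^dM_F(i)\prod_{i=1}^{d-1}L_i\left(\sqrt{6d\log2+5h/4}+\sqrt{2h\log(1/\delta)}\right)\left(n^{-1/2}+m^{-1/2}\right).$$ (II) If the parameter set is $\mathcal{W}_{1,\infty}$ and each activation function satisfies $\sigma_i(0)=0$, then with probability at least $1-\delta$ over the randomness of $\hat\mu_n$ and $\hat\nu_m$, $$|d_{\mathcal{F}_{nn}}(\mu,\nu)-d_{\mathcal{F}_{nn}}(\hat\mu_n,\hat\nu_m)|\le2\Gamma_{uB}\prod_{i=1}^dM_{1,\infty}(i)\prod_{i=1}^{d-1}L_i\left(\sqrt{2d\log2+2\log h}+\sqrt{2h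\log(1/\delta)}\right)\left(n^{-1/2}+m^{-1/2}\right).$$
   Context: Fix integers $h\ge1$ (input dimension), $d\ge2$ (depth), layer widths $k_1=h,k_2,\dots,k_d\ge1$, and sample sizes $n,m\ge1$. For a matrix $\mathbf{W}$, $\|\mathbf{W}\|_F$ is the Frobenius norm and $\|\mathbf{W}\|_{1,\infty}$ is the maximal $\ell_1$ norm of its rows; $\|\cdot\|$ on vectors is the $\ell_2$ norm and $\|\cdot\|_1$ the $\ell_1$ norm. $\log$ is the natural logarithm. Networks: a depth-$d$ neural network is a function $f:\mathbb{R}^h\to\mathbb{R}$, $f(\mathbf{x})=\mathbf{w}_d^T\sigma_{d-1}(\mathbf{W}_{d-1}\sigma_{d-2}(\cdots\sigma_1(\mathbf{W}_1\mathbf{x})))$, where $\mathbf{W}_i\in\mathbb{R}^{k_{i+1}\times k_i}$ for $i=1,\dots,d-1$, $\mathbf{w}_d\in\mathbb{R}^{k_d}$, and the scalar activation functions $\sigma_i:\mathbb{R}\to\mathbb{R}$ (fixed) are applied entrywise. Given positive constants $M_F(i)$, $M_{1,\infty}(i)$, $i=1,\dots,d$, the parameter sets are: $\mathcal{W}_F$, all $(\mathbf{W}_1,\dots,\mathbf{W}_{d-1},\mathbf{w}_d)$ with $\|\mathbf{W}_i\|_F\le M_F(i)$ for $i\le d-1$ and $\|\mathbf{w}_d\|\le M_F(d)$; and $\mathcal{W}_{1,\infty}$, all such tuples with $\|\mathbf{W}_i\|_{1,\infty}\le M_{1,\infty}(i)$ for $i\le d-1$ and $\|\mathbf{w}_d\|_1\le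 M_{1,\infty}(d)$. $\mathcal{F}_{nn}$ is the set of all such networks with parameters in the given parameter set. Assumption A: each $\sigma_i$ is continuous, non-decreasing, satisfies $\sigma_i(0)\ge0$, and is $L_i$-Lipschitz with $L_i>0$ (these are the $L_i$ in the claim). Assumption B: for each $i=1,\dots,d-1$ there are positive constants $q(i)$ and $Q_\sigma(i)$ such that $\sigma_i(x_2)-\sigma_i(x_1)\ge Q_\sigma(i)(x_2-x_1)$ for all $0\le x_1\le x_2\le q(i)$. Neural net distance: $d_{\mathcal{F}_{nn}}(\mu,\nu)=\sup_{f\in\mathcal{F}_{nn}}|\mathbb{E}_{\mathbf{x}\sim\mu}f(\mathbf{x})-\mathbb{E}_{\mathbf{x}\sim\nu}f(\mathbf{x})|$. Class $\mathcal{P}_{uB}$: given $\Gamma_{uB}>0$, $\mathcal{P}_{uB}$ is the set of all Borel probability measures $\mu$ on $\mathbb{R}^h$ with unbounded support such that $\|\mathbb{E}_{\mathbf{x}\sim\mu}\mathbf{x}\|\le\Gamma_{uB}$ and, for some $\tau$ with $0<\tau\le\Gamma_{uB}$, $\mathbb{E}_{\mathbf{x}\sim\mu}e^{\mathbf{a}^T(\mathbf{x}-\mathbb{E}\mathbf{x})}\le e^{\|\mathbf{a}\|^2\tau^2/2}$ for all $\mathbf{a}\in\mathbb{R}^h$. Empirical measures: $\hat\mu_n$ puts mass $1/n$ on each of $n$ i.i.d. samples from $\mu$, and $\hat\nu_m$ puts mass $1/m$ on each of $m$ i.i.d. samples from $\nu$, the two samples being independent of each other. *)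

(* Defs.v *)
From HB Require Import structures.
From mathcomp Require Export all_boot all_order all_algebra.
From mathcomp Require Export all_classical all_reals all_analysis.
Export Order.TTheory GRing.Theory Num.Theory numFieldNormedType.Exports.

Set Implicit Arguments.
Unset Strict Implicit.
Unset Printing Implicit Defensive.

Local Open Scope classical_set_scope.
Local Open Scope ring_scope.

Definition l2norm (R : realType) (n : nat) (v : 'cV[R]_n) : R :=
  Num.sqrt (\sum_(i < n) v i 0 ^+ 2).

Definition l1norm (R : realType) (n : nat) (v : 'cV[R]_n) : R :=
  \sum_(i < n) `|v i 0|.

Definition frobenius (R : realType) (m n : nat) (A : 'M[R]_(m, n)) : R :=
  Num.sqrt (\sum_(i < m) \sum_(j < n) A i j ^+ 2).

Definition norm_1oo (R : realType) (m n : nat) (A : 'M[R]_(m, n)) : R :=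
  \big[Num.max/0]_(i < m) \sum_(j < n) `|A i j|.

Definition dot (R : realType) (n : nat) (a x : 'cV[R]_n) : R :=
  (a^T *m x) 0 0.

(* Indices are shifted down by one with respect to the usual presentation:
   a depth-d network has widths k 0 (the input dimension), ..., k d.-1,
   hidden weight matrices W 0, ..., W d.-2, activations sigma 0, ...,
   sigma d.-2, and output weights w.  The families are indexed by nat;
   their values beyond these ranges are never used. *)

Definition weights (R : realType) (k : nat -> nat) : Type :=
  forall i : nat, 'M[R]_(k i.+1, k i).

Fixpoint layer (R : realType) (k : nat -> nat) (sigma : nat -> R -> R)
    (W : weights R k) (x : 'cV[R]_(k 0%N)) (i : nat) : 'cV[R]_(k i) :=
  match i with
  | 0 => x
  | j.+1 => map_mx (sigma j) (W j *m layer sigma W x j)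
  end.

Definition network (R : realType) (d : nat) (k : nat -> nat)
    (sigma : nat -> R -> R) (W : weights R k) (w : 'cV[R]_(k d.-1))
    (x : 'cV[R]_(k 0%N)) : R :=
  dot w (layer sigma W x d.-1).

Definition params_F (R : realType) (d : nat) (k : nat -> nat) (M : nat -> R)
    (W : weights R k) (w : 'cV[R]_(k d.-1)) : Prop :=
  (forall i, (i < d.-1)%N -> frobenius (W i) <= M i) /\ l2norm w <= M d.-1.

Definition params_1oo (R : realType) (d : nat) (k : nat -> nat) (M : nat -> R)
    (W : weights R k) (w : 'cV[R]_(k d.-1)) : Prop :=
  (forall i, (i < d.-1)%N -> norm_1oo (W i) <= M i) /\ l1norm w <= M d.-1.

Definition nn_class (R : realType) (d : nat) (k : nat -> nat)
    (sigma : nat -> R -> R)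
    (params : weights R k -> 'cV[R]_(k d.-1) -> Prop) :
    set ('cV[R]_(k 0%N) -> R) :=
  [set f | exists W w, params W w /\ f = network sigma W w].

Arguments params_F {R} d k M W w.
Arguments params_1oo {R} d k M W w.
Arguments nn_class {R} d k sigma params.

Definition assumptionA (R : realType) (s : R -> R) (L : R) : Prop :=
  [/\ continuous s, {homo s : x y / x <= y}, 0 <= s 0, 0 < L
    & L.-lipschitz s].

Definition assumptionB (R : realType) (s : R -> R) : Prop :=
  exists q Q : R, [/\ 0 < q, 0 < Q &
    forall x1 x2, 0 <= x1 -> x1 <= x2 -> x2 <= q ->
      Q * (x2 - x1) <= s x2 - s x1].

Notation borel_cV R h := (g_sigma_algebraType (@open 'cV[R]_h)).

Definition nn_distance (R : realType) (h : nat) (F : set ('cV[R]_h -> R))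
    (mu nu : {measure set (borel_cV R h) -> \bar R}) : \bar R :=
  ereal_sup [set `| \int[mu]_x (f x)%:E - \int[nu]_x (f x)%:E |%E | f in F].

Definition support (R : realType) (h : nat)
    (mu : probability (borel_cV R h) R) : set 'cV[R]_h :=
  [set x | forall U : set 'cV[R]_h, open U -> U x -> (0 < mu U)%E].

Definition mean (R : realType) (h : nat)
    (mu : probability (borel_cV R h) R) : 'cV[R]_h :=
  \col_(i < h) \int[mu]_x (x : 'cV[R]_h) i 0.

Definition P_uB (R : realType) (h : nat) (Gamma : R)
    (mu : probability (borel_cV R h) R) : Prop :=
  [/\ ~ bounded_set (support mu),
      (* makes [mean mu] meaningful *)
      forall i : 'I_h,
        mu.-integrable setT (fun x => ((x : 'cV[R]_h) i 0)%:E),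
      l2norm (mean mu) <= Gamma
    & exists tau : R, [/\ 0 < tau, tau <= Gamma &
        forall a : 'cV[R]_h,
          (\int[mu]_x (expR (dot a ((x : 'cV[R]_h) - mean mu)))%:E
             <= (expR (l2norm a ^+ 2 * tau ^+ 2 / 2))%:E)%E]].

Section empirical.
Local Open Scope ereal_scope.
Context (R : realType) (d : measure_display) (T : measurableType d) (n : nat).
Variable x : 'I_n -> T.

Definition empirical (A : set T) : \bar R :=
  (n%:R^-1)%:E * \sum_(i < n) \d_(x i) A.

Let empirical0 : empirical set0 = 0.
Proof. by rewrite /empirical big1 ?mule0// => i _; rewrite measure0. Qed.

Let empirical_ge0 A : 0 <= empirical A.
Proof. by rewrite mule_ge0 ?lee_fin ?invr_ge0//; exact: sume_ge0. Qed.

Let empirical_sigma_additive : semi_sigma_additive empirical.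
Proof.
move=> F mF tF mUF.
pose m k : {measure set T -> \bar R} :=
  if insub k is Some i then \d_(x i) else mzero.
have n0 : (0 <= n%:R^-1 :> R)%R by rewrite invr_ge0.
pose c : {nonneg R} := NngNum n0.
have E A : empirical A = mscale c (msum m n) A.
  rewrite /empirical /mscale/= /msum; congr (_ * _).
  by apply: eq_bigr => i _; rewrite /m valK.
rewrite E.
have -> : (fun k => \sum_(0 <= i < k) empirical (F i)) =
          (fun k => \sum_(0 <= i < k) mscale c (msum m n) (F i)).
  by apply/funext => k; apply: eq_bigr => i _.
exact: (@measure_semi_sigma_additive _ _ _ (mscale c (msum m n))).
Qed.

HB.instance Definition _ := isMeasure.Build d T R empirical
  empirical0 empirical_ge0 empirical_sigma_additive.
End empirical.
Arguments empirical {R d T n} x.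

Definition mutually_independent (R : realType) (d d' : measure_display)
    (Omega : measurableType d) (P : probability Omega R)
    (T : measurableType d') (I : finType) (X : I -> {mfun Omega >-> T}) : Prop :=
  forall (J : {set I}) (A : I -> set T),
    (forall i, i \in J -> measurable (A i)) ->
    P (\bigcap_(i in [set` J]) (X i @^-1` A i)) =
    (\prod_(i in J) P (X i @^-1` A i))%E.

(* X 0, ..., X n.-1 are drawn from mu and Y 0, ..., Y m.-1 from nu, all draws
   being mutually independent.  Laws are compared on measurable sets only,
   since a measure is unspecified on the others. *)
Definition iid_samples (R : realType) (d d' : measure_display)
    (Omega : measurableType d) (P : probability Omega R)
    (T : measurableType d') (mu nu : probability T R) (n m : nat)
    (X : 'I_n -> {mfun Omega >-> T}) (Y : 'I_m -> {mfun Omega >-> T}) : Prop :=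
  [/\ forall i A, measurable A -> distribution P (X i) A = mu A,
      forall j A, measurable A -> distribution P (Y j) A = nu A
    & mutually_independent P (fun s : 'I_n + 'I_m =>
        match s with inl i => X i | inr j => Y j end)].

(* G need not be measurable: it must contain a measurable event of
   probability at least p. *)
Definition with_prob_ge (R : realType) (d : measure_display)
    (Omega : measurableType d) (P : probability Omega R) (p : R)
    (G : set Omega) : Prop :=
  exists2 E : set Omega, measurable E /\ E `<=` G & (p%:E <= P E)%E.

(* Main.v *)
(* For a class F of B-Lipschitz functions containing 0 and closed under negation,
   the estimation error is at most dev(X)/n + dev(Y)/m, where
   dev(z) = sup_f sum_i (f(z_i) - E f).

   Concentration: dev is B-Lipschitz in each sample point, and symmetrising one
   point at a time gives E exp(t dev) <= exp(t E dev + n t^2 B^2 h Gamma^2) for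
   coordinatewise sub-Gaussian points.

   Mean: E dev is compared with the expected Rademacher supremum over 2n points.
   Keeping the sample at n of the positive signs and integrating out the
   remaining points costs a factor tending to 1, where the usual argument
   costs 2.  Under an exponential, each layer is peeled off at the
   price sqrt 2, since half of a monotone activation is linear.  What is left is
   the exponential moment of |sum_k eps_k z_k|: for the Euclidean norm it is
   dominated by a Gaussian moment, linearised by an auxiliary Gaussian variable;
   for the sup norm it is a sum over coordinates.  In the second case very small
   samples are treated by a direct maximal inequality instead. *)
From HB Require Import structures.
Require Import Defs.
From mathcomp Require Import measurable_realfun zify ring lra.

Set Implicit Arguments.
Unset Strict Implicit.
Unset Printing Implicit Defensive.

Local Open Scope classical_set_scope.
Local Open Scope ring_scope.

(** * Contraction and peeling *)

(** The constants of the statement force the economies. A signed sum of [2 n] points is only about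
    sqrt 2 times as large as one of [n] points, so comparing with [2 n] points gains nearly sqrt 2
    over the usual symmetrisation. In the sup norm case with [h = 1], the same computation with the
    usual symmetrisation, or with 2 instead of sqrt 2 per layer, would already exceed the claimed
    bound. The class is uncountable and its suprema sit under exponentials and integrals. Under the
    exponential a supremum is replaced by a family of functions indexed by sign patterns, one
    near-maximiser per pattern, so that peeling only handles finite sums. Under the integral,
    measurability comes from the suprema being Lipschitz functions of the sample. Networks enter
    only through a few properties: the zero function, closure under negation, vanishing at 0, a
    Lipschitz bound and a contraction inequality, the last two for a norm that is Euclidean in (I)
    and the sup norm in (II). Concentration always uses the Euclidean norm, which dominates the sup
    norm. *)

Section contraction.
Variable R : realType.
Implicit Types a b p q s t u w x y : R.

(** Convexity of the exponential through increments, the form in which the two-point inequality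
    consumes it. *)
Lemma expR_increment p q u w : p <= q -> 0 <= u -> u <= w ->
  expR (p + u) - expR p <= expR (q + w) - expR q.
Proof.
move=> pq u0 uw; rewrite !expRD -[X in _ - X <= _]mulr1 -[X in _ <= _ - X]mulr1.
rewrite -!mulrBr ler_pM ?expR_ge0 ?ler_expR ?lerB ?ler_expR//.
by rewrite subr_ge0 -expR0 ler_expR.
Qed.

Lemma expRD_expRN_abs x y : `|x| <= `|y| ->
  expR x + expR (- x) <= expR y + expR (- y).
Proof.
move=> xy.
have E z : expR z + expR (- z) = expR `|z| + expR (- `|z|) :> R.
  by case: (ger0P z) => _ //; rewrite opprK addrC.
rewrite E [leRHS]E; have x0 := normr_ge0 x.
have := @expR_increment (- `|y|) `|x| (`|y| - `|x|) (`|y| - `|x|).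
rewrite (addrC `|x|) subrK (_ : - `|y| + _ = - `|x|); last ring.
by move=> /(_ _ _ _); lra.
Qed.

(** One sign of the contraction principle. The candidates [(a, t)] and [(b, s)] are what a supremum
    would range over: [a], [b] collect the other coordinates, and [x], [y] are the contracted values
    of [t], [s]. For each sign the pair [pq] names the candidate that dominates. *)
Lemma contraction_two_points a b x y t s :
  `|x| <= `|t| -> `|y| <= `|s| -> `|x - y| <= `|t - s| ->
  exists pq : bool * bool,
    let c (i : bool) := if i then a else b in
    let v (i : bool) := if i then t else s in
    expR (a + x) + expR (b - y) <=
    expR (c pq.1 + v pq.1) + expR (c pq.2 - v pq.2).
Proof.
move=> xt ys xyts.
(* For nonnegative values the larger of [t'], [s'] takes the plus sign, and [expR_increment]
   compares the two displacements. *)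
have core (t' s' : R) : 0 <= t' -> 0 <= s' -> `|x| <= t' -> `|y| <= s' ->
    `|x - y| <= `|t' - s'| -> b + y <= a + x -> a - x <= b - y ->
    expR (a + x) + expR (b - y) <= expR (a + t') + expR (b - s') \/
    expR (a + x) + expR (b - y) <= expR (b + s') + expR (a - t').
  move=> t0 s0 /ler_normlP[x1 x2] /ler_normlP[y1 y2] xy h1 h2.
  have [st|st] := leP s' t'; [left|right].
    move: xy; rewrite [leRHS]ger0_norm ?subr_ge0// => /ler_normlP[xy1 xy2].
    have := @expR_increment (b - s') (a + x) (s' - y) (t' - x).
    rewrite (_ : b - s' + _ = b - y); last ring.
    rewrite (_ : a + x + _ = a + t'); last ring.
    by move=> /(_ _ _ _); lra.
  move: xy; rewrite distrC [leRHS]distrC [leRHS]ger0_norm ?subr_ge0 ?(ltW st)//.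
  move=> /ler_normlP[xy1 xy2].
  have := @expR_increment (a - t') (b - y) (t' + x) (s' + y).
  rewrite (_ : a - t' + _ = a + x); last ring.
  rewrite (_ : b - y + _ = b + s'); last ring.
  by move=> /(_ _ _ _); lra.
(* If one candidate is at least as good for both signs it is used twice, and only the even function
   [expR z + expR (- z)] remains to be compared. *)
have [h1|h1] := leP (a + x) (b + y).
  exists (false, false) => /=.
  apply: (@le_trans _ _ (expR (b + y) + expR (b - y))).
    by rewrite lerD2r ler_expR.
  by rewrite !expRD -!mulrDr ler_wpM2l ?expR_ge0// expRD_expRN_abs.
have [h2|h2] := leP (b - y) (a - x).
  exists (true, true) => /=.
  apply: (@le_trans _ _ (expR (a + x) + expR (a - x))).
    by rewrite lerD2l ler_expR.
  by rewrite !expRD -!mulrDr ler_wpM2l ?expR_ge0// expRD_expRN_abs.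
move: (ltW h1) (ltW h2) => {}h1 {}h2.
have [t0|/ltW t0] := leP 0 t; have [s0|/ltW s0] := leP 0 s.
- rewrite !(ger0_norm t0) in xt; rewrite (ger0_norm s0) in ys.
  have [H|H] := core t s t0 s0 xt ys xyts h1 h2.
    by exists (true, false).
  by exists (false, true).
- exists (true, false) => /=; rewrite (ger0_norm t0) in xt.
  rewrite (ler0_norm s0) in ys.
  move: xt ys => /ler_normlP[? ?] /ler_normlP[? ?].
  by rewrite lerD// ler_expR; lra.
- exists (false, true) => /=; rewrite (ler0_norm t0) in xt.
  rewrite (ger0_norm s0) in ys.
  move: xt ys => /ler_normlP[? ?] /ler_normlP[? ?].
  by rewrite addrC lerD// ler_expR; lra.
- rewrite (ler0_norm t0) in xt; rewrite (ler0_norm s0) in ys.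
  have [|||H|H] := core (- t) (- s) _ _ xt ys _ h1 h2.
  + by rewrite oppr_ge0.
  + by rewrite oppr_ge0.
  + by rewrite -opprD normrN.
  + by exists (false, true); rewrite /= addrC [leRHS]addrC; move: H; rewrite opprK; lra.
  + by exists (true, false); move: H; rewrite /= opprK; lra.
Qed.

End contraction.

(** A sign pattern is the set of its positive indices, so an average over signs is a finite sum over
    [{set 'I_N}]. *)
Definition sgset (R : realType) (N : nat) (A : {set 'I_N}) (k : 'I_N) : R :=
  if k \in A then 1 else -1.

Section sgset.
Variables (R : realType) (N : nat).
Implicit Types (A : {set 'I_N}) (k m : 'I_N).

Lemma sgsetC A k : sgset R (~: A) k = - sgset R A k.
Proof. by rewrite /sgset inE; case: (k \in A); rewrite ?opprK. Qed.

Lemma sum_setC (V : nmodType) (F : {set 'I_N} -> V) :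
  \sum_A F A = \sum_A F (~: A).
Proof. by rewrite (reindex_inj (@finset.setC_inj 'I_N)). Qed.

Lemma sum_set_pairs (V : nmodType) (F : {set 'I_N} -> V) m :
  \sum_A F A = \sum_(A : {set 'I_N} | m \notin A) (F (m |: A)%SET + F A).
Proof.
rewrite (bigID (fun A : {set 'I_N} => m \in A)) /= big_split /=; congr (_ + _).
rewrite (reindex_onto (fun A : {set 'I_N} => m |: A)%SET
  (fun A : {set 'I_N} => A :\ m)%SET) /=.
  apply: eq_bigl => A; rewrite setU11 /=.
  apply/eqP/idP => [<-|mA]; first by rewrite !inE eqxx.
  by apply/setP => k; rewrite !inE; case: eqVneq => //= ->; rewrite (negbTE mA).
by move=> A mA; rewrite finset.setD1K.
Qed.

Lemma sum_sgsetU1 (m : 'I_N) A (F : 'I_N -> R) : m \notin A ->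
  \sum_k sgset R (m |: A)%SET k * F k
    = \sum_(k | k != m) sgset R A k * F k + F m /\
  \sum_k sgset R A k * F k = \sum_(k | k != m) sgset R A k * F k - F m.
Proof.
move=> mA; split; rewrite (bigD1 m) //= addrC; congr (_ + _).
- apply: eq_bigr => k km; congr (_ * _).
  by rewrite /sgset !inE (negbTE km).
- by rewrite /sgset setU11 mul1r.
- by rewrite /sgset (negbTE mA) mulN1r.
Qed.

End sgset.

Lemma sum_set_cst (R : realType) n (K : R) :
  \sum_(A : {set 'I_n}) K = 2 ^+ n * K.
Proof.
by rewrite sumr_const -cardsT -powersetT card_powerset cardsT card_ord
  -(mulr_natl K) natrX.
Qed.

(* Ledoux-Talagrand contraction; letting the point of [T] depend on the signs
   replaces the supremum over [T] inside the exponential. *)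
Lemma contraction (R : realType) (N : nat) (T : set ('I_N -> R)) (K Y : R)
    (phi : R -> R) :
  0 <= K -> phi 0 = 0 -> (forall x y, `|phi x - phi y| <= K * `|x - y|) ->
  (forall t : {set 'I_N} -> 'I_N -> R, (forall A, T (t A)) ->
    \sum_A expR (\sum_k sgset R A k * (K * t A k)) <= Y) ->
  forall t : {set 'I_N} -> 'I_N -> R, (forall A, T (t A)) ->
    \sum_A expR (\sum_k sgset R A k * phi (t A k)) <= Y.
Proof.
move=> K0 phi0 phiK HT.
(* Hybrid argument: indices below the threshold are already linear, the others still contracted.
   Each induction step moves the threshold by one. *)
pose psi (j : nat) (k : 'I_N) u := if (k < j)%N then K * u else phi u.
suff H j : (j <= N)%N -> forall t : {set 'I_N} -> 'I_N -> R,
    (forall A, T (t A)) ->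
    \sum_A expR (\sum_k sgset R A k * psi (N - j)%N k (t A k)) <= Y.
  move=> t tT; have := H N (leqnn _) t tT; rewrite subnn.
  by under eq_bigr do under eq_bigr do rewrite /psi ltn0.
elim: j => [_ t tT|j IH jN t tT].
  rewrite subn0 (le_trans _ (HT t tT))// le_eqVlt; apply/orP; left.
  apply/eqP/eq_bigr => A _; congr expR; apply: eq_bigr => k _.
  by rewrite /psi ltn_ord.
have jN' : (N - j.+1 < N)%N by rewrite subnS prednK ?subn_gt0// leq_subr.
pose m : 'I_N := Ordinal jN'.
have psiE (k : 'I_N) u : k != m -> psi (N - j.+1)%N k u = psi (N - j)%N k u.
  move=> km; rewrite /psi; have -> : (N - j)%N = (N - j.+1).+1 by rewrite subnSK.
  by rewrite ltnS (leq_eqVlt k) (_ : (k == _ :> nat) = false)//; exact: negbTE.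
have psim u : psi (N - j)%N m u = K * u.
  by rewrite /psi -(subnSK jN) leqnn.
have psim' u : psi (N - j.+1)%N m u = phi u by rewrite /psi ltnn.
pose c A (t1 : 'I_N -> R) :=
  \sum_(k | k != m) sgset R A k * psi (N - j)%N k (t1 k).
have /choice[pq Hpq] (A : {set 'I_N}) : exists pq : bool * bool, m \notin A ->
    let u (i : bool) := if i then t (m |: A)%SET else t A in
    expR (c A (u true) + phi (u true m)) + expR (c A (u false) - phi (u false m))
    <= expR (c A (u pq.1) + K * u pq.1 m) + expR (c A (u pq.2) - K * u pq.2 m).
  have phiN x : `|phi x| <= `|K * x|.
    by have := phiK x 0; rewrite phi0 !subr0 normrM (ger0_norm K0).
  have [mA|mA] := boolP (m \in A); first by exists (true, true).
  have [|pq Hpq] := contraction_two_points (c A (t (m |: A)%SET)) (c A (t A))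
      (phiN (t (m |: A)%SET m)) (phiN (t A m)).
    by rewrite -mulrBr normrM (ger0_norm K0).
  by exists pq => _; move: Hpq; case: (pq) => -[] [].
(* The patterns [B] and [m |: B] form a pair; each receives whichever of the two members [t B],
   [t (m |: B)] the choice [pq B] designates for its sign at [m]. *)
pose t' (A : {set 'I_N}) := if m \in A
  then (let B := (A :\ m)%SET in if (pq B).1 then t A else t B)
  else (if (pq A).2 then t (m |: A)%SET else t A).
have t'T A : T (t' A) by rewrite /t'; case: ifP => _; case: ifP.
apply: le_trans (IH (ltnW jN) t' t'T).
rewrite !(sum_set_pairs _ m) ler_sum// => A mA.
have E1 (u : 'I_N -> R) : \sum_k sgset R (m |: A)%SET k * psi (N - j.+1)%N k (u k)
    = c A u + phi (u m).
  rewrite (sum_sgsetU1 (fun k => psi (N - j.+1)%N k (u k)) mA).1 psim'; congr (_ + _).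
  by apply: eq_bigr => k km; rewrite psiE.
have E2 (u : 'I_N -> R) : \sum_k sgset R A k * psi (N - j.+1)%N k (u k)
    = c A u - phi (u m).
  rewrite (sum_sgsetU1 (fun k => psi (N - j.+1)%N k (u k)) mA).2 psim'; congr (_ - _).
  by apply: eq_bigr => k km; rewrite psiE.
have E3 (u : 'I_N -> R) : \sum_k sgset R (m |: A)%SET k * psi (N - j)%N k (u k)
    = c A u + K * u m.
  by rewrite (sum_sgsetU1 (fun k => psi (N - j)%N k (u k)) mA).1 psim.
have E4 (u : 'I_N -> R) : \sum_k sgset R A k * psi (N - j)%N k (u k)
    = c A u - K * u m.
  by rewrite (sum_sgsetU1 (fun k => psi (N - j)%N k (u k)) mA).2 psim.
rewrite E1 E2 E3 E4 /t' setU11 (negbTE mA) setU1K//.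
exact: Hpq.
Qed.

(* Monotonicity makes [sigma - L / 2] Lipschitz with constant [L / 2]; only this
   half of [sigma] pays the factor 2 for the absolute value, and averaging it
   with the linear half leaves sqrt 2. *)
Lemma contraction_abs (R : realType) (N : nat) (T : set ('I_N -> R))
    (mu L Y : R) (sigma : R -> R) :
  0 <= mu -> 0 <= L -> sigma 0 = 0 -> {homo sigma : x y / x <= y} ->
  (forall x y, `|sigma x - sigma y| <= L * `|x - y|) ->
  (forall t : {set 'I_N} -> 'I_N -> R, (forall A, T (t A)) ->
    \sum_A expR (mu * L * `|\sum_k sgset R A k * t A k|) <= Y) ->
  forall t : {set 'I_N} -> 'I_N -> R, (forall A, T (t A)) ->
    \sum_A expR (mu * `|\sum_k sgset R A k * sigma (t A k)|)
      <= Num.sqrt 2 * Y.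
Proof.
move=> mu0 L0 s0 sh sL HT t tT.
pose rho u := sigma u - L / 2 * u.
have rhoL x y : `|rho x - rho y| <= L / 2 * `|x - y|.
  have H (u v : R) : u <= v -> `|rho v - rho u| <= L / 2 * `|v - u|.
    move=> uv; have := sL v u; have := sh u v uv.
    rewrite /rho (ger0_norm (_ : 0 <= v - u)) ?subr_ge0// => h1.
    rewrite ger0_norm ?subr_ge0// => h2.
    by rewrite ler_norml; apply/andP; split; lra.
  have [xy|/ltW xy] := leP y x; first exact: H.
  by rewrite distrC (distrC x); exact: H.
pose a A := mu * L * `|\sum_k sgset R A k * t A k|.
pose b A := \sum_k sgset R A k * (2 * mu * rho (t A k)).
have sabs A : mu * `|\sum_k sgset R A k * sigma (t A k)|
    <= a A / 2 + `|b A| / 2.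
  have -> : \sum_k sgset R A k * sigma (t A k) =
      L / 2 * (\sum_k sgset R A k * t A k) + \sum_k sgset R A k * rho (t A k).
    rewrite mulr_sumr -big_split; apply: eq_bigr => k _ /=.
    by rewrite /rho; ring.
  have -> : `|b A| = 2 * mu * `|\sum_k sgset R A k * rho (t A k)|.
    rewrite -[in RHS](ger0_norm (_ : 0 <= 2 * mu)) ?mulr_ge0// -normrM.
    by rewrite mulr_sumr; congr `| _ |; apply: eq_bigr => k _; ring.
  have := ler_normD (L / 2 * (\sum_k sgset R A k * t A k))
    (\sum_k sgset R A k * rho (t A k)).
  rewrite normrM (ger0_norm (_ : 0 <= L / 2)) ?divr_ge0// => H.
  by have := ler_wpM2l mu0 H; rewrite /a; lra.
have s2 : 0 < Num.sqrt 2 :> R by rewrite sqrtr_gt0.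
have s22 : Num.sqrt 2 * Num.sqrt 2 = 2 :> R by rewrite -expr2 sqr_sqrtr.
(* Weighted AM-GM. The absolute value costs two signed exponentials, so its square gets half the
   weight of the linear one: [sqrt 2 / 2 + 2 * (sqrt 2 / 4) = sqrt 2]. *)
have step A : expR (mu * `|\sum_k sgset R A k * sigma (t A k)|) <=
    Num.sqrt 2 / 2 * expR (a A) + Num.sqrt 2 / 4 * (expR (b A) + expR (- b A)).
  apply: (@le_trans _ _ (expR (a A / 2) * expR (`|b A| / 2))).
    by rewrite -expRD ler_expR.
  have -> : expR (a A) = expR (a A / 2) ^+ 2.
    by rewrite -expRM_natr -mulr_natr; congr expR; field.
  have : expR `|b A| <= expR (b A) + expR (- b A).
    by case: (ger0P (b A)) => _; [rewrite lerDl|rewrite lerDr]; exact: expR_ge0.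
  have -> : expR `|b A| = expR (`|b A| / 2) ^+ 2.
    by rewrite -expRM_natr -mulr_natr; congr expR; field.
  set p := expR (a A / 2); set q := expR (`|b A| / 2) => qb.
  have /(ler_wpM2l (ltW s2)) : 2 * p * q * Num.sqrt 2 <= 2 * p ^+ 2 + q ^+ 2.
    have := sqr_ge0 (Num.sqrt 2 * p - q).
    by rewrite sqrrB exprMn expr2 s22; lra.
  have : Num.sqrt 2 * q ^+ 2 <= Num.sqrt 2 * (expR (b A) + expR (- b A)).
    by rewrite ler_wpM2l// ltW.
  have -> : Num.sqrt 2 * (2 * p * q * Num.sqrt 2) = 4 * (p * q).
    by rewrite mulrC -!mulrA s22; ring.
  by lra.
apply: (le_trans (ler_sum _ (fun A _ => step A))).
rewrite big_split /= -!mulr_sumr big_split /=.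
have muL0 : 0 <= mu * L by rewrite mulr_ge0.
have HT' (u : {set 'I_N} -> 'I_N -> R) : (forall A, T (u A)) ->
    \sum_A expR (\sum_k sgset R A k * (mu * L * u A k)) <= Y.
  move=> uT; apply: le_trans (HT u uT); apply: ler_sum => A _.
  rewrite ler_expR; under eq_bigr do rewrite mulrCA.
  by rewrite -mulr_sumr ler_wpM2l// ler_norm.
have h1 : \sum_A expR (b A) <= Y.
  apply: (contraction muL0 (phi := fun u => 2 * mu * rho u)) HT' _ tT.
    by rewrite /rho s0; ring.
  move=> x y; rewrite -mulrBr normrM ger0_norm ?mulr_ge0//.
  by have := ler_wpM2l mu0 (rhoL x y); lra.
have h2 : \sum_A expR (- b A) <= Y.
  rewrite (eq_bigr (fun A => expR (\sum_k sgset R A k * - (2 * mu * rho (t A k))))).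
    apply: (contraction muL0 (phi := fun u => - (2 * mu * rho u))) HT' _ tT.
      by rewrite /rho s0; ring.
    move=> x y; rewrite -opprD normrN -mulrBr normrM ger0_norm ?mulr_ge0//.
    by have := ler_wpM2l mu0 (rhoL x y); lra.
  by move=> A _; rewrite /b -sumrN; congr expR; apply: eq_bigr => k _; rewrite mulrN.
have h3 : \sum_A expR (a A) <= Y by exact: HT.
have := ler_wpM2l (ltW s2) h1; have := ler_wpM2l (ltW s2) h2.
have := ler_wpM2l (ltW s2) h3.
rewrite /a; lra.
Qed.

Section peeling.
Variables (R : realType) (k : nat -> nat) (sigma : nat -> R -> R).
Variables (L M c : nat -> R) (D : nat) (norm : forall n, 'cV[R]_n -> R).
Variable ok : forall i, 'M[R]_(k i.+1, k i) -> Prop.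
Hypothesis L0 : forall i, (i < D)%N -> 0 <= L i.
Hypothesis M0 : forall i, (i < D)%N -> 0 <= M i.
Hypothesis c0 : forall i, (i < D)%N -> 0 <= c i.
Hypothesis sigma0 : forall i, (i < D)%N -> sigma i 0 = 0.
Hypothesis sigma_homo : forall i, (i < D)%N ->
  {homo sigma i : x y / x <= y}.
Hypothesis sigma_lip : forall i, (i < D)%N ->
  forall x y, `|sigma i x - sigma i y| <= L i * `|x - y|.
(* the layer bound is attained, up to [c i], by a single unit *)
Hypothesis unit_bound : forall i, (i < D)%N ->
  forall (W : 'M[R]_(k i.+1, k i)) N (a : 'I_N -> R) (v : 'I_N -> 'cV[R]_(k i)),
  ok W -> exists w : 'cV[R]_(k i),
    (forall u, c i * `|dot w u| <= M i * norm u) /\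
    norm (\sum_j a j *: map_mx (sigma i) (W *m v j))
      <= c i * `|\sum_j a j * sigma i (dot w (v j))|.

Lemma dot_sum n N (a : 'I_N -> R) (w : 'cV[R]_n) (v : 'I_N -> 'cV[R]_n) :
  dot w (\sum_j a j *: v j) = \sum_j a j * dot w (v j).
Proof.
rewrite /dot mulmx_sumr summxE; apply: eq_bigr => j _.
by rewrite -scalemxAr mxE.
Qed.

(** The outer layer is reduced to a single unit by [unit_bound], its activation is removed by
    [contraction_abs], and the dual bound on [w] turns the remaining linear form back into the norm
    of the layer below, with weights that again depend on the signs. *)
Lemma peeling N (z : 'I_N -> 'cV[R]_(k 0)) i : (i <= D)%N ->
  forall lam, 0 <= lam -> forall W : {set 'I_N} -> weights R k,
  (forall A j, (j < D)%N -> ok (W A j)) ->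
  \sum_A expR (lam * norm (\sum_j sgset R A j *: layer sigma (W A) (z j) i))
   <= Num.sqrt 2 ^+ i *
     \sum_A expR (lam * (\prod_(j < i) (M j * L j)) *
                  norm (\sum_j sgset R A j *: z j)).
Proof.
elim: i => [_ lam lam0 W okW|i IH iD lam lam0 W okW].
  by rewrite expr0 mul1r big_ord0 mulr1.
pose h (V : weights R k) (w : 'cV[R]_(k i)) (j : 'I_N) :=
  dot w (layer sigma V (z j) i).
pose T := [set t : 'I_N -> R | exists V w, [/\ (forall j, (j < D)%N -> ok (V j)),
  (forall u, c i * `|dot w u| <= M i * norm u) & t = h V w]].
have /choice[w Hw] (A : {set 'I_N}) := unit_bound iD (sgset R A)
  (fun j => layer sigma (W A) (z j) i) (okW A i iD).
set Y := _ * \sum_A _.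
rewrite exprS in Y *.
apply: (@le_trans _ _ (\sum_A expR (lam * c i *
    `|\sum_j sgset R A j * sigma i (h (W A) (w A) j)|))).
  apply: ler_sum => A _; rewrite ler_expR -mulrA ler_wpM2l//.
  exact: (Hw A).2.
rewrite /Y -mulrA.
apply: (@contraction_abs _ _ T _ (L i)).
- by rewrite mulr_ge0// c0.
- exact: L0.
- exact: sigma0.
- exact: sigma_homo.
- exact: sigma_lip.
- move=> t tT.
  have /choice[V HV] : forall A : {set 'I_N}, exists V : weights R k,
      (forall j, (j < D)%N -> ok (V j)) /\
      c i * `|\sum_j sgset R A j * t A j| <=
      M i * norm (\sum_j sgset R A j *: layer sigma V (z j) i).
    move=> A; have [V [u [okV Hu tE]]] := tT A.
    by exists V; split=> //; rewrite tE /h -dot_sum.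
  rewrite [in leRHS](eq_bigr (fun A => expR (lam * (M i * L i) * (\prod_(j < i) (M j * L j)) *
                  norm (\sum_j sgset R A j *: z j)))); last first.
    by move=> A _; rewrite big_ord_recr /= -!mulrA; congr (expR (_ * _)); ring.
  apply: le_trans (IH (ltnW iD) (lam * (M i * L i)) _ V (fun A => (HV A).1)).
    apply: ler_sum => A _; rewrite ler_expR.
    have := ler_wpM2l (mulr_ge0 lam0 (L0 iD)) (HV A).2.
    by lra.
  by rewrite !mulr_ge0// ?M0// ?L0.
- by move=> A; exists (W A), (w A); split=> //; [exact: okW|exact: (Hw A).1].
Qed.

Lemma peeling_network N (z : 'I_N -> 'cV[R]_(k 0)) (MD lam : R) : 0 <= lam ->
  0 <= MD ->
  forall (W : {set 'I_N} -> weights R k) (w : {set 'I_N} -> 'cV[R]_(k D)),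
  (forall A j, (j < D)%N -> ok (W A j)) ->
  (forall A u, `|dot (w A) u| <= MD * norm u) ->
  \sum_A expR (lam * `|\sum_j sgset R A j * dot (w A) (layer sigma (W A) (z j) D)|)
   <= Num.sqrt 2 ^+ D *
     \sum_A expR (lam * (MD * \prod_(j < D) (M j * L j)) *
                  norm (\sum_j sgset R A j *: z j)).
Proof.
move=> lam0 MD0 W w okW Hw.
rewrite mulrA; apply: le_trans (peeling z (leqnn D) (mulr_ge0 lam0 MD0) okW).
apply: ler_sum => A _; rewrite ler_expR -mulrA ler_wpM2l// -dot_sum.
exact: Hw.
Qed.

End peeling.

(** * Vector norms *)

Definition linf (R : realType) (n : nat) (v : 'cV[R]_n) : R :=
  \big[Num.max/0]_(i < n) `|v i 0|.

Section norms.
Variable R : realType.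

Lemma l2norm_ge0 n (v : 'cV[R]_n) : 0 <= l2norm v.
Proof. exact: sqrtr_ge0. Qed.

Lemma l2norm_sqr n (v : 'cV[R]_n) : l2norm v ^+ 2 = \sum_i v i 0 ^+ 2.
Proof. by rewrite sqr_sqrtr// sumr_ge0// => i _; exact: sqr_ge0. Qed.

Lemma dotE n (a x : 'cV[R]_n) : dot a x = \sum_i a i 0 * x i 0.
Proof. by rewrite /dot mxE; apply: eq_bigr => i _; rewrite mxE. Qed.

Lemma dotB n (a x y : 'cV[R]_n) : dot a (x - y) = dot a x - dot a y.
Proof. by rewrite /dot mulmxBr !mxE. Qed.

Lemma dotZl n (a x : 'cV[R]_n) c : dot (c *: a) x = c * dot a x.
Proof. by rewrite !dotE mulr_sumr; apply: eq_bigr => i _; rewrite mxE mulrA. Qed.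

(** Cauchy-Schwarz, from the squared norm of [l2norm x ^+ 2 *: a - dot a x *: x]. *)
Lemma dot_le n (a x : 'cV[R]_n) : `|dot a x| <= l2norm a * l2norm x.
Proof.
have [x0|x0] := eqVneq (l2norm x ^+ 2) 0.
  have H i : x i 0 = 0.
    apply/eqP; rewrite -sqrf_eq0; apply/eqP.
    by move: x0; rewrite l2norm_sqr => /psumr_eq0P; apply => // j _; exact: sqr_ge0.
  by rewrite dotE big1 ?normr0 ?mulr_ge0 ?l2norm_ge0// => i _; rewrite H mulr0.
rewrite -ler_sqr ?nnegrE ?mulr_ge0 ?l2norm_ge0// real_normK ?num_real// exprMn.
have xp : 0 < l2norm x ^+ 2 by rewrite lt_neqAle eq_sym x0 sqr_ge0.
rewrite -subr_ge0 -(pmulr_rge0 _ xp).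
have -> : l2norm x ^+ 2 * (l2norm a ^+ 2 * l2norm x ^+ 2 - dot a x ^+ 2) =
    \sum_i (l2norm x ^+ 2 * a i 0 - dot a x * x i 0) ^+ 2.
  under eq_bigr do rewrite sqrrB !exprMn.
  rewrite big_split /= sumrB /= -!mulr_sumr -!l2norm_sqr.
  rewrite (_ : \sum_(i < n) _ *+ 2 = 2 * l2norm x ^+ 2 * dot a x * dot a x); first ring.
  rewrite [in X in _ * X]dotE mulr_sumr; apply: eq_bigr => i _; ring.
by rewrite sumr_ge0// => i _; exact: sqr_ge0.
Qed.

Lemma l2normZ n c (v : 'cV[R]_n) : l2norm (c *: v) = `|c| * l2norm v.
Proof.
rewrite /l2norm; under eq_bigr do rewrite mxE exprMn.
by rewrite -mulr_sumr sqrtrM ?sqr_ge0// sqrtr_sqr.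
Qed.

Lemma l2normN n (v : 'cV[R]_n) : l2norm (- v) = l2norm v.
Proof. by rewrite -scaleN1r l2normZ normrN1 mul1r. Qed.

Lemma l2norm_distC n (u v : 'cV[R]_n) : l2norm (u - v) = l2norm (v - u).
Proof. by rewrite -opprB l2normN. Qed.

Lemma l2normD n (u v : 'cV[R]_n) : l2norm (u + v) <= l2norm u + l2norm v.
Proof.
rewrite -ler_sqr ?nnegrE ?addr_ge0 ?l2norm_ge0//.
have -> : l2norm (u + v) ^+ 2 = l2norm u ^+ 2 + 2 * dot u v + l2norm v ^+ 2.
  rewrite !l2norm_sqr dotE mulr_sumr -!big_split /=; apply: eq_bigr => i _.
  by rewrite mxE; ring.
rewrite sqrrD lerD2r lerD2l -[leRHS]mulr_natl ler_wpM2l//.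
by rewrite (le_trans (ler_norm _))// dot_le.
Qed.

Lemma l2norm_lip n (x y z : 'cV[R]_n) :
  `|l2norm (x - y) - l2norm (x - z)| <= l2norm (y - z).
Proof.
have H (u v w : 'cV[R]_n) : l2norm (u - v) - l2norm (u - w) <= l2norm (v - w).
  rewrite lerBlDl (l2norm_distC v) (_ : u - v = (u - w) + (w - v)).
    exact: l2normD.
  by rewrite addrA subrK.
by rewrite ler_norml H andbT lerNl opprB (l2norm_distC y) H.
Qed.

Lemma frobenius_sqr m n (W : 'M[R]_(m, n)) :
  frobenius W ^+ 2 = \sum_i l2norm (row i W)^T ^+ 2.
Proof.
rewrite sqr_sqrtr; last by do 2! apply: sumr_ge0 => ? _; exact: sqr_ge0.
by apply: eq_bigr => i _; rewrite l2norm_sqr; apply: eq_bigr => j _; rewrite !mxE.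
Qed.

Lemma mulmx_dot m n (W : 'M[R]_(m, n)) (v : 'cV[R]_n) i :
  (W *m v) i 0 = dot (row i W)^T v.
Proof. by rewrite dotE mxE; apply: eq_bigr => j _; rewrite !mxE. Qed.

Lemma l2norm_mulmx m n (W : 'M[R]_(m, n)) (v : 'cV[R]_n) :
  l2norm (W *m v) <= frobenius W * l2norm v.
Proof.
rewrite -ler_sqr ?nnegrE ?mulr_ge0 ?l2norm_ge0 ?sqrtr_ge0//.
rewrite exprMn frobenius_sqr l2norm_sqr mulr_suml ler_sum// => i _.
rewrite mulmx_dot -exprMn -[leLHS]real_normK ?num_real//.
by rewrite ler_sqr ?nnegrE ?mulr_ge0 ?l2norm_ge0// dot_le.
Qed.

Lemma l2norm_map n (s : R -> R) L (u v : 'cV[R]_n) :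
  (forall x y, `|s x - s y| <= L * `|x - y|) -> 0 <= L ->
  l2norm (map_mx s u - map_mx s v) <= L * l2norm (u - v).
Proof.
move=> sL L0; rewrite -ler_sqr ?nnegrE ?mulr_ge0 ?l2norm_ge0//.
rewrite exprMn !l2norm_sqr mulr_sumr ler_sum// => i _; rewrite !mxE.
rewrite -exprMn -[leLHS]real_normK ?num_real// -[leRHS]real_normK ?num_real//.
by rewrite ler_sqr ?nnegrE// normrM (ger0_norm L0).
Qed.

Lemma linf_ge0 n (v : 'cV[R]_n) : 0 <= linf v.
Proof. by rewrite /linf; apply: bigmax_ge_id. Qed.

Lemma le_linf n (v : 'cV[R]_n) i : `|v i 0| <= linf v.
Proof. exact: (le_bigmax 0 (fun i => `|v i 0|) i). Qed.

Lemma linf_le n (v : 'cV[R]_n) c : 0 <= c -> (forall i, `|v i 0| <= c) ->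
  linf v <= c.
Proof. by move=> c0 vc; apply/bigmax_leP. Qed.

Lemma dot_le_linf n (a x : 'cV[R]_n) : `|dot a x| <= l1norm a * linf x.
Proof.
rewrite dotE (le_trans (ler_norm_sum _ _ _))// /l1norm mulr_suml ler_sum// => i _.
by rewrite normrM ler_wpM2l// le_linf.
Qed.

Lemma l1norm_row_le m n (W : 'M[R]_(m, n)) i : l1norm (row i W)^T <= norm_1oo W.
Proof.
apply: le_trans (le_bigmax 0 (fun i => \sum_j `|W i j|) i).
by rewrite /l1norm ler_sum// => j _; rewrite !mxE.
Qed.

Lemma linf_mulmx m n (W : 'M[R]_(m, n)) (v : 'cV[R]_n) :
  linf (W *m v) <= norm_1oo W * linf v.
Proof.
apply: linf_le => [|i].
  by rewrite mulr_ge0 ?linf_ge0// /norm_1oo; apply: bigmax_ge_id.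
rewrite mulmx_dot (le_trans (dot_le_linf _ _))// ler_wpM2r ?linf_ge0//.
exact: l1norm_row_le.
Qed.

Lemma linf_map n (s : R -> R) L (u v : 'cV[R]_n) :
  (forall x y, `|s x - s y| <= L * `|x - y|) -> 0 <= L ->
  linf (map_mx s u - map_mx s v) <= L * linf (u - v).
Proof.
move=> sL L0; apply: linf_le => [|i]; first by rewrite mulr_ge0 ?linf_ge0.
rewrite !mxE (le_trans (sL _ _))// ler_wpM2l//.
by have := le_linf (u - v) i; rewrite !mxE.
Qed.

Lemma linf_l2norm n (v : 'cV[R]_n) : linf v <= l2norm v.
Proof.
apply: linf_le => [|i]; first exact: l2norm_ge0.
rewrite -[leLHS]sqrtr_sqr; apply: ler_wsqrtr.
rewrite (bigD1 i) //= lerDl sumr_ge0// => j _.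
exact: sqr_ge0.
Qed.

(** The first alternative is [m = 0], a layer without units. *)
Lemma argmax_exists m (t : 'I_m -> R) :
  (forall i : 'I_m, False) \/ exists i0, forall i, t i <= t i0.
Proof.
case: m t => [|m] t; first by left => -[].
right; have [i _ H] := arg_maxP t (erefl : xpredT (ord0 : 'I_m.+1)).
by exists i => j; exact: H.
Qed.

(** By positive homogeneity a row contributes its norm times the value of the normalised row.
    Summing squares, the best normalised row stands for all of them at the price of the Frobenius
    norm, whence the constant [M] on both sides of the dual bound. *)
Lemma unit_bound_frobenius m n (s : R -> R) (M : R) (W : 'M[R]_(m, n)) N
    (a : 'I_N -> R) (v : 'I_N -> 'cV[R]_n) :
  s 0 = 0 -> (forall alpha x, 0 < alpha -> s (alpha * x) = alpha * s x) ->
  0 <= M -> frobenius W <= M ->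
  exists w : 'cV[R]_n, (forall u, M * `|dot w u| <= M * l2norm u) /\
    l2norm (\sum_j a j *: map_mx s (W *m v j)) <= M * `|\sum_j a j * s (dot w (v j))|.
Proof.
move=> s0 sh M0 WM.
(* A zero row has [hat i = 0], because [0^-1 = 0]. *)
pose hat i := (l2norm (row i W)^T)^-1 *: (row i W)^T.
pose t (w : 'cV[R]_n) := `|\sum_j a j * s (dot w (v j))|.
have hat1 i : l2norm (hat i) <= 1.
  rewrite /hat l2normZ normfV (ger0_norm (l2norm_ge0 _)).
  by have [->|h] := eqVneq (l2norm (row i W)^T) 0; rewrite ?invr0 ?mul0r// mulVf.
have E i : `|(\sum_j a j *: map_mx s (W *m v j)) i 0| =
    l2norm (row i W)^T * t (hat i).
  rewrite summxE /t -[X in X * _](ger0_norm (l2norm_ge0 _)) -normrM mulr_sumr.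
  congr `| _ |; apply: eq_bigr => j _; rewrite !mxE -[\sum_ _ _]/(_) mulrCA.
  congr (_ * _); rewrite /hat dotZl.
  have -> : \sum_j0 W i j0 * v j j0 0 = dot (row i W)^T (v j).
    by rewrite dotE; apply: eq_bigr => l _; rewrite !mxE.
  have [h|h] := eqVneq (l2norm (row i W)^T) 0.
    have : `|dot (row i W)^T (v j)| <= 0.
      by rewrite (le_trans (dot_le _ _))// h mul0r.
    by rewrite normr_le0 => /eqP ->; rewrite s0 h mul0r.
  have hp : 0 < l2norm (row i W)^T by rewrite lt_neqAle eq_sym h l2norm_ge0.
  by rewrite -sh// mulrA mulfV// mul1r.
have key w : (forall i, t (hat i) <= t w) ->
    l2norm (\sum_j a j *: map_mx s (W *m v j)) <= M * t w.
  move=> H; have tw : 0 <= t w by exact: normr_ge0.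
  rewrite -ler_sqr ?nnegrE ?mulr_ge0 ?l2norm_ge0//.
  apply: (@le_trans _ _ (frobenius W ^+ 2 * t w ^+ 2)).
    rewrite l2norm_sqr frobenius_sqr mulr_suml ler_sum// => i _.
    rewrite -[leLHS]real_normK ?num_real// E exprMn ler_wpM2l ?sqr_ge0//.
    by rewrite ler_sqr ?nnegrE ?normr_ge0.
  by rewrite exprMn ler_wpM2r ?sqr_ge0// ler_sqr ?nnegrE ?sqrtr_ge0.
have [H0|[i0 H]] := argmax_exists (fun i => t (hat i)).
  exists 0; split; last by apply: key => i; have := H0 i.
  by move=> u; rewrite -(scale0r (0 : 'cV[R]_n)) dotZl mul0r normr0 mulr0 mulr_ge0// l2norm_ge0.
exists (hat i0); split; last exact: key.
move=> u; rewrite ler_wpM2l// (le_trans (dot_le _ _))// -[leRHS]mul1r.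
by rewrite ler_wpM2r ?l2norm_ge0.
Qed.

(** The sup norm is attained at one row, which serves as [w] without rescaling; hence the constant
    1. *)
Lemma unit_bound_1oo m n (s : R -> R) (M : R) (W : 'M[R]_(m, n)) N
    (a : 'I_N -> R) (v : 'I_N -> 'cV[R]_n) :
  0 <= M -> norm_1oo W <= M ->
  exists w : 'cV[R]_n, (forall u, 1 * `|dot w u| <= M * linf u) /\
    linf (\sum_j a j *: map_mx s (W *m v j)) <= 1 * `|\sum_j a j * s (dot w (v j))|.
Proof.
move=> M0 WM.
pose t (w : 'cV[R]_n) := `|\sum_j a j * s (dot w (v j))|.
have E i : `|(\sum_j a j *: map_mx s (W *m v j)) i 0| = t (row i W)^T.
  rewrite summxE /t; congr `| _ |; apply: eq_bigr => j _.
  by rewrite mxE [in LHS]mxE mulmx_dot.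
have [H0|[i0 H]] := argmax_exists (fun i => t (row i W)^T).
  exists 0; split; last by rewrite mul1r linf_le// => i; have := H0 i.
  move=> u; rewrite -(scale0r (0 : 'cV[R]_n)) dotZl mul0r normr0 mulr0.
  by rewrite mulr_ge0// linf_ge0.
exists (row i0 W)^T; split=> [u|]; last first.
  by rewrite mul1r linf_le ?normr_ge0// => i; rewrite E; exact: H.
rewrite mul1r (le_trans (dot_le_linf _ _))// ler_wpM2r ?linf_ge0//.
by rewrite (le_trans (l1norm_row_le _ _)).
Qed.

Lemma network_lipschitz (k : nat -> nat) (sigma : nat -> R -> R) (L M : nat -> R)
    (MD : R) (D : nat) (norm : forall n, 'cV[R]_n -> R)
    (W : weights R k) (w : 'cV[R]_(k D)) :
  (forall i, (i < D)%N -> 0 <= L i) -> (forall i, (i < D)%N -> 0 <= M i) ->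
  0 <= MD ->
  (forall i, (i < D)%N -> forall v, norm _ (W i *m v) <= M i * norm _ v) ->
  (forall v, `|dot w v| <= MD * norm _ v) ->
  (forall i, (i < D)%N -> forall u v : 'cV_(k i.+1),
    norm _ (map_mx (sigma i) u - map_mx (sigma i) v) <= L i * norm _ (u - v)) ->
  forall x y, `|dot w (layer sigma W x D) - dot w (layer sigma W y D)|
    <= MD * (\prod_(j < D) (M j * L j)) * norm _ (x - y).
Proof.
move=> L0 M0 MD0 WM wM sL x y; rewrite -dotB (le_trans (wM _))// -mulrA ler_wpM2l//.
suff H i : (i <= D)%N -> norm _ (layer sigma W x i - layer sigma W y i)
    <= (\prod_(j < i) (M j * L j)) * norm _ (x - y) by exact: H.
elim: i => [_|i IH iD]; first by rewrite big_ord0 mul1r.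
rewrite (le_trans (sL i iD _ _))// -mulmxBr.
apply: (le_trans (ler_wpM2l (L0 i iD) (WM i iD _))).
apply: (le_trans (ler_wpM2l (L0 i iD) (ler_wpM2l (M0 i iD) (IH (ltnW iD))))).
by rewrite big_ord_recr /= le_eqVlt; apply/orP; left; apply/eqP; ring.
Qed.

End norms.

(** * Hyperbolic cosine of a Euclidean norm *)

Definition cosh (R : realType) (x : R) : R := (expR x + expR (- x)) / 2.

Section cosh.
Variable R : realType.
Implicit Types a b c r x y : R.

Lemma nondecreasing_is_derive (f df : R -> R) a b : a <= b ->
  (forall x : R, is_derive x 1 f (df x)) ->
  (forall x, a <= x -> x <= b -> 0 <= df x) -> f a <= f b.
Proof.
move=> ab fd df0.
have [|c cab E] := @MVT_segment _ f df a b ab.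
  by apply: derivable_within_continuous => x _; case: (fd x).
by rewrite -subr_ge0 E mulr_ge0 ?subr_ge0// df0// ?(itvP cab).
Qed.

Lemma cosh_ge0 x : 0 <= cosh x.
Proof. by rewrite divr_ge0// addr_ge0// expR_ge0. Qed.

Lemma coshN x : cosh (- x) = cosh x.
Proof. by rewrite /cosh opprK addrC. Qed.

Lemma le_cosh x y : `|x| <= `|y| -> cosh x <= cosh y.
Proof. by move=> xy; rewrite ler_pM2r// expRD_expRN_abs. Qed.

Lemma cosh_le_gauss x : cosh x <= expR (x ^+ 2 / 2).
Proof.
wlog x0 : x / 0 <= x.
  move=> H; case: (ger0P x) => x0; first exact: H.
  by rewrite -coshN -sqrrN; apply: H; rewrite oppr_ge0 ltW.
(* This is the sign of the derivative of the second [f] below, after division by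
   [expR (- y - y ^+ 2 / 2)]. *)
have psi y : 0 <= y -> (1 - y) * expR (2 * y) <= 1 + y.
  move=> y0; rewrite -subr_ge0.
  pose f (y : R) := 1 + y - (1 - y) * expR (2 * y).
  have -> : 0 = f 0 by rewrite /f !(mulr0, addr0, subr0) expR0; ring.
  apply: (@nondecreasing_is_derive f (fun y => 1 - (1 - 2 * y) * expR (2 * y))) => //.
    move=> z; apply: is_derive_eq; rewrite /GRing.scale /=; ring.
  move=> z z0 _; have := expR_ge1Dx (- (2 * z)).
  move=> /(ler_wpM2r (expR_ge0 (2 * z))); rewrite -expRD addNr expR0; lra.
pose f (y : R) := - (expR (y - y ^+ 2 / 2) + expR (- y - y ^+ 2 / 2)).
have : f 0 <= f x.
  pose df (y : R) := - ((1 - y) * expR (y - y ^+ 2 / 2) +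
    (- 1 - y) * expR (- y - y ^+ 2 / 2)).
  apply: (@nondecreasing_is_derive f df) => //.
    by move=> z; apply: is_derive_eq; rewrite /df /GRing.scale /=; field.
  move=> z z0 _; rewrite /df.
  have -> : expR (z - z ^+ 2 / 2) = expR (2 * z) * expR (- z - z ^+ 2 / 2).
    by rewrite -expRD; congr expR; ring.
  have := ler_wpM2r (expR_ge0 (- z - z ^+ 2 / 2)) (psi z z0); lra.
rewrite /f expr0n /= !(mul0r, subr0, oppr0) expR0 !expRD => H.
have {H} : (expR x + expR (- x)) * expR (- (x ^+ 2 / 2)) <= 2.
  by move: H; rewrite lerN2 mulrDl.
rewrite (expRN (x ^+ 2 / 2)) ler_pdivrMr ?expR_gt0// /cosh; lra.
Qed.

(** Monotonicity of [sinh z / z], cleared of denominators: the difference of the two sides grows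
    with [y] since [sinh x <= x * cosh x <= x * cosh y]. *)
Lemma sinh_ratio x y : 0 <= x -> x <= y ->
  y * (expR x - expR (- x)) <= x * (expR y - expR (- y)).
Proof.
move=> x0 xy.
have sh z : 0 <= z -> 0 <= expR z - expR (- z).
  by move=> z0; rewrite subr_ge0 ler_expR; lra.
have k : expR x - expR (- x) <= x * (expR x + expR (- x)).
  rewrite -subr_ge0.
  pose f (y : R) := y * (expR y + expR (- y)) - (expR y - expR (- y)).
  have -> : 0 = f 0 by rewrite /f oppr0 expR0; ring.
  apply: (@nondecreasing_is_derive f (fun y => y * (expR y - expR (- y)))) => //.
    move=> z; apply: is_derive_eq; rewrite /GRing.scale /=; ring.
  by move=> z z0 _; rewrite mulr_ge0// sh.
rewrite -subr_ge0.
pose f (y : R) := x * (expR y - expR (- y)) - y * (expR x - expR (- x)).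
have -> : 0 = f x by rewrite /f subrr.
apply: (@nondecreasing_is_derive f
    (fun y => x * (expR y + expR (- y)) - (expR x - expR (- x)))) => //.
  move=> z; apply: is_derive_eq; rewrite /GRing.scale /=; ring.
move=> z xz _; rewrite subr_ge0 (le_trans k)// ler_wpM2l//.
by apply: expRD_expRN_abs; rewrite !ger0_norm// (le_trans x0).
Qed.

(* convexity of [cosh (sqrt u)]: tangent line at [u = r ^+ 2] *)
Lemma cosh_tangent r x : 0 < r ->
  cosh r + (expR r - expR (- r)) / (4 * r) * (x ^+ 2 - r ^+ 2) <= cosh x.
Proof.
move=> r0; wlog x0 : x / 0 <= x.
  move=> H; case: (ger0P x) => x0; first exact: H.
  by rewrite -(coshN x) -(sqrrN x); apply: H; rewrite oppr_ge0 ltW.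
set A := _ / _.
pose f y := cosh y - A * y ^+ 2.
pose df y := (expR y - expR (- y)) / 2 - 2 * A * y.
have fd : forall z : R, is_derive z 1 f (df z).
  by move=> z; apply: is_derive_eq; rewrite /df /GRing.scale /=; field.
have dfE y : df y = (r * (expR y - expR (- y)) - y * (expR r - expR (- r))) / (2 * r).
  by rewrite /df /A; field; rewrite gt_eqF.
suff : f r <= f x by rewrite /f; lra.
have r20 : 0 <= (2 * r)^-1 by rewrite invr_ge0; lra.
have [rx|xr] := leP r x.
  apply: (nondecreasing_is_derive rx fd) => z rz _.
  by rewrite dfE mulr_ge0// subr_ge0 sinh_ratio// ltW.
rewrite -lerN2; apply: (@nondecreasing_is_derive (fun y => - f y)
    (fun y => - df y)) (ltW xr) _ _.
move=> z xz zr; rewrite dfE oppr_ge0 mulr_le0_ge0// subr_le0 sinh_ratio//.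
exact: le_trans xz.
Qed.

(** The product is the mean of [cosh (a + b)] and [cosh (a - b)], whose squared arguments average to
    [a ^+ 2 + b ^+ 2]. Taking the tangent of [cosh (sqrt u)] there, the first-order terms cancel. *)
Lemma cosh_sqrtD a b : cosh (Num.sqrt (a ^+ 2 + b ^+ 2)) <= cosh a * cosh b.
Proof.
set r := Num.sqrt _.
have r2 : r ^+ 2 = a ^+ 2 + b ^+ 2 by rewrite sqr_sqrtr// addr_ge0// sqr_ge0.
have -> : cosh a * cosh b = (cosh (a + b) + cosh (a - b)) / 2.
  by rewrite /cosh !opprD !opprK !expRD; field.
have [r0|r0] := eqVneq r 0.
  rewrite r0.
  have c1 x : cosh 0 <= cosh x by apply: le_cosh; rewrite normr0.
  by have := c1 (a + b); have := c1 (a - b); lra.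
have rp : 0 < r by rewrite lt_neqAle eq_sym r0 sqrtr_ge0.
have := cosh_tangent (a + b) rp; have := cosh_tangent (a - b) rp.
set A := _ / _.
have : A * ((a + b) ^+ 2 - r ^+ 2) + A * ((a - b) ^+ 2 - r ^+ 2) = 0.
  by rewrite r2; ring.
lra.
Qed.

Lemma cosh_sqrt_sum n (v : 'I_n -> R) :
  cosh (Num.sqrt (\sum_i v i ^+ 2)) <= \prod_i cosh (v i).
Proof.
elim: n v => [v|n IH v].
  by rewrite !big_ord0 sqrtr0 /cosh oppr0 expR0; lra.
rewrite !big_ord_recl.
set S := \sum_i _; have S0 : 0 <= S by apply: sumr_ge0 => i _; exact: sqr_ge0.
have := cosh_sqrtD (v ord0) (Num.sqrt S).
rewrite (sqr_sqrtr S0) => /le_trans; apply.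
by rewrite ler_wpM2l ?cosh_ge0// IH.
Qed.

Lemma prod_cosh n (v : 'I_n -> R) :
  \prod_i cosh (v i) =
  (\sum_(A : {set 'I_n}) expR (\sum_i sgset R A i * v i)) / 2 ^+ n.
Proof.
rewrite big_split /= prodr_const card_ord -exprVn; congr (_ * _).
rewrite bigA_distr; apply: eq_big => // A _.
rewrite expR_sum; apply: eq_bigr => i _; rewrite /sgset.
by case: ifP => _; rewrite ?mul1r ?mulN1r.
Qed.

End cosh.

(** * Powers of a probability measure *)

Section power.
Context (R : realType) d (T : measurableType d).

Definition cons_pair n (p : T * n.-tuple T) : n.+1.-tuple T :=
  [tuple of p.1 :: p.2].

Lemma measurable_cons_pair n : measurable_fun [set: T * n.-tuple T] (@cons_pair n).
Proof. exact: measurable_cons. Qed.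

HB.instance Definition _ n :=
  isMeasurableFun.Build _ _ _ _ (@cons_pair n) (@measurable_cons_pair n).

Variable mu : probability T R.

(** The product measure in recursive form, for inductions that integrate out the first point. *)
Fixpoint power n : probability (n.-tuple T) R :=
  match n with
  | 0 => \d_ ([tuple] : 0.-tuple T)
  | n.+1 => distribution (mu \x power n)%E (@cons_pair n)
  end.

Lemma power_integral0 (f : 0.-tuple T -> \bar R) : measurable_fun [set: 0.-tuple T] f ->
  (\int[power 0]_z f z = f [tuple])%E.
Proof. by move=> mf; rewrite /= integral_dirac// diracT mul1e. Qed.

Lemma power_integralS n (f : n.+1.-tuple T -> \bar R) :
  measurable_fun [set: n.+1.-tuple T] f -> (forall z, 0 <= f z)%E ->
  (\int[power n.+1]_z f z = \int[mu]_x \int[power n]_t f [tuple of x :: t])%E.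
Proof.
move=> mf f0; rewrite /= ge0_integral_distribution//.
rewrite fubini_tonelli1//; last by move=> x; exact: f0.
exact: (measurableT_comp mf (@measurable_cons_pair n)).
Qed.

Lemma power_rectangle n (A : 'I_n -> set T) : (forall i, measurable (A i)) ->
  power n [set z | forall i, A i (tnth z i)] = (\prod_i mu (A i))%E.
Proof.
elim: n A => [A _|n IH A mA].
  by rewrite big_ord0 /= diracE mem_set//= => -[].
rewrite big_ord_recl -(IH (fun i => A (lift ord0 i)))// /=.
rewrite /distribution /pushforward -product_measure1E//.
  congr (_ _); apply/seteqP; split => -[x t] /=.
    move=> H; split; first exact: (H ord0).
    by move=> i; have := H (lift ord0 i); rewrite tnthS.
  move=> [H1 H2] i; case: (unliftP ord0 i) => [j|] ->; last by [].
  by rewrite tnthS; exact: H2.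
rewrite (_ : [set _ | _] = \big[setI/setT]_i
   ((fun z : n.-tuple T => tnth z i) @^-1` A (lift ord0 i))).
  apply: bigsetI_measurable => i _; rewrite -[X in measurable X]setTI.
  exact: measurable_tnth.
by apply/seteqP; split => z /=; rewrite -bigcap_seq /= => H i; [move=> _; exact: H|exact: (H i (mem_index_enum i))].
Qed.

End power.

(** Independence and common law in one product formula on full rectangles; [setT] factors recover
    subfamilies. The index type is an arbitrary finite type so that samples can be merged and
    reindexed. *)
Definition iid (R : realType) d dO (T : measurableType d)
    (Omega : measurableType dO) (P : probability Omega R) (mu : probability T R)
    (I : finType) (Z : I -> Omega -> T) :=
  forall A : I -> set T, (forall i, measurable (A i)) ->
    P [set w | forall i, A i (Z i w)] = (\prod_i mu (A i))%E.

Section iid.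
Context (R : realType) d dO (T : measurableType d) (Omega : measurableType dO).
Variables (P : probability Omega R) (mu : probability T R).
Local Open Scope ereal_scope.

(** Indices outside the image of [h] receive [setT], of measure 1; injectivity prevents two indices
    from sharing a point. *)
Lemma iid_injective (I J : finType) (Z : I -> Omega -> T) (h : J -> I) :
  injective h -> iid P mu Z -> iid P mu (fun j => Z (h j)).
Proof.
move=> h_inj HZ A mA.
pose B i := if [pick j | h j == i] is Some j then A j else setT.
have Bh j : B (h j) = A j.
  rewrite /B; case: pickP => [j' /eqP/h_inj -> //|/(_ j)].
  by rewrite eqxx.
rewrite (_ : [set _ | _] = [set w | forall i, B i (Z i w)]); last first.
  apply/seteqP; split => w /= H; last by move=> j; have := H (h j); rewrite Bh.
  by move=> i; rewrite /B; case: pickP => // j /eqP <-; exact: H.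
rewrite HZ; last by move=> i; rewrite /B; case: pickP.
rewrite (bigID (fun i => i \in codom h)) /= [X in _ * X]big1 ?mule1; last first.
  move=> i ih; rewrite /B; case: pickP => [j /eqP jE|_].
    by move: ih; rewrite -jE codom_f.
  by rewrite probability_setT.
rewrite -[in LHS]big_filter (perm_big (map h (index_enum J))) /=.
  by rewrite big_map; apply: eq_bigr => j _; rewrite Bh.
apply: uniq_perm.
- by rewrite filter_uniq// index_enum_uniq.
- by rewrite map_inj_uniq// index_enum_uniq.
move=> i; rewrite mem_filter mem_index_enum andbT.
apply/codomP/mapP => [[j ->]|[j _ ->]]; by exists j.
Qed.

Lemma iid_marginal (I : finType) (Z : I -> Omega -> T) i (A : set T) :
  iid P mu Z -> measurable A -> P (Z i @^-1` A) = mu A.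
Proof.
move=> HZ mA; have := HZ (fun j => if j == i then A else setT).
rewrite (bigD1 i) //= eqxx [X in _ * X]big1 ?mule1; last first.
  by move=> j /negbTE ->; rewrite probability_setT.
move=> <-; last by move=> j; case: ifP.
congr (P _); apply/seteqP; split => w /= H; last by have := H i; rewrite eqxx.
by move=> j; case: eqP => // ->.
Qed.

Lemma measurable_rectangle n (A : 'I_n -> set T) :
  (forall i, measurable (A i)) ->
  measurable [set z : n.-tuple T | forall i, A i (tnth z i)].
Proof.
move=> mA; rewrite (_ : [set _ | _] = \big[setI/setT]_i
   ((fun z : n.-tuple T => tnth z i) @^-1` A i)).
  apply: bigsetI_measurable => i _; rewrite -[X in measurable X]setTI.
  exact: measurable_tnth.
apply/seteqP; split => z /=; rewrite -bigcap_seq /= => H i.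
  by move=> _; exact: H.
exact: (H i (mem_index_enum i)).
Qed.

(** Rectangles are stable under intersection and generate the sigma-algebra of tuples. *)
Lemma tuple_measure_unique n (m1 m2 : probability (n.-tuple T) R) :
  (forall A : 'I_n -> set T, (forall i, measurable (A i)) ->
    m1 [set z | forall i, A i (tnth z i)] = m2 [set z | forall i, A i (tnth z i)]) ->
  forall B, measurable B -> m1 B = m2 B.
Proof.
move=> m12.
pose G : set (set (n.-tuple T)) :=
  [set [set z | forall i, A i (tnth z i)] | A in
    [set A : 'I_n -> set T | forall i, measurable (A i)]].
apply: (@measure_unique _ _ _ G (fun=> setT)).
- apply/seteqP; split; last first.
    apply: smallest_sub; first exact: sigma_algebra_measurable.
    by move=> _ [A mA <-]; exact: measurable_rectangle.
  apply: smallest_sub; first exact: smallest_sigma_algebra.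
  move=> B /=; rewrite -bigcup_seq => -[i _] [C mC <-]; apply: sub_sigma_algebra.
  exists (fun j => if j == i then C else setT) => [j|]; first by case: ifP.
  apply/seteqP; split => z /= H; last first.
    by move=> j; case: eqP => // ->; case: H.
  by split => //; have := H i; rewrite eqxx.
- move=> _ _ [A mA <-] [B mB <-]; exists (fun i => A i `&` B i).
    by move=> i; exact: measurableI.
  apply/seteqP; split => z /=; first by move=> H; split => i; case: (H i).
  by move=> [H1 H2] i; split.
- by move=> _; exists (fun=> setT) => //; apply/seteqP; split.
- by apply/seteqP; split => // z _; exists 0%N.
- by move=> _ [A mA <-]; exact: m12.
- by move=> _; rewrite (le_lt_trans (probability_le1 _ _)) ?ltry.
Qed.

Lemma measurable_mktuple n (Z : 'I_n -> Omega -> T) :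
  (forall i, measurable_fun setT (Z i)) ->
  measurable_fun setT (fun w => [tuple Z i w | i < n]).
Proof.
move=> mZ; apply/measurable_fun_tnthP => i.
by rewrite (_ : _ \o _ = Z i)//; apply/funext => w /=; rewrite tnth_mktuple.
Qed.

Lemma iid_ge0_integral n (Z : 'I_n -> Omega -> T) (f : n.-tuple T -> \bar R) :
  (forall i, measurable_fun setT (Z i)) -> iid P mu Z ->
  measurable_fun [set: n.-tuple T] f -> (forall z, 0 <= f z) ->
  \int[P]_w f [tuple Z i w | i < n] = \int[power mu n]_z f z.
Proof.
move=> mZ HZ mf f0.
pose X : {mfun Omega >-> n.-tuple T} :=
  HB.pack_for {mfun Omega >-> n.-tuple T} (fun w => [tuple Z i w | i < n])
   (isMeasurableFun.Build _ _ _ _ _ (measurable_mktuple mZ)).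
rewrite (_ : \int[P]_w _ = \int[P]_w ((f \o X) w))//.
rewrite -ge0_integral_distribution//; apply: eq_measure_integral => B mB _.
apply: (tuple_measure_unique (m1 := distribution P X)) mB => A mA.
rewrite power_rectangle// -HZ// /distribution /pushforward; congr (P _).
by apply/seteqP; split => w /= H i; have := H i; rewrite tnth_mktuple.
Qed.

Lemma iid_ge0_integral1 (I : finType) (Z : I -> Omega -> T) i (f : T -> \bar R) :
  measurable_fun setT (Z i) -> iid P mu Z ->
  measurable_fun setT f -> (forall z, 0 <= f z) ->
  \int[P]_w f (Z i w) = \int[mu]_z f z.
Proof.
move=> mZ HZ mf f0.
rewrite (_ : \int[P]_w _ = \int[P]_(w in Z i @^-1` setT) ((f \o Z i) w))//.
rewrite -ge0_integral_pushforward//; apply: eq_measure_integral => B mB _.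
exact: iid_marginal.
Qed.

Lemma iid_integrable1 (I : finType) (Z : I -> Omega -> T) i (f : T -> \bar R) :
  measurable_fun setT (Z i) -> iid P mu Z ->
  mu.-integrable setT f -> P.-integrable setT (fun w => f (Z i w)).
Proof.
move=> mZ HZ /integrableP[mf fi]; apply/integrableP; split.
  exact: (measurableT_comp mf).
rewrite (iid_ge0_integral1 (f := fun x => `|f x|) mZ HZ)//.
exact: (measurableT_comp _ mf).
Qed.

Lemma iid_integral1 (I : finType) (Z : I -> Omega -> T) i (f : T -> \bar R) :
  measurable_fun setT (Z i) -> iid P mu Z ->
  mu.-integrable setT f ->
  \int[P]_w f (Z i w) = \int[mu]_z f z.
Proof.
move=> mZ HZ fi; have mf := measurable_int _ fi.
rewrite (_ : \int[P]_w _ = \int[P]_(w in Z i @^-1` setT) ((f \o Z i) w))//.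
rewrite -integral_pushforward//; last by rewrite preimage_setT; exact: (iid_integrable1 mZ HZ fi).
by apply: eq_measure_integral => B mB _; exact: iid_marginal.
Qed.

End iid.

Lemma power_iid (R : realType) d (T : measurableType d) (mu : probability T R) n :
  iid (power mu n) mu (fun (i : 'I_n) z => tnth z i).
Proof. by move=> A mA; exact: power_rectangle. Qed.

Lemma power_pair_iid (R : realType) d (T : measurableType d)
    (mu : probability T R) n m :
  iid (power mu n \x power mu m)%E mu (fun (s : 'I_n + 'I_m) z =>
    match s with inl i => tnth z.1 i | inr j => tnth z.2 j end).
Proof.
move=> A mA.
rewrite (_ : [set _ | _] = [set z | forall i, A (inl i) (tnth z i)] `*`
  [set z | forall j, A (inr j) (tnth z j)]); last first.
  apply/seteqP; split => -[z z'] /=; first by move=> H; split => i; [exact: (H (inl i))|exact: (H (inr i))].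
  by move=> [H1 H2] [i|j].
rewrite [LHS](product_measure1E (power mu n) (power mu m)); last 2 first.
- by apply: (@measurable_rectangle _ _ n (fun i => A (inl i))) => i; exact: mA.
- by apply: (@measurable_rectangle _ _ m (fun j => A (inr j))) => i; exact: mA.
have /= E1 := @power_rectangle R d T mu n (fun i => A (inl i)) (fun i => mA (inl i)).
have /= E2 := @power_rectangle R d T mu m (fun i => A (inr i)) (fun i => mA (inr i)).
by rewrite [X in (X * _)%E]E1 [X in (_ * X)%E]E2 big_sumType.
Qed.

(** * Measurability of Lipschitz functions of a sample *)

Section lipschitz_measurable.
Variables (R : realType) (h : nat).
Local Notation T := (borel_cV R h).

Lemma measurable_coord (i : 'I_h) :
  measurable_fun [set: T] (fun x : T => (x : 'cV[R]_h) i 0).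
Proof.
apply: (measurability _ (RGenOpens.measurableE R)) => //= _ [B [a [b ->]] <-].
rewrite setTI; apply: sub_sigma_algebra.
have /continuousP := @coord_continuous R h 1 i 0; apply.
exact: interval_open.
Qed.

Lemma l2norm_le_sum n (v : 'cV[R]_n) : l2norm v <= \sum_i `|v i 0|.
Proof.
have s0 : 0 <= \sum_i `|v i 0| by rewrite sumr_ge0.
rewrite -ler_sqr ?nnegrE ?l2norm_ge0// l2norm_sqr expr2 mulr_suml ler_sum// => i _.
rewrite -real_normK ?num_real// expr2 ler_wpM2l// (bigD1 i) //= lerDl.
by rewrite sumr_ge0.
Qed.

Lemma measurable_countable_fun d (U : measurableType d) d' (V : measurableType d')
    (C : countType) (phi : U -> C) (g : C -> V) :
  (forall c, measurable (phi @^-1` [set c])) ->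
  measurable_fun setT (g \o phi).
Proof.
move=> mphi _ B mB; rewrite setTI.
rewrite (_ : _ @^-1` B =
    \bigcup_c (if g c \in B then phi @^-1` [set c] else set0)).
  apply: countable_bigcupT_measurable; first exact: countableP.
  by move=> c; case: ifP.
apply/seteqP; split => x /=.
  by move=> Bx; exists (phi x) => //; rewrite mem_set.
by move=> [c _]; case: ifPn => // /set_mem Bc /= ->.
Qed.

Definition grid (q : nat) (x : 'cV[R]_h) : 'cV[int]_h :=
  \col_i Num.floor (q.+1%:R * x i 0).

Definition grid_point (q : nat) (v : 'cV[int]_h) : 'cV[R]_h :=
  \col_i ((v i 0)%:~R / q.+1%:R).

Lemma grid_close q x : l2norm (grid_point q (grid q x) - x) <= h%:R / q.+1%:R.
Proof.
rewrite (le_trans (l2norm_le_sum _))// [leRHS](_ : _ = \sum_(i < h) q.+1%:R^-1).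
  apply: ler_sum => i _; rewrite !mxE.
  have q0 : 0 < q.+1%:R :> R by rewrite ltr0n.
  have /andP[] := floor_itv (q.+1%:R * x i 0).
  set y := Num.floor _; rewrite intrD => h1 h2.
  rewrite -(ler_pM2r q0) mulVf ?gt_eqF// -[X in _ * X](ger0_norm (ltW q0)).
  rewrite -normrM mulrBl divfK ?gt_eqF// ler_norml; apply/andP; split; lra.
by rewrite sumr_const card_ord mulr_natl.
Qed.

Lemma measurable_grid q (v : 'cV[int]_h) :
  measurable [set x : T | grid q x = v].
Proof.
rewrite (_ : [set _ | _] = \big[setI/setT]_i
    ((fun x : T => q.+1%:R * (x : 'cV[R]_h) i 0) @^-1`
      `[(v i 0)%:~R, (v i 0 + 1)%:~R[%classic)).
  apply: bigsetI_measurable => i _; rewrite -[X in measurable X]setTI.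
  have mf : measurable_fun [set: T] (fun x : T => q.+1%:R * (x : 'cV[R]_h) i 0).
    by apply: measurable_funM => //; exact: measurable_coord.
  by apply: mf => //; exact: measurable_itv.
apply/seteqP; split => x /=; rewrite -bigcap_seq /=.
  by move=> <- i _ /=; rewrite in_itv /= mxE; exact: floor_itv.
move=> H; apply/colP => i; rewrite mxE; apply: floor_def.
by have := H i (mem_index_enum i); rewrite /= in_itv.
Qed.

(* A Lipschitz functional is the limit of its compositions with the roundings
   to finer and finer grids, which take countably many values. *)
Lemma lipschitz_measurable n (g : n.-tuple T -> R) c :
  (forall z z', `|g z - g z'| <=
     c * \sum_i l2norm ((tnth z i : 'cV[R]_h) - tnth z' i)) ->
  measurable_fun [set: n.-tuple T] g.
Proof.
move=> gL.
pose code q (z : n.-tuple T) : n.-tuple 'cV[int]_h :=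
  [tuple grid q (tnth z i) | i < n].
pose dec q (v : n.-tuple 'cV[int]_h) : n.-tuple T :=
  [tuple (grid_point q (tnth v i) : T) | i < n].
apply: (@measurable_fun_cvg _ _ _ setT (fun q => g \o dec q \o code q)).
  move=> q; apply: measurable_countable_fun => v.
  rewrite (_ : _ @^-1` _ =
      [set z | forall i, [set x : T | grid q x = tnth v i] (tnth z i)]).
    by apply: (@measurable_rectangle _ _ n
      (fun i => [set x : T | grid q x = tnth v i])) => i; exact: measurable_grid.
  apply/seteqP; split => z /=; first by move=> <- i; rewrite tnth_mktuple.
  by move=> H; apply: eq_from_tnth => i; rewrite tnth_mktuple.
move=> z _.
have c0 : 0 <= `|c| by [].
apply/cvgrPdist_le => e e0.
have [q0 _ Hq] : \forall q \near \oo, `|c| * (n%:R * (h%:R / q.+1%:R)) <= e.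
  pose K := `|c| * (n%:R * h%:R) / e.
  have K0 : 0 <= K by rewrite /K !mulr_ge0// invr_ge0 ltW.
  exists (Num.trunc K).+1 => // q /= Kq.
  have : K <= q.+1%:R.
    rewrite (le_trans (ltW (truncnS_gt K)))// ler_nat.
    by rewrite (leq_trans Kq).
  rewrite /K ler_pdivrMr// => Kq'.
  have q1 : 0 < q.+1%:R :> R by rewrite ltr0n.
  by rewrite !mulrA ler_pdivrMr// -mulrA mulrC [leRHS]mulrC mulrC.
exists q0 => // q /= /Hq; apply: le_trans.
apply: (le_trans (gL _ _)).
apply: (@le_trans _ _ (`|c| * \sum_i l2norm ((tnth z i : 'cV[R]_h) - tnth (dec q (code q z)) i))).
  by rewrite ler_wpM2r ?ler_norm// sumr_ge0// => i _; exact: l2norm_ge0.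
rewrite ler_wpM2l//.
rewrite [leRHS](_ : _ = \sum_(i < n) (h%:R / q.+1%:R)); last first.
  by rewrite sumr_const card_ord mulr_natl.
apply: ler_sum => i _; rewrite !tnth_mktuple.
rewrite -opprB -scaleN1r l2normZ normrN1 mul1r; exact: grid_close.
Qed.

Lemma lipschitz_measurable1 (f : T -> R) c :
  (forall x y, `|f x - f y| <= c * l2norm ((x : 'cV[R]_h) - y)) ->
  measurable_fun [set: T] f.
Proof.
move=> fL.
have mg : measurable_fun [set: 1.-tuple T] (fun z => f (tnth z ord0)).
  by apply: (@lipschitz_measurable _ _ c) => z z'; rewrite big_ord1; exact: fL.
rewrite (_ : f = (fun z : 1.-tuple T => f (tnth z ord0)) \o
  (fun x : T => [tuple of x :: [tuple]])) //.
apply: measurableT_comp mg _.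
exact: measurable_cons.
Qed.

End lipschitz_measurable.

(** * Concentration *)

Section real_integrals.
Context (R : realType) d (T : measurableType d) (P : probability T R).
Local Open Scope ereal_scope.
Implicit Types f g u : T -> R.

Lemma le_integral_real f g : measurable_fun setT f -> measurable_fun setT g ->
  (forall x, 0 <= f x)%R -> (forall x, f x <= g x)%R ->
  \int[P]_x (f x)%:E <= \int[P]_x (g x)%:E.
Proof.
move=> mf mg f0 fg; apply: ge0_le_integral => //.
- by move=> x _; rewrite lee_fin.
- exact/measurable_EFinP.
- exact/measurable_EFinP.
- by move=> x _; rewrite lee_fin.
Qed.

Lemma integral_probability_cst (c : R) : \int[P]_x c%:E = c%:E.
Proof. by rewrite integral_cst//= probability_setT mule1. Qed.

Lemma integral_realZl f (c : R) : measurable_fun setT f ->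
  (forall x, 0 <= f x)%R -> (0 <= c)%R ->
  \int[P]_x (c * f x)%:E = c%:E * \int[P]_x (f x)%:E.
Proof.
move=> mf f0 c0; rewrite -ge0_integralZl_EFin//.
- by move=> x _; rewrite lee_fin.
- exact/measurable_EFinP.
Qed.

Lemma integral_realD f g : measurable_fun setT f -> measurable_fun setT g ->
  (forall x, 0 <= f x)%R -> (forall x, 0 <= g x)%R ->
  \int[P]_x (f x + g x)%:E = \int[P]_x (f x)%:E + \int[P]_x (g x)%:E.
Proof.
move=> mf mg f0 g0; rewrite -ge0_integralD//.
- by move=> x _; rewrite lee_fin.
- exact/measurable_EFinP.
- by move=> x _; rewrite lee_fin.
- exact/measurable_EFinP.
Qed.

Lemma integral_real_sum (I : finType) (f : I -> T -> R) :
  (forall i, measurable_fun setT (f i)) -> (forall i x, 0 <= f i x)%R ->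
  \int[P]_x (\sum_i f i x)%R%:E = \sum_i \int[P]_x (f i x)%:E.
Proof.
move=> mf f0; rewrite -ge0_integral_sum//.
- by apply: eq_integral => x _; rewrite sumEFin.
- by move=> i; exact/measurable_EFinP.
- by move=> i x _; rewrite lee_fin.
Qed.

(** Here [f] is signed, hence the detour through its positive part, and the integral of [g] may be
    infinite. *)
Lemma integral_le_ge0 f g : P.-integrable setT (EFin \o f) ->
  measurable_fun setT g -> (forall x, 0 <= g x)%R -> (forall x, f x <= g x)%R ->
  \int[P]_x (f x)%:E <= \int[P]_x (g x)%:E.
Proof.
move=> fi mg g0 fg; rewrite integralE.
have mf := measurable_int _ fi.
apply: (@le_trans _ _ (\int[P]_x (EFin \o f)^\+ x)).
  rewrite leeBlDr; last exact: integrable_neg_fin_num.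
  rewrite leeDl//; apply: integral_ge0 => x _.
  exact: funeneg_ge0.
apply: ge0_le_integral => //.
- exact: measurable_funepos.
- exact/measurable_EFinP.
- by move=> x _; rewrite funeposE ge_max /= !lee_fin fg g0.
Qed.

(** Jensen's inequality, by integrating the tangent line of [expR] at [I]. *)
Lemma expR_integral_le u (I : R) : measurable_fun setT u ->
  P.-integrable setT (EFin \o u) -> \int[P]_x (u x)%:E = I%:E ->
  (expR I)%:E <= \int[P]_x (expR (u x))%:E.
Proof.
move=> mu ui uI.
pose v x := (expR I * (1 - I) + expR I * u x)%R.
have vE : EFin \o v = (EFin \o cst (expR I * (1 - I))%R) \+
    (fun x => (expR I)%:E * (EFin \o u) x).
  by apply/funext => x /=; rewrite -EFinM -EFinD.
have c1i : P.-integrable setT (EFin \o cst (expR I * (1 - I))%R).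
  exact: finite_measure_integrable_cst.
have c2i : P.-integrable setT (fun x => (expR I)%:E * (EFin \o u) x).
  exact: integrableZl.
have vi : P.-integrable setT (EFin \o v) by rewrite vE; exact: integrableD.
have -> : (expR I)%:E = \int[P]_x (v x)%:E.
  rewrite (_ : (fun x => (v x)%:E) = EFin \o v)// vE integralD//= integralZl//=.
  rewrite integral_probability_cst uI -EFinM -EFinD; congr EFin; ring.
apply: integral_le_ge0 => //.
  exact: measurableT_comp.
move=> x; rewrite /v -mulrDr.
have -> : expR (u x) = (expR I * expR (u x - I))%R.
  by rewrite -expRD; congr expR; ring.
rewrite ler_wpM2l ?expR_ge0//.
have := expR_ge1Dx (u x - I); lra.
Qed.

End real_integrals.

Lemma sume_cst (R : realType) n (x : \bar R) : (0 <= x)%E ->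
  (\sum_(i < n) x = n%:R%:E * x)%E.
Proof.
move=> x0; elim: n => [|n IH]; first by rewrite big_ord0 mul0e.
by rewrite big_ord_recr /= IH -natr1 EFinD ge0_muleDl ?lee_fin// mul1e.
Qed.

Lemma integral_prod_mul (R : realType) d1 d2 (T1 : measurableType d1)
    (T2 : measurableType d2) (P1 : probability T1 R) (P2 : probability T2 R)
    (u : T1 -> R) (v : T2 -> R) :
  measurable_fun setT u -> measurable_fun setT v ->
  (forall x, 0 <= u x) -> (forall y, 0 <= v y) ->
  (\int[P1 \x P2]_z (u z.1 * v z.2)%:E =
   (\int[P1]_x (u x)%:E) * (\int[P2]_y (v y)%:E))%E.
Proof.
move=> mu mv u0 v0; rewrite fubini_tonelli1//=; last 2 first.
- apply/measurable_EFinP; apply: measurable_funM.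
    exact: measurableT_comp.
  exact: measurableT_comp.
- by move=> z; rewrite lee_fin mulr_ge0.
rewrite /fubini_F /=.
under eq_integral do rewrite integral_realZl//.
rewrite ge0_integralZr//.
- exact/measurable_EFinP.
- by move=> x _; rewrite lee_fin.
- by apply: integral_ge0 => y _; rewrite lee_fin.
Qed.

Lemma power_integral_leS (R : realType) d (T : measurableType d)
    (mu : probability T R) n (F : n.+1.-tuple T -> R) (k : T -> R) :
  measurable_fun [set: n.+1.-tuple T] F -> (forall z, 0 <= F z) ->
  measurable_fun setT k ->
  (forall x, \int[power mu n]_t (F [tuple of x :: t])%:E <= (k x)%:E)%E ->
  (\int[power mu n.+1]_z (F z)%:E <= \int[mu]_x (k x)%:E)%E.
Proof.
move=> mF F0 mk Fk; rewrite power_integralS; last 2 first.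
- exact/measurable_EFinP.
- by move=> z; rewrite lee_fin.
apply: ge0_le_integral => //.
- by move=> x _; apply: integral_ge0 => t _; rewrite lee_fin.
- apply: (@measurable_fun_fubini_tonelli_F _ _ _ _ _ _
    (fun p => (F (cons_pair p))%:E)).
    apply/measurable_EFinP.
    exact: (measurableT_comp mF (@measurable_cons_pair _ _ n)).
  by move=> p; rewrite lee_fin.
- exact/measurable_EFinP.
Qed.

Section subgaussian.
Variables (R : realType) (h : nat).
Local Notation T := (borel_cV R h).
Variables (mu : probability T R) (Gamma : R).

(** The moment condition of [P_uB] with [tau] relaxed to [Gamma], so that one parameter serves both
    samples. *)
Definition subgaussian := forall a : 'cV[R]_h,
  (\int[mu]_x (expR (dot a ((x : 'cV[R]_h) - mean mu)))%:E
     <= (expR (l2norm a ^+ 2 * Gamma ^+ 2 / 2))%:E)%E.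

Hypothesis mu_int : forall i : 'I_h,
  mu.-integrable setT (fun x => ((x : 'cV[R]_h) i 0)%:E).

Lemma measurable_dotB (a m : 'cV[R]_h) :
  measurable_fun setT (fun x : T => dot a ((x : 'cV[R]_h) - m)).
Proof.
apply: (@lipschitz_measurable1 _ _ _ (l2norm a)) => x y.
by rewrite !dotB opprB addrA subrK -dotB dot_le.
Qed.

Lemma measurable_expR_dotB (a m : 'cV[R]_h) :
  measurable_fun setT (fun x : T => expR (dot a ((x : 'cV[R]_h) - m))).
Proof. exact: (measurableT_comp _ (measurable_dotB a m)). Qed.

Lemma lipschitz_integrable1 (f : T -> R) c :
  (forall x y, `|f x - f y| <= c * l2norm ((x : 'cV[R]_h) - y)) ->
  mu.-integrable setT (EFin \o f).
Proof.
move=> fL.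
pose s := (EFin \o cst `|f (0 : 'cV[R]_h)|) \+
  (fun x : T => `|c|%:E * (\sum_i `|((x : 'cV[R]_h) i 0)%:E|)%E)%E.
apply: (@le_integrable _ _ _ _ _ measurableT _ s).
- by apply/measurable_EFinP; exact: lipschitz_measurable1 fL.
- move=> x _; rewrite /s /= sumEFin -EFinM -EFinD lee_fin.
  rewrite [leRHS]ger0_norm; last by rewrite addr_ge0// mulr_ge0// sumr_ge0.
  rewrite -[f x](subrK (f (0 : 'cV[R]_h))) (le_trans (ler_normD _ _))// addrC lerD2l.
  rewrite (le_trans (fL _ _))// subr0.
  apply: (le_trans (ler_wpM2r (l2norm_ge0 _) (ler_norm c))).
  by rewrite ler_wpM2l// l2norm_le_sum.
- apply: integrableD => //; first exact: finite_measure_integrable_cst.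
  apply: integrableZl => //; apply: integrable_sum => // i _.
  exact: integrable_abse.
Qed.

(* Symmetrising with an independent copy [y] turns [g x - g y] into a [cosh],
   and [cosh |v| <= \prod_i cosh (v i)] only involves [expR (dot a v)] with
   sign vectors [a]. *)
Lemma concentration1 (g : T -> R) c (I : R) : 0 <= c ->
  (forall x y, `|g x - g y| <= c * l2norm ((x : 'cV[R]_h) - y)) ->
  (\int[mu]_x (g x)%:E = I%:E)%E -> subgaussian ->
  (\int[mu]_x (expR (g x))%:E <=
    (expR (I + c ^+ 2 * h%:R * Gamma ^+ 2))%:E)%E.
Proof.
move=> c0 gL gI mgf.
have gi := lipschitz_integrable1 gL; have mg := lipschitz_measurable1 gL.
have mNg : measurable_fun setT (fun x => - g x) by exact: measurableT_comp.
have meg : measurable_fun setT (fun x => expR (g x)) by exact: measurableT_comp.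
have meNg : measurable_fun setT (fun x => expR (- g x)) by exact: measurableT_comp.
set Z0 := (\int[mu]_x (expR (g x))%:E)%E.
pose Z1 := (\int[mu]_x (expR (- g x))%:E)%E.
pose K := expR (c ^+ 2 * h%:R * Gamma ^+ 2).
(* The product [Z0 * Z1] is the moment of [g x - g y] for independent [x], [y]; this lower bound on
   [Z1] then releases [Z0]. *)
have Z1_ge : ((expR (- I))%:E <= Z1)%E.
  apply: expR_integral_le => //.
    by rewrite (_ : EFin \o _ = \- (EFin \o g))%E//; exact: integrableN.
  transitivity (- \int[mu]_x (g x)%:E)%E; last by rewrite gI.
  by rewrite -integralN//=; exact: integrable_add_def.
have Z01 : (Z0 * Z1 <= K%:E)%E.
  (* A sign vector scaled by [c] has squared norm [c ^+ 2 * h], the origin of the factor [h]; [x]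
     and [y] each contribute half of the exponent in [K]. *)
  pose a (A : {set 'I_h}) : 'cV[R]_h := \col_i (c * sgset R A i).
  have la A : l2norm (a A) ^+ 2 = c ^+ 2 * h%:R.
    rewrite l2norm_sqr (eq_bigr (fun=> c ^+ 2)).
      by rewrite sumr_const card_ord mulr_natr.
    by move=> i _; rewrite mxE exprMn /sgset; case: ifP; rewrite ?expr1n ?sqrrN ?expr1n mulr1.
  pose e (A : {set 'I_h}) (x : T) := expR (dot (a A) ((x : 'cV[R]_h) - mean mu)).
  pose e' (A : {set 'I_h}) (x : T) := expR (dot (- a A) ((x : 'cV[R]_h) - mean mu)).
  have e0 A x : 0 <= e A x by exact: expR_ge0.
  have e'0 A x : 0 <= e' A x by exact: expR_ge0.
  have me A : measurable_fun setT (e A) by exact: measurable_expR_dotB.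
  have me' A : measurable_fun setT (e' A) by exact: measurable_expR_dotB.
  have m1 (u : T -> R) : measurable_fun setT u ->
      measurable_fun setT (fun z : T * T => u z.1).
    by move=> mf; exact: (measurableT_comp mf).
  have m2 (u : T -> R) : measurable_fun setT u ->
      measurable_fun setT (fun z : T * T => u z.2).
    by move=> mf; exact: (measurableT_comp mf).
  (* Exchanging the two copies makes the integrand even in [g x - g y], so that only its absolute
     value matters. *)
  have step : (Z0 * Z1 + Z1 * Z0 <= (2 * K)%:E)%E.
    rewrite /Z0 /Z1 -integral_prod_mul// -integral_prod_mul//.
    have mA : measurable_fun setT (fun z : T * T => expR (g z.1) * expR (- g z.2)).
      by apply: measurable_funM; [exact: (m1 _ meg)|exact: (m2 _ meNg)].
    have mB : measurable_fun setT (fun z : T * T => expR (- g z.1) * expR (g z.2)).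
      by apply: measurable_funM; [exact: (m1 _ meNg)|exact: (m2 _ meg)].
    rewrite -integral_realD//; try by move=> z; rewrite mulr_ge0// expR_ge0.
    have msum : measurable_fun setT (fun z : T * T => \sum_A e A z.1 * e' A z.2).
      apply: measurable_sum => A; apply: measurable_funM.
        exact: (m1 _ (me A)).
      exact: (m2 _ (me' A)).
    apply: (@le_trans _ _ (\int[mu \x mu]_z
        (2 / 2 ^+ h * \sum_A e A z.1 * e' A z.2)%:E)%E).
      apply: le_integral_real; [exact: measurable_funD|by apply: measurable_funM| |].
        by move=> z; rewrite addr_ge0// mulr_ge0// expR_ge0.
      move=> [x y] /=; rewrite -!expRD.
      have -> : expR (g x - g y) + expR (- g x + g y) = 2 * cosh (g x - g y).
        by rewrite /cosh opprB (addrC (- g x)); field.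
      pose v i := c * ((x : 'cV[R]_h) - y) i 0.
      have vE : Num.sqrt (\sum_i v i ^+ 2) = c * l2norm ((x : 'cV[R]_h) - y).
        rewrite /v; under eq_bigr do rewrite exprMn.
        by rewrite -mulr_sumr sqrtrM ?sqr_ge0// sqrtr_sqr ger0_norm.
      rewrite -mulrA ler_wpM2l// mulrC.
      apply: (@le_trans _ _ (cosh (Num.sqrt (\sum_i v i ^+ 2)))).
        apply: le_cosh; rewrite vE (le_trans (gL x y))//; exact: ler_norm.
      apply: (le_trans (cosh_sqrt_sum v)); rewrite prod_cosh.
      rewrite le_eqVlt; apply/orP; left; apply/eqP; congr (_ / _).
      apply: eq_bigr => A _; rewrite -expRD; congr expR.
      rewrite !dotE -big_split /=; apply: eq_bigr => i _.
      by rewrite /v !mxE; ring.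
    rewrite integral_realZl//; last by move=> z; rewrite sumr_ge0// => A _; rewrite mulr_ge0.
    rewrite (_ : (2 * K)%:E = (2 / 2 ^+ h)%:E * (\sum_(A : {set 'I_h}) K%:E))%E; last first.
      rewrite sumEFin -EFinM; congr EFin.
      rewrite sum_set_cst.
      by field; rewrite expf_neq0.
    rewrite lee_wpmul2l ?lee_fin//.
    rewrite integral_real_sum; last 2 first.
    - move=> A; apply: measurable_funM; first exact: (m1 _ (me A)).
      exact: (m2 _ (me' A)).
    - by move=> A z; rewrite mulr_ge0.
    apply: lee_sum => A _; rewrite integral_prod_mul//.
    have -> : K%:E = ((expR (l2norm (a A) ^+ 2 * Gamma ^+ 2 / 2))%:E *
        (expR (l2norm (- a A) ^+ 2 * Gamma ^+ 2 / 2))%:E)%E.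
      rewrite -scaleN1r l2normZ normrN1 mul1r la -EFinM -expRD /K.
      by congr (expR _)%:E; field.
    apply: lee_pmul; [| |exact: mgf|exact: mgf];
      by apply: integral_ge0 => x _; rewrite lee_fin.
  move: step; rewrite (muleC Z1); case: (Z0 * Z1)%E => [r| |].
  - by rewrite -EFinD !lee_fin; lra.
  - by rewrite addye// leye_eq.
  - by move=> _; rewrite leNye.
have KE : expR (I + c ^+ 2 * h%:R * Gamma ^+ 2) = K * expR I.
  by rewrite /K -expRD addrC.
have Z00 : (0 <= Z0)%E by apply: integral_ge0 => x _; rewrite lee_fin expR_ge0.
have : (Z0 * (expR (- I))%:E <= K%:E)%E.
  by apply: le_trans Z01; exact: lee_wpmul2l.
rewrite KE; case: (Z0) Z00 => [r| |]//= _; last by rewrite gt0_mulye ?lte_fin ?expR_gt0.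
by rewrite -EFinM !lee_fin expRN ler_pdivrMr ?expR_gt0.
Qed.

End subgaussian.

Section tuple_lipschitz.
Variables (R : realType) (h : nat).
Local Notation T := (borel_cV R h).

Definition tuple_lipschitz n (c : R) (G : n.-tuple T -> R) :=
  forall z z', `|G z - G z'| <=
    c * \sum_i l2norm ((tnth z i : 'cV[R]_h) - tnth z' i).

Lemma l2norm0 : l2norm (0 : 'cV[R]_h) = 0.
Proof. by rewrite /l2norm big1 ?sqrtr0// => i _; rewrite mxE expr0n. Qed.

Lemma tuple_lipschitz_cons n c (G : n.+1.-tuple T -> R) (x : T) :
  tuple_lipschitz c G -> tuple_lipschitz c (fun t : n.-tuple T => G [tuple of x :: t]).
Proof.
move=> GL z z'; rewrite (le_trans (GL _ _))// big_ord_recl /= !tnth0 subrr.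
rewrite l2norm0 add0r le_eqVlt; apply/orP; left; apply/eqP; congr (_ * _).
by apply: eq_bigr => i _; rewrite !tnthS.
Qed.

Lemma tuple_lipschitz_head n c (G : n.+1.-tuple T -> R) (x y : T)
    (t : n.-tuple T) :
  tuple_lipschitz c G ->
  `|G [tuple of x :: t] - G [tuple of y :: t]| <= c * l2norm ((x : 'cV[R]_h) - y).
Proof.
move=> GL; rewrite (le_trans (GL _ _))// big_ord_recl /= !tnth0.
rewrite big1 ?addr0// => i _; rewrite !tnthS subrr; exact: l2norm0.
Qed.

Variables (mu : probability T R) (Gamma : R).
Hypothesis mu_int : forall i : 'I_h,
  mu.-integrable setT (fun x => ((x : 'cV[R]_h) i 0)%:E).

(** The martingale method as an induction: [g x], the mean of [G] given its first point, is again
    [c]-Lipschitz, so [concentration1] treats that point after the induction hypothesis has treated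
    the others. *)
Lemma concentration n (G : n.-tuple T -> R) c : 0 <= c ->
  tuple_lipschitz c G -> (forall z, 0 <= G z) -> subgaussian mu Gamma ->
  exists I, (\int[power mu n]_z (G z)%:E = I%:E)%E /\
    (\int[power mu n]_z (expR (G z))%:E <=
      (expR (I + n%:R * (c ^+ 2 * h%:R * Gamma ^+ 2)))%:E)%E.
Proof.
move=> c0 + + mgf.
elim: n G => [G GL G0|n IH G GL G0].
  have mG := lipschitz_measurable GL.
  exists (G [tuple]); rewrite !power_integral0.
  - by rewrite mul0r addr0.
  - by apply/measurable_EFinP; exact: (measurableT_comp _ mG).
  - exact/measurable_EFinP.
have mG := lipschitz_measurable GL.
have /choice[g Hg] (x : T) := IH _ (tuple_lipschitz_cons x GL) (fun t => G0 _).
have gL x y : `|g x - g y| <= c * l2norm ((x : 'cV[R]_h) - y).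
  have H u v : g u - g v <= c * l2norm ((u : 'cV[R]_h) - v).
    rewrite lerBlDl -lee_fin EFinD -(Hg u).1 -(Hg v).1.
    rewrite -(integral_probability_cst (power mu n) (c * _)).
    have mGv (w : T) : measurable_fun setT (fun t : n.-tuple T => G [tuple of w :: t]).
      exact: lipschitz_measurable (tuple_lipschitz_cons w GL).
    rewrite -integral_realD//; last by move=> _; rewrite mulr_ge0// l2norm_ge0.
    apply: le_integral_real => //; first exact: measurable_funD.
    move=> t; rewrite -lerBlDl (le_trans (ler_norm _))//.
    exact: tuple_lipschitz_head.
  rewrite ler_norml H andbT lerNl opprB (le_trans (H _ _))//.
  by rewrite -opprB -scaleN1r l2normZ normrN1 mul1r.
have gi := lipschitz_integrable1 mu_int gL.
have [I gI] : exists I : R, (\int[mu]_x (g x)%:E)%E = I%:E.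
  by exists (fine (\int[mu]_x (g x)%:E)%E); rewrite fineK//; exact: integrable_fin_num.
exists I; split.
  rewrite power_integralS; last 2 first.
  - exact/measurable_EFinP.
  - by move=> z; rewrite lee_fin.
  by rewrite -gI; apply: eq_integral => x _; exact: (Hg x).1.
set K := c ^+ 2 * _ * _.
have mg := lipschitz_measurable1 gL.
apply: (@le_trans _ _ (\int[mu]_x (expR (n%:R * K) * expR (g x))%:E)%E).
  apply: power_integral_leS.
  - exact: (measurableT_comp _ mG).
  - by move=> z; exact: expR_ge0.
  - by apply: measurable_funM => //; exact: (measurableT_comp _ mg).
  by move=> x; rewrite -expRD addrC; exact: (Hg x).2.
rewrite integral_realZl ?expR_ge0//; last exact: (measurableT_comp _ mg).
apply: (@le_trans _ _ ((expR (n%:R * K))%:E * (expR (I + K))%:E)%E).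
  by apply: lee_wpmul2l; [rewrite lee_fin expR_ge0|exact: concentration1].
by rewrite -EFinM -expRD lee_fin ler_expR -natr1 le_eqVlt; apply/orP; left; apply/eqP; ring.
Qed.

End tuple_lipschitz.

(** * Symmetrisation *)

Section placement.
Variable n : nat.

Lemma shift_subproof (r : 'I_n) i : ((i + r) %% n < n)%N.
Proof. by rewrite ltn_pmod// (leq_ltn_trans _ (ltn_ord r)). Qed.

(** Averaging over rotations gives all sample points equal weight even when fewer than [n] signs are
    positive. *)
Definition shift (r : 'I_n) i : 'I_n := Ordinal (shift_subproof r i).

Lemma sum_shift (V : nmodType) (g : 'I_n -> V) i :
  \sum_(r < n) g (shift r i) = \sum_j g j.
Proof.
rewrite [RHS](reindex_inj (h := shift^~ i))//= => r r' /(congr1 val)/= /eqP.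
by rewrite eqn_modDl !modn_small// => /eqP /val_inj.
Qed.

Lemma shift_inj (r : 'I_n) i j : (i < n)%N -> (j < n)%N ->
  shift r i = shift r j -> i = j.
Proof.
move=> iN jN /(congr1 val)/= /eqP.
by rewrite eqn_modDr !modn_small// => /eqP.
Qed.

(* Half of the [2 n] points are the sample itself: the first [n] positive signs
   are put on the sample points, up to a rotation, and all the other signs on
   fresh points. *)
Definition placed (A : {set 'I_(n.*2)}) : seq 'I_(n.*2) := take n (enum A).

(** A sign that is not placed uses the fresh point of its own index, so no two signs share a point;
    this is why [n.*2] fresh points are provided. *)
Definition place (A : {set 'I_(n.*2)}) (r : 'I_n) (k : 'I_(n.*2)) :
  'I_n + 'I_(n.*2) :=
  if k \in placed A then inl (shift r (index k (enum A))) else inr k.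

Lemma placedP (A : {set 'I_(n.*2)}) k : k \in placed A ->
  (k \in A) /\ (index k (enum A) < n)%N.
Proof.
move=> kA; have kA' := mem_take kA; split; first by rewrite -mem_enum.
by rewrite -in_take.
Qed.

Lemma place_inj A r : injective (place A r).
Proof.
move=> k k'; rewrite /place; case: ifPn => kA; case: ifPn => kA' // -[] // e.
have /shift_inj : shift r (index k (enum A)) = shift r (index k' (enum A)).
  exact: val_inj.
move=> /(_ (placedP kA).2 (placedP kA').2) {}e.
have := nth_index k (mem_take kA); rewrite e.
by rewrite (nth_index k (mem_take kA')).
Qed.

Lemma card_placed A : #|placed A| = minn n #|A|.
Proof.
rewrite (card_uniqP _) ?take_uniq ?enum_uniq// size_take -cardE.
by rewrite /minn.
Qed.

End placement.

(** * Suprema over a class of Lipschitz functions *)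

Section function_class.
Variables (R : realType) (h : nat).
Local Notation T := (borel_cV R h).
Variable F : set (T -> R).

(** A real supremum has a default value on unbounded sets, so the lemmas below carry an explicit
    bound [C]. *)
Definition supF (Phi : (T -> R) -> R) : R := sup [set Phi f | f in F].

Hypothesis F_cst0 : F (fun=> 0).

Lemma supF_ub Phi C f : (forall g, F g -> Phi g <= C) -> F f -> Phi f <= supF Phi.
Proof.
move=> PhiC Ff; apply: ub_le_sup; last by exists f.
by exists C => _ [g Fg <-]; exact: PhiC.
Qed.

Lemma supF_le Phi C : (forall g, F g -> Phi g <= C) -> supF Phi <= C.
Proof.
move=> PhiC; apply: ge_sup; first by exists (Phi (fun=> 0)); exists (fun=> 0).
by move=> _ [g Fg <-]; exact: PhiC.
Qed.

Lemma supF_ge0 Phi C : (forall g, F g -> Phi g <= C) -> Phi (fun=> 0) = 0 ->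
  0 <= supF Phi.
Proof. by move=> PhiC <-; exact: supF_ub PhiC F_cst0. Qed.

Lemma supF_dist Phi Psi C D : (forall g, F g -> Phi g <= C) ->
  (forall g, F g -> Psi g <= C) -> (forall g, F g -> `|Phi g - Psi g| <= D) ->
  `|supF Phi - supF Psi| <= D.
Proof.
have H U V : (forall g, F g -> V g <= C) -> (forall g, F g -> `|U g - V g| <= D) ->
    supF U - supF V <= D.
  move=> VC UV; rewrite lerBlDr; apply: supF_le => g Fg.
  rewrite -[U g](subrK (V g)) lerD//; last exact: supF_ub VC Fg.
  by rewrite (le_trans (ler_norm _))// UV.
move=> PhiC PsiC PP; rewrite ler_norml H// andbT lerNl opprB H// => g Fg.
by rewrite distrC PP.
Qed.

Lemma supF_adherent Phi C e : (forall g, F g -> Phi g <= C) -> 0 < e ->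
  exists2 f, F f & supF Phi - e <= Phi f.
Proof.
move=> PhiC e0.
have [|_ [f Ff <-] H] := @sup_adherent R [set Phi f | f in F] e e0.
  by split; [exists (Phi (fun=> 0)); exists (fun=> 0)|exists C => _ [g Fg <-]; exact: PhiC].
by exists f => //; exact: ltW.
Qed.

Variables (B : R).
Hypothesis B0 : 0 <= B.
Hypothesis F_lip : forall f, F f ->
  forall x y, `|f x - f y| <= B * l2norm ((x : 'cV[R]_h) - y).
Hypothesis F_0 : forall f, F f -> f (0 : 'cV[R]_h) = 0.

Lemma F_bound f x : F f -> `|f x| <= B * l2norm (x : 'cV[R]_h).
Proof.
by move=> Ff; have := F_lip Ff x (0 : 'cV[R]_h); rewrite F_0// !subr0.
Qed.

(** The Rademacher supremum for one fixed sign pattern, without normalisation. *)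
Definition rad n (A : {set 'I_n}) (z : n.-tuple T) : R :=
  supF (fun f => \sum_k sgset R A k * f (tnth z k)).

Lemma norm_sgset n (A : {set 'I_n}) k : `|sgset R A k| = 1.
Proof. by rewrite /sgset; case: ifP; rewrite ?normrN1 ?normr1. Qed.

Lemma rad_bounded n (A : {set 'I_n}) (z : n.-tuple T) f : F f ->
  \sum_k sgset R A k * f (tnth z k) <= \sum_k B * l2norm (tnth z k : 'cV[R]_h).
Proof.
move=> Ff; apply: ler_sum => k _; rewrite (le_trans (ler_norm _))//.
by rewrite normrM norm_sgset mul1r F_bound.
Qed.

Lemma le_rad n (A : {set 'I_n}) (z : n.-tuple T) f : F f ->
  \sum_k sgset R A k * f (tnth z k) <= rad A z.
Proof.
move=> Ff.
exact: (supF_ub (Phi := fun f => \sum_k sgset R A k * f (tnth z k))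
  (rad_bounded A z) Ff).
Qed.

Lemma rad_ge0 n (A : {set 'I_n}) z : 0 <= rad A z.
Proof.
apply: (supF_ge0 (rad_bounded A z)).
by rewrite big1// => k _; rewrite mulr0.
Qed.

Lemma rad_lipschitz n (A : {set 'I_n}) : tuple_lipschitz B (rad A).
Proof.
move=> z z'.
apply: (supF_dist (C := (\sum_k B * l2norm (tnth z k : 'cV[R]_h)) +
  \sum_k B * l2norm (tnth z' k : 'cV[R]_h))) => [g Fg|g Fg|g Fg].
- rewrite (le_trans (rad_bounded _ _ Fg))// lerDl sumr_ge0// => k _.
  by rewrite mulr_ge0// l2norm_ge0.
- rewrite (le_trans (rad_bounded _ _ Fg))// lerDr sumr_ge0// => k _.
  by rewrite mulr_ge0// l2norm_ge0.
rewrite -sumrB mulr_sumr (le_trans (ler_norm_sum _ _ _))// ler_sum// => k _.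
by rewrite -mulrBr normrM norm_sgset mul1r F_lip.
Qed.

Variables (mu : probability T R).
Hypothesis mu_int : forall i : 'I_h,
  mu.-integrable setT (fun x => ((x : 'cV[R]_h) i 0)%:E).

Definition expect (f : T -> R) : R := fine (\int[mu]_x (f x)%:E)%E.

Lemma F_integrable f : F f -> mu.-integrable setT (EFin \o f).
Proof. by move=> Ff; exact: (lipschitz_integrable1 mu_int (F_lip Ff)). Qed.

Lemma expectE f : F f -> (\int[mu]_x (f x)%:E = (expect f)%:E)%E.
Proof. by move=> Ff; rewrite fineK//; exact: integrable_fin_num (F_integrable Ff). Qed.

(** Controls [f x - expect f] uniformly over the class, which makes the supremum in [dev] finite. *)
Definition mean_dist (x : T) : R :=
  expect (fun y => l2norm ((x : 'cV[R]_h) - y)).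

Lemma lipschitz_dist_integrable (x : 'cV[R]_h) :
  mu.-integrable setT (EFin \o (fun y : T => l2norm (x - (y : 'cV[R]_h)))).
Proof.
apply: (lipschitz_integrable1 mu_int (c := 1)) => y z; rewrite mul1r.
exact: l2norm_lip.
Qed.

Lemma mean_distE x :
  (\int[mu]_y (l2norm ((x : 'cV[R]_h) - y))%:E = (mean_dist x)%:E)%E.
Proof.
by rewrite fineK//; exact: integrable_fin_num (lipschitz_dist_integrable x).
Qed.

Lemma mean_dist_ge0 x : 0 <= mean_dist x.
Proof.
rewrite -lee_fin -mean_distE; apply: integral_ge0 => y _.
by rewrite lee_fin l2norm_ge0.
Qed.

Lemma sub_expect_le f x (D : T -> R) : F f -> measurable_fun setT D ->
  (forall y, 0 <= D y) -> (forall y, f x - f y <= D y) ->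
  ((f x - expect f)%:E <= \int[mu]_y (D y)%:E)%E.
Proof.
move=> Ff mD D0 fD; have fi := F_integrable Ff.
have E : (EFin \o (fun y => f x - f y)) = ((EFin \o cst (f x)) \- (EFin \o f))%E.
  exact/funext.
have -> : (f x - expect f)%:E = (\int[mu]_y (f x - f y)%:E)%E.
  rewrite (_ : (fun y => (f x - f y)%:E) = EFin \o (fun y => f x - f y))// E.
  rewrite integralB//; last exact: finite_measure_integrable_cst.
  by rewrite /= integral_probability_cst expectE// EFinB.
apply: integral_le_ge0 => //.
by rewrite E; apply: integrableB => //; exact: finite_measure_integrable_cst.
Qed.

Lemma F_dev f x : F f -> f x - expect f <= B * mean_dist x.
Proof.
move=> Ff; rewrite -lee_fin EFinM -mean_distE.
have md : measurable_fun setT (fun y : T => l2norm ((x : 'cV[R]_h) - y)).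
  by apply: (@lipschitz_measurable1 _ _ _ 1) => y z; rewrite mul1r l2norm_lip.
rewrite -integral_realZl//; last by move=> y; exact: l2norm_ge0.
apply: sub_expect_le => //.
- exact: measurable_funM.
- by move=> y; rewrite mulr_ge0// l2norm_ge0.
- by move=> y; rewrite (le_trans (ler_norm _))// F_lip.
Qed.

(** One-sided; closure under negation restores the absolute value in [abs_dev]. *)
Definition dev n (z : n.-tuple T) : R :=
  supF (fun f => \sum_i (f (tnth z i) - expect f)).

Lemma dev_bounded n (z : n.-tuple T) f : F f ->
  \sum_i (f (tnth z i) - expect f) <= \sum_i B * mean_dist (tnth z i).
Proof. by move=> Ff; apply: ler_sum => i _; exact: F_dev. Qed.

Lemma le_dev n (z : n.-tuple T) f : F f ->
  \sum_i (f (tnth z i) - expect f) <= dev z.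
Proof.
move=> Ff; exact: (supF_ub (Phi := fun f => \sum_i (f (tnth z i) - expect f))
  (dev_bounded z) Ff).
Qed.

Lemma expect_cst0 : expect (fun=> 0) = 0.
Proof. by rewrite /expect integral0. Qed.

Lemma dev_ge0 n (z : n.-tuple T) : 0 <= dev z.
Proof.
apply: (supF_ge0 (dev_bounded z)).
by rewrite big1// => i _; rewrite expect_cst0 subr0.
Qed.

Lemma dev_lipschitz n : tuple_lipschitz B (@dev n).
Proof.
move=> z z'.
have D0 (u : n.-tuple T) : 0 <= \sum_i B * mean_dist (tnth u i).
  by rewrite sumr_ge0// => i _; rewrite mulr_ge0// mean_dist_ge0.
apply: (supF_dist (C := \sum_i B * mean_dist (tnth z i) +
  \sum_i B * mean_dist (tnth z' i))) => [g Fg|g Fg|g Fg].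
- by rewrite (le_trans (dev_bounded z Fg))// lerDl.
- by rewrite (le_trans (dev_bounded z' Fg))// lerDr.
rewrite -sumrB mulr_sumr (le_trans (ler_norm_sum _ _ _))// ler_sum// => i _.
by rewrite opprB addrA subrK F_lip.
Qed.

Hypothesis F_opp : forall f, F f -> F (fun x => - f x).

Lemma abs_dev n (z : n.-tuple T) f : F f ->
  `|\sum_i (f (tnth z i) - expect f)| <= dev z.
Proof.
move=> Ff; rewrite ler_norml le_dev// andbT lerNl -sumrN.
have := le_dev z (F_opp Ff); congr (_ <= _); apply: eq_bigr => i _.
rewrite opprB addrC; congr (_ + _).
have : (\int[mu]_x (- f x)%:E = - \int[mu]_x (f x)%:E)%E.
  have fi := F_integrable Ff; rewrite -integralN//=; exact: integrable_add_def.
by rewrite !expectE//; [move=> -[->]; rewrite opprK|exact: F_opp].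
Qed.


Lemma sum_sgset n : \sum_(A : {set 'I_n}) \sum_k sgset R A k = 0.
Proof.
set s := \sum_A _; suff : s = - s by lra.
rewrite {1}/s sum_setC -sumrN; apply: eq_bigr => A _; rewrite -sumrN.
by apply: eq_bigr => k _; rewrite sgsetC.
Qed.

(** All signs together sum to 0 and every placed sign is positive, so the fresh points carry minus
    the number of placed ones. *)
Lemma sum_place_coef n :
  \sum_(A : {set 'I_(n.*2)}) \sum_(k | k \notin placed A) sgset R A k =
  - (\sum_(A : {set 'I_(n.*2)}) minn n #|A|)%:R.
Proof.
apply/eqP; rewrite -addr_eq0 addrC natr_sum -big_split /= -[eqbRHS](sum_sgset n.*2).
apply/eqP/eq_bigr => A _; rewrite [RHS](bigID (mem (placed A))) /=; congr (_ + _).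
rewrite -card_placed -sum1_card natr_sum; apply: eq_bigr => k kA.
by rewrite /sgset (placedP kA).1.
Qed.

(** Integrating out the fresh points produces the centring: their total weight is [- n] times the
    coefficient of the left-hand side. This is an identity; the only loss lies in how far that
    coefficient falls short of [n * 4 ^ n]. *)
Lemma symmetrization_pointwise n (x : n.-tuple T) f : F f ->
  ((\sum_(A : {set 'I_(n.*2)}) minn n #|A|)%:R *
     \sum_i (f (tnth x i) - expect f))%:E =
  (\int[power mu n.*2]_y (\sum_(A : {set 'I_(n.*2)}) \sum_(r < n) \sum_k
     sgset R A k * f (match place A r k with
       inl i => tnth x i | inr j => tnth y j end))%:E)%E.
Proof.
move=> Ff; set S := \sum_(A : {set _}) _.
pose C1 := S%:R * \sum_i f (tnth x i).
pose w k := n%:R * \sum_(A : {set 'I_(n.*2)} | k \notin placed A) sgset R A k.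
have uE (y : n.*2.-tuple T) : \sum_(A : {set 'I_(n.*2)}) \sum_(r < n) \sum_k
     sgset R A k * f (match place A r k with
       inl i => tnth x i | inr j => tnth y j end) =
     C1 + \sum_k w k * f (tnth y k).
  have -> : \sum_k w k * f (tnth y k) = \sum_(A : {set 'I_(n.*2)})
      n%:R * \sum_(k | k \notin placed A) sgset R A k * f (tnth y k).
    under eq_bigr do rewrite /w -mulrA mulr_suml.
    rewrite -!mulr_sumr; congr (_ * _).
    by rewrite [LHS](exchange_big_dep xpredT).
  rewrite /C1 /S natr_sum mulr_suml -big_split /=; apply: eq_bigr => A _.
  rewrite exchange_big /= (bigID (mem (placed A))) /=; congr (_ + _).
    rewrite -card_placed -sum1_card natr_sum mulr_suml; apply: eq_bigr => k kA.
    rewrite -(sum_shift (fun i => f (tnth x i)) (index k (enum A))) mul1r.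
    by apply: eq_bigr => r _; rewrite /place kA /sgset (placedP kA).1 mul1r.
  rewrite mulr_sumr; apply: eq_bigr => k kA.
  under eq_bigr do rewrite /place (negbTE kA).
  by rewrite sumr_const card_ord mulr_natl.
under eq_integral do rewrite uE.
have fi k : (power mu n.*2).-integrable setT (fun y => (f (tnth y k))%:E).
  exact: (iid_integrable1 (i := k) (f := EFin \o f) (measurable_tnth k)
    (@power_iid _ _ _ mu n.*2) (F_integrable Ff)).
rewrite (_ : (fun y => _) = ((EFin \o cst C1) \+
    (fun y => \sum_k (w k)%:E * (f (tnth y k))%:E))%E); last first.
  by apply/funext => y /=; rewrite EFinD -sumEFin.
rewrite integralD//; last 2 first.
- exact: finite_measure_integrable_cst.
- by apply: integrable_sum => // k _; exact: integrableZl.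
rewrite /= integral_probability_cst integral_sum//; last first.
  by move=> k; exact: integrableZl.
have Ek k : (\int[power mu n.*2]_y ((w k)%:E * (f (tnth y k))%:E) =
    (w k * expect f)%:E)%E.
  rewrite integralZl// [X in (_ * X)%E](iid_integral1 (i := k) (f := EFin \o f)
    (measurable_tnth k) (@power_iid _ _ _ mu n.*2) (F_integrable Ff)).
  by rewrite /= expectE// EFinM.
rewrite (eq_bigr _ (fun k _ => Ek k)).
rewrite sumEFin -EFinD; congr EFin.
rewrite -mulr_suml /w -mulr_sumr (exchange_big_dep xpredT)//= sum_place_coef.
rewrite sumrB sumr_const card_ord -mulr_natl /C1; ring.
Qed.

(** For a fixed sample [x] the identity above bounds each function by the same integral of suprema,
    hence also bounds [dev x]; then [x] is integrated. *)
Lemma symmetrization n :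
  ((\sum_(A : {set 'I_(n.*2)}) minn n #|A|)%:R%:E *
     \int[power mu n]_z (dev z)%:E <=
   n%:R%:E * \sum_(A : {set 'I_(n.*2)}) \int[power mu n.*2]_z (rad A z)%:E)%E.
Proof.
set S := \sum_(A : {set _}) _.
pose Z (s : 'I_n + 'I_(n.*2)) (z : n.-tuple T * n.*2.-tuple T) : T :=
  match s with inl i => tnth z.1 i | inr j => tnth z.2 j end.
have mZ s : measurable_fun setT (Z s).
  by case: s => i; apply: (measurableT_comp (measurable_tnth _)).
pose V A r z : n.*2.-tuple T := [tuple Z (place A r k) z | k < n.*2].
have mrad m (A : {set 'I_m}) : measurable_fun setT (rad A).
  exact: lipschitz_measurable (rad_lipschitz A).
have mradV A r : measurable_fun setT (fun z => rad A (V A r z)).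
  by apply: (measurableT_comp (mrad _ A)); exact: measurable_mktuple.
have radV0 A r z : 0 <= rad A (V A r z) by exact: rad_ge0.
pose J z := \sum_(A : {set 'I_(n.*2)}) \sum_(r < n) rad A (V A r z).
have mJ : measurable_fun setT J.
  by apply: measurable_sum => A; apply: measurable_sum => r.
have J0 z : 0 <= J z by rewrite sumr_ge0// => A _; rewrite sumr_ge0.
have mdev : measurable_fun setT (@dev n) by exact: lipschitz_measurable (@dev_lipschitz n).
(* Every placement is an i.i.d. family of [n.*2] points because [place] is injective, so the
   integral does not depend on [r]. *)
have JE : (\int[power mu n \x power mu n.*2]_z (J z)%:E =
    n%:R%:E * \sum_(A : {set 'I_(n.*2)}) \int[power mu n.*2]_z (rad A z)%:E)%E.
  rewrite integral_real_sum//; last 2 first.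
  - by move=> A; apply: measurable_sum => r.
  - by move=> A z; rewrite sumr_ge0.
  rewrite ge0_sume_distrr; last first.
    by move=> A _; apply: integral_ge0 => z _; rewrite lee_fin rad_ge0.
  apply: eq_bigr => A _; rewrite integral_real_sum//.
  rewrite (eq_bigr (fun=> \int[power mu n.*2]_z (rad A z)%:E)%E).
    by rewrite sume_cst//; apply: integral_ge0 => z _; rewrite lee_fin rad_ge0.
  move=> r _.
  apply: (iid_ge0_integral (P := (power mu n \x power mu n.*2)%E)
    (Z := fun k z => Z (place A r k) z) (f := fun z => (rad A z)%:E)) => //.
  - exact: (iid_injective (@place_inj n A r) (@power_pair_iid _ _ _ mu n n.*2)).
  - by apply/measurable_EFinP; exact: mrad.
  - by move=> z; rewrite lee_fin rad_ge0.
rewrite -JE -integral_realZl//; last by move=> z; exact: dev_ge0.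
rewrite fubini_tonelli1; last 2 first.
- exact/measurable_EFinP.
- by move=> z; rewrite lee_fin.
apply: ge0_le_integral => //.
- by move=> z _; rewrite lee_fin mulr_ge0// dev_ge0.
- by apply/measurable_EFinP; exact: measurable_funM.
- apply: measurable_fun_fubini_tonelli_F; first exact/measurable_EFinP.
  by move=> z; rewrite lee_fin.
move=> x _; rewrite /fubini_F.
have Jx0 : (0 <= \int[power mu n.*2]_y (J (x, y))%:E)%E.
  by apply: integral_ge0 => y _; rewrite lee_fin.
have mJx : measurable_fun setT (fun y => J (x, y)).
  exact: (measurableT_comp mJ).
have key f : F f -> ((S%:R * \sum_i (f (tnth x i) - expect f))%:E <=
    \int[power mu n.*2]_y (J (x, y))%:E)%E.
  move=> Ff; rewrite symmetrization_pointwise//; apply: integral_le_ge0 => //.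
    rewrite (_ : EFin \o _ = (fun y => \sum_(A : {set 'I_(n.*2)})
       \sum_(r < n) \sum_k (sgset R A k)%:E * (f (match place A r k with
         inl i => tnth x i | inr j => tnth y j end))%:E)%E); last first.
      apply/funext => y /=; rewrite -sumEFin; apply: eq_bigr => A _.
      rewrite -sumEFin; apply: eq_bigr => r _.
      by rewrite -sumEFin; apply: eq_bigr => k _; rewrite EFinM.
    apply: integrable_sum => // A _; apply: integrable_sum => // r _.
    apply: integrable_sum => // k _; apply: integrableZl => //.
    case: (place A r k) => [i|j].
      exact: finite_measure_integrable_cst.
    exact: (iid_integrable1 (i := j) (f := EFin \o f) (measurable_tnth j)
      (@power_iid _ _ _ mu n.*2) (F_integrable Ff)).
  move=> y; rewrite /J; apply: ler_sum => A _; apply: ler_sum => r _.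
  apply: le_trans (le_rad A (V A r (x, y)) Ff).
  rewrite le_eqVlt; apply/orP; left; apply/eqP; apply: eq_bigr => k _.
  by rewrite tnth_mktuple /Z; case: (place A r k).
case: (\int[power mu n.*2]_y (J (x, y))%:E)%E Jx0 key => [j| |]//.
- rewrite !lee_fin => j0 key; have [S0|S0] := eqVneq (S%:R : R) 0.
    by rewrite S0 mul0r.
  have Sp : 0 < S%:R :> R by rewrite lt_neqAle eq_sym S0 ler0n.
  rewrite mulrC -ler_pdivlMr//; apply: supF_le => // f Ff.
  by rewrite ler_pdivlMr// mulrC -lee_fin key.
- by move=> _ _; rewrite leey.
Qed.

End function_class.

(** * Binomial sums for the symmetrisation factor *)

Section binomial_average.
Local Open Scope nat_scope.

Lemma sum_card_set n (g : nat -> nat) :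
  \sum_(A : {set 'I_n}) g #|A| = \sum_(p < n.+1) 'C(n, p) * g p.
Proof.
rewrite (partition_big (fun A : {set 'I_n} => inord #|A| : 'I_n.+1) xpredT) //=.
apply: eq_bigr => p _.
rewrite (eq_bigr (fun=> g p)); last first.
  move=> A /eqP <-; rewrite inordK// ltnS -[X in _ <= X]card_ord.
  exact: max_card.
rewrite sum_nat_const; congr (_ * _).
rewrite -[X in 'C(X, _)]card_ord -card_draws -sum1_card -[RHS]sum1_card.
apply: eq_bigl => A; rewrite inE.
have An : #|A| < n.+1 by rewrite ltnS -[X in _ <= X]card_ord max_card.
by rewrite -[LHS]/(nat_of_ord (inord #|A| : 'I_n.+1) == p) inordK.
Qed.

(** Unlike plain partial sums of binomial coefficients, these weighted ones have a closed form (de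
    Moivre's mean deviation). Only [j = n] is used later; a general [j] makes the induction work. *)
Lemma sum_bin_below n j : 0 < n -> j <= n ->
  \sum_(p < j.+1) 'C(n.*2, p) * (n - p) = n * 'C(n.*2.-1, j).
Proof.
move=> n0; elim: j => [_|j IH jn].
  by rewrite big_ord1 !bin0 subn0 mul1n muln1.
rewrite big_ord_recr /= IH ?(ltnW jn)//.
have -> : 'C(n.*2, j.+1) = 'C(n.*2.-1, j.+1) + 'C(n.*2.-1, j).
  by rewrite -binS prednK ?double_gt0.
have := mul_bin_left n.*2.-1 j.
set a := 'C(_, j.+1); set b := 'C(_, j) => e.
nia.
Qed.

(** From [minn n p + (n - p) = n] with truncated subtraction; the complementary sum is the one
    evaluated in [sum_bin_below]. *)
Lemma sum_minn_card n :
  \sum_(A : {set 'I_(n.+1.*2)}) minn n.+1 #|A| + n.+1 * 'C(n.*2.+1, n.+1)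
   = n.+1 * 4 ^ n.+1.
Proof.
rewrite sum_card_set.
have -> : n.+1 * 'C(n.*2.+1, n.+1) =
    \sum_(p < (n.+1.*2).+1) 'C(n.+1.*2, p) * (n.+1 - p).
  rewrite -[n.*2.+1]/(n.+1.*2.-1) -sum_bin_below//.
  rewrite -!(big_mkord xpredT (fun p => 'C(n.+1.*2, p) * (n.+1 - p))).
  rewrite [RHS](big_cat_nat (n := n.+2))//=; last by lia.
  rewrite [X in _ = _ + X]big1_seq ?addn0// => p /andP[_].
  by rewrite mem_index_iota => /andP[pn _]; rewrite (eqP (_ : n.+1 - p == 0)) ?muln0//; lia.
rewrite -big_split /= (eq_bigr (fun p : 'I_(n.+1.*2).+1 => n.+1 * ('C(n.+1.*2, p) * (1 ^ (n.+1.*2 - p) * 1 ^ p)))).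
  by rewrite -big_distrr /= -expnDn -[4]/(2 ^ 2) -expnM mul2n.
move=> p _; rewrite !exp1n !muln1 -mulnDr mulnC; congr (_ * _).
by rewrite minnE subnK// leq_subr.
Qed.

(** Relative to [4 ^ n] the coefficient decreases, so the symmetrisation loss is worst for the
    smallest sample. *)
Lemma bin_odd_le n : 'C(n.+1.*2.+1, n.+2) <= 4 * 'C(n.*2.+1, n.+1).
Proof.
have e1 : 'C(n.*2.+1, n) = 'C(n.*2.+1, n.+1).
  rewrite -[RHS]bin_sub; last by lia.
  by congr 'C(_, _); lia.
have e2 := mul_bin_left n.*2.+1 n.+1.
have -> : 'C(n.+1.*2.+1, n.+2) = 'C(n.*2.+1, n.+2) + 'C(n.*2.+1, n.+1) +
    ('C(n.*2.+1, n.+1) + 'C(n.*2.+1, n)) by [].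
rewrite e1; move: e2; set a := 'C(_, n.+2); set b := 'C(_, n.+1).
rewrite (_ : n.*2.+1 - n.+1 = n); last by lia.
nia.
Qed.

Lemma bin_odd_bound n n0 : n0 <= n ->
  'C(n.*2.+1, n.+1) <= 4 ^ (n - n0) * 'C(n0.*2.+1, n0.+1).
Proof.
elim: n => [|n IH]; first by rewrite leqn0 => /eqP ->; rewrite expn0 mul1n.
rewrite leq_eqVlt => /orP[/eqP <-|]; first by rewrite subnn expn0 mul1n.
rewrite ltnS => nn; rewrite (leq_trans (bin_odd_le n))// subSn// expnS -mulnA.
by rewrite leq_mul2l IH.
Qed.

End binomial_average.

(* Loss factor of the symmetrisation; equals [1 - 'C(n.*2, n) / (2 * 4 ^ n)] for
   [0 < n]. *)
Definition minn_average (R : realType) (n : nat) : R :=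
  (\sum_(A : {set 'I_(n.*2)}) minn n #|A|)%:R / (n%:R * 4 ^+ n).

Lemma minn_average_ge (R : realType) (n n0 : nat) : (n0.+1 <= n)%N ->
  1 - 'C(n0.*2.+1, n0.+1)%:R / 4 ^+ n0.+1 <= minn_average R n.
Proof.
case: n => // n; rewrite ltnS => n0n.
rewrite /minn_average; set S := (\sum_A _)%N.
pose a := ('C(n.*2.+1, n.+1))%:R : R; set b := 'C(_, _)%:R.
have ab : a <= 4 ^+ (n - n0) * b.
  by have := bin_odd_bound n0n; rewrite -(ler_nat R) natrM natrX.
have e : S%:R + n.+1%:R * a = n.+1%:R * 4 ^+ n.+1 :> R.
  by rewrite -natrM -natrD sum_minn_card natrM natrX.
have n1 : 0 < n.+1%:R :> R by rewrite ltr0n.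
rewrite ler_pdivlMr ?mulr_gt0 ?exprn_gt0//.
have -> : S%:R = n.+1%:R * (4 ^+ n.+1 - a) by rewrite mulrBr -e addrK.
rewrite mulrCA ler_pM2l// mulrBl mul1r lerB// mulrAC ler_pdivlMr ?exprn_gt0//.
rewrite (_ : n.+1 = (n - n0) + n0.+1)%N; last by lia.
by rewrite exprD mulrA ler_pM2r ?exprn_gt0// mulrC.
Qed.

Section expected_deviation.
Variables (R : realType) (h : nat).
Local Notation T := (borel_cV R h).
Variables (F : set (T -> R)) (B : R) (mu : probability T R) (Gamma : R).
Hypothesis F_cst0 : F (fun=> 0).
Hypothesis B0 : 0 <= B.
Hypothesis F_lip : forall f, F f ->
  forall x y, `|f x - f y| <= B * l2norm ((x : 'cV[R]_h) - y).
Hypothesis F_0 : forall f, F f -> f (0 : 'cV[R]_h) = 0.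
Hypothesis mu_int : forall i : 'I_h,
  mu.-integrable setT (fun x => ((x : 'cV[R]_h) i 0)%:E).
Hypothesis mu_mgf : subgaussian mu Gamma.

(** Passage from suprema to choices: each pattern gets a function that is maximal up to [eta]. *)
Lemma sum_expR_rad_le n (z : n.-tuple T) lam Y : 0 <= lam ->
  (forall f : {set 'I_n} -> T -> R, (forall A, F (f A)) ->
    \sum_A expR (lam * `|\sum_k sgset R A k * f A (tnth z k)|) <= Y) ->
  \sum_A expR (lam * rad F A z) <= Y.
Proof.
move=> lam0 HY; apply/ler_addgt0Pr => e e0.
set s := \sum_A _.
have s0 : 0 <= s by rewrite sumr_ge0// => A _; exact: expR_ge0.
(* By [1 - t <= expR (- t)] it suffices that [lam * eta * s <= e]; the added ones keep the
   denominator positive. *)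
have [eta eta0 He] : exists2 eta, 0 < eta & s <= expR (- (lam * eta)) * s + e.
  have d0 : 0 < (lam + 1) * (s + 1) by rewrite mulr_gt0 ?ltr_wpDl.
  exists (e / ((lam + 1) * (s + 1))); first exact: divr_gt0.
  set t := lam * _.
  have te : t * s <= e.
    rewrite /t (_ : _ * s = e * (lam * s) / ((lam + 1) * (s + 1))); last by ring.
    rewrite ler_pdivrMr// ler_wpM2l ?(ltW e0)// mulrDl mulrDr mul1r mulr1.
    by rewrite -addrA lerDl !addr_ge0.
  have := expR_ge1Dx (- t) => /(ler_wpM2r s0); lra.
have /choice[f Hf] (A : {set 'I_n}) : exists f, F f /\
    rad F A z - eta <= \sum_k sgset R A k * f (tnth z k).
  have [f Ff Hf] := supF_adherent F_cst0 (rad_bounded F_lip F_0 A z) eta0.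
  by exists f.
rewrite (le_trans He)// lerD2r (le_trans _ (HY f (fun A => (Hf A).1)))//.
rewrite mulr_sumr ler_sum// => A _; rewrite -expRD ler_expR.
have := ler_wpM2l lam0 (Hf A).2.
have := ler_wpM2l lam0 (ler_norm (\sum_k sgset R A k * f A (tnth z k))).
lra.
Qed.

(** Jensen's inequality over signs and points jointly, through the tangent
    [u + 1 <= ln M + M^-1 * expR u]. [Q] dominates only after summation over [A], since contraction
    mixes the patterns. *)
Lemma expected_dev_bound n lam M (I : R) (Q : {set 'I_(n.*2)} -> n.*2.-tuple T -> R) :
  (0 < n)%N -> 0 < lam -> 1 <= M ->
  (\int[power mu n]_z (dev F mu z)%:E = I%:E)%E ->
  (forall A, measurable_fun setT (Q A)) -> (forall A z, 0 <= Q A z) ->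
  (forall z, \sum_A expR (lam * rad F A z) <= \sum_A Q A z) ->
  (\sum_A \int[power mu n.*2]_z (Q A z)%:E <= (4 ^+ n * M)%:E)%E ->
  minn_average R n * lam * I <= ln M.
Proof.
move=> n0 lam0 M1 devI mQ Q0 radQ QM.
have M0 : 0 < M by rewrite (lt_le_trans _ M1).
have mrad (A : {set 'I_(n.*2)}) : measurable_fun setT (rad F A).
  exact: lipschitz_measurable (rad_lipschitz F_cst0 B0 F_lip F_0 A).
have rad0 (A : {set 'I_(n.*2)}) z : 0 <= rad F A z by exact: (rad_ge0 F_cst0 F_lip F_0).
have /choice[r Hr] (A : {set 'I_(n.*2)}) : exists r, (\int[power mu n.*2]_z (rad F A z)%:E = r%:E)%E.
  have [r [Hr _]] := concentration mu_int B0
    (rad_lipschitz F_cst0 B0 F_lip F_0 A) (rad0 A) mu_mgf.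
  by exists r.
have N4 : 2 ^+ n.*2 = 4 ^+ n :> R.
  by rewrite -mul2n exprM; congr (_ ^+ _); lra.
have rM : lam * \sum_A r A <= 4 ^+ n * ln M.
  have mr : measurable_fun setT (fun z : n.*2.-tuple T =>
      \sum_(A : {set 'I_(n.*2)}) (lam * rad F A z + 1)).
    apply: measurable_sum => A; apply: measurable_funD => //.
    exact: measurable_funM.
  have mq : measurable_fun setT (fun z : n.*2.-tuple T =>
      4 ^+ n * ln M + M^-1 * \sum_A Q A z).
    apply: measurable_funD => //; apply: measurable_funM => //.
    exact: measurable_sum.
  have lnM : 0 <= ln M by rewrite ln_ge0.
  have : (\int[power mu n.*2]_z (\sum_(A : {set 'I_(n.*2)}) (lam * rad F A z + 1))%:E <=
      \int[power mu n.*2]_z (4 ^+ n * ln M + M^-1 * \sum_A Q A z)%:E)%E.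
    apply: le_integral_real => //.
      by move=> z; rewrite sumr_ge0// => A _; rewrite addr_ge0// mulr_ge0// ltW.
    move=> z.
    apply: (@le_trans _ _ (\sum_A (ln M + M^-1 * expR (lam * rad F A z)))).
      apply: ler_sum => A _.
      have := expR_ge1Dx (lam * rad F A z - ln M).
      by rewrite expRD expRN lnK ?posrE// mulrC; lra.
    rewrite big_split /= sum_set_cst N4 lerD2l -mulr_sumr ler_wpM2l//.
    by rewrite invr_ge0 ltW.
  have mlr (A : {set 'I_(n.*2)}) : measurable_fun setT (fun z => lam * rad F A z).
    exact: measurable_funM.
  have lr0 (A : {set 'I_(n.*2)}) z : 0 <= lam * rad F A z by rewrite mulr_ge0// ltW.
  have mSQ : measurable_fun setT (fun z => \sum_A Q A z) by exact: measurable_sum.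
  have SQ0 z : 0 <= \sum_A Q A z by rewrite sumr_ge0.
  have M'0 : 0 <= M^-1 by rewrite invr_ge0 ltW.
  rewrite integral_real_sum; last 2 first.
  - by move=> A; exact: measurable_funD.
  - by move=> A z; rewrite addr_ge0.
  rewrite (eq_bigr (fun A => (lam * r A + 1)%:E)); last first.
    move=> A _; rewrite (integral_realD _ (mlr A) (measurable_cst (1 : R)) (lr0 A) (fun=> ler01)).
    by rewrite integral_realZl ?(ltW lam0)// integral_probability_cst Hr.
  rewrite sumEFin big_split /= sum_set_cst N4 -mulr_sumr mulr1.
  have l0 : 0 <= 4 ^+ n * ln M by rewrite mulr_ge0// exprn_ge0.
  rewrite (integral_realD _ (measurable_cst (4 ^+ n * ln M))
    (measurable_funM (measurable_cst M^-1) mSQ) (fun=> l0)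
    (fun z => mulr_ge0 M'0 (SQ0 z))).
  rewrite integral_probability_cst integral_realZl//.
  rewrite integral_real_sum// => H.
  have {}H := le_trans H (leeD2l _ (lee_wpmul2l _ QM)).
  have : ((lam * \sum_A r A + 4 ^+ n)%:E <=
      (4 ^+ n * ln M)%:E + (M^-1)%:E * (4 ^+ n * M)%:E)%E.
    by apply: H; rewrite lee_fin invr_ge0 ltW.
  rewrite -EFinM -EFinD lee_fin mulrC (mulrC M^-1) mulfK ?gt_eqF//.
  by rewrite lerD2r mulrC.
have := symmetrization F_cst0 B0 F_lip F_0 mu_int n.
rewrite devI (eq_bigr (fun A => (r A)%:E)) => [|A _]; last exact: Hr.
rewrite sumEFin -!EFinM lee_fin /minn_average => sy.
have n1 : 0 < n%:R :> R by rewrite ltr0n.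
set S := (\sum_A _)%:R in sy *.
have -> : S / (n%:R * 4 ^+ n) * lam * I = (lam * (S * I)) / (n%:R * 4 ^+ n).
  by rewrite mulrAC [in RHS]mulrA; ring.
rewrite ler_pdivrMr ?mulr_gt0 ?exprn_gt0//.
have := ler_wpM2l (ltW lam0) sy; have := ler_wpM2l (ltW n1) rM; lra.
Qed.

End expected_deviation.

(** * Exponential moments of signed sums *)

Section exponential_moments.
Variable R : realType.

Lemma expR_convex (w a b : R) : 0 <= w -> w <= 1 ->
  expR ((1 - w) * a + w * b) <= (1 - w) * expR a + w * expR b.
Proof.
move=> w0 w1; set c := _ + _.
have H x : expR c * (1 + x - c) <= expR x.
  rewrite (_ : expR x = expR c * expR (x - c)); last by rewrite -expRD; congr expR; ring.
  by rewrite ler_wpM2l ?expR_ge0// -addrA expR_ge1Dx.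
have w1' : 0 <= 1 - w by rewrite subr_ge0.
have := lerD (ler_wpM2l w1' (H a)) (ler_wpM2l w0 (H b)).
apply: le_trans; rewrite le_eqVlt; apply/orP; left; apply/eqP.
by rewrite /c; ring.
Qed.

(** The exponential lies below its chord on [[0, theta * G ^+ 2]], so the extreme case has all the
    mass in one coordinate. This shares the mean among the coordinates instead of charging it to
    each of them. *)
Lemma sum_expR_sqr_le h (v : 'I_h -> R) (theta G : R) : 0 <= theta -> 0 < G ->
  \sum_j v j ^+ 2 <= G ^+ 2 ->
  \sum_j expR (theta * v j ^+ 2) <= h%:R - 1 + expR (theta * G ^+ 2).
Proof.
move=> t0 G0 vG; have G2 : 0 < G ^+ 2 by rewrite exprn_gt0.
have H j : expR (theta * v j ^+ 2) <=
    1 + v j ^+ 2 / G ^+ 2 * (expR (theta * G ^+ 2) - 1).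
  have vj : v j ^+ 2 <= G ^+ 2.
    apply: le_trans vG; rewrite (bigD1 j) //= lerDl sumr_ge0// => i _.
    exact: sqr_ge0.
  have w0 : 0 <= v j ^+ 2 / G ^+ 2 by rewrite divr_ge0 ?sqr_ge0 ?ltW.
  have w1 : v j ^+ 2 / G ^+ 2 <= 1 by rewrite ler_pdivrMr// mul1r.
  have := @expR_convex _ 0 (theta * G ^+ 2) w0 w1.
  rewrite mulr0 add0r (_ : v j ^+ 2 / G ^+ 2 * (theta * G ^+ 2) = theta * v j ^+ 2).
    by rewrite expR0; lra.
  by field; rewrite gt_eqF.
apply: (le_trans (ler_sum _ (fun j _ => H j))).
rewrite big_split /= sumr_const card_ord -!mulr_suml.
have E0 : 0 <= expR (theta * G ^+ 2) - 1.
  by rewrite subr_ge0 -[leLHS]expR0 ler_expR mulr_ge0// ltW.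
have : (\sum_j v j ^+ 2) / G ^+ 2 <= 1 by rewrite ler_pdivrMr// mul1r.
move=> /(ler_wpM2r E0); rewrite mul1r; lra.
Qed.

Lemma sum_expR_signs n (t : R) :
  \sum_(A : {set 'I_n}) expR (t * \sum_k sgset R A k) <=
  2 ^+ n * expR (n%:R * t ^+ 2 / 2).
Proof.
have -> : \sum_(A : {set 'I_n}) expR (t * \sum_k sgset R A k) =
    2 ^+ n * \prod_(i < n) cosh t.
  rewrite (prod_cosh (fun=> t)) mulrC divfK ?expf_neq0//.
  apply: eq_bigr => A _; congr expR; rewrite mulr_sumr.
  by apply: eq_bigr => k _; rewrite mulrC.
rewrite ler_pM2l ?exprn_gt0// prodr_const card_ord.
rewrite (_ : n%:R * _ / 2 = t ^+ 2 / 2 * n%:R); last by rewrite -mulrA mulrC.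
by rewrite expRM_natr lerXn2r ?nnegrE ?cosh_ge0 ?expR_ge0// cosh_le_gauss.
Qed.

Lemma power_integral_prod_le d (T : measurableType d) (mu : probability T R) n
    (phi : 'I_n -> T -> R) (c : 'I_n -> R) :
  (forall k, measurable_fun setT (phi k)) -> (forall k x, 0 <= phi k x) ->
  (forall k, 0 <= c k) ->
  (forall k, \int[mu]_x (phi k x)%:E <= (c k)%:E)%E ->
  (\int[power mu n]_z (\prod_k phi k (tnth z k))%:E <= (\prod_k c k)%:E)%E.
Proof.
move=> mphi phi0 c0 phic.
have mprod m (u : 'I_m -> T -> R) : (forall k, measurable_fun setT (u k)) ->
    measurable_fun [set: m.-tuple T] (fun z => \prod_k u k (tnth z k)).
  move=> mu'; apply: measurable_prod => k _.
  exact: (measurableT_comp (mu' k) (measurable_tnth k)).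
elim: n phi c mphi phi0 c0 phic => [|n IH] phi c mphi phi0 c0 phic.
  rewrite power_integral0; last by apply/measurable_EFinP; exact: mprod.
  by rewrite !big_ord0.
set C := \prod_(k < n) c (lift ord0 k).
have C0 : 0 <= C by exact: prodr_ge0.
apply: (@le_trans _ _ (\int[mu]_x (C * phi ord0 x)%:E)%E).
  apply: power_integral_leS.
  - exact: mprod.
  - by move=> z; exact: prodr_ge0.
  - exact: measurable_funM.
  move=> x; under eq_integral => t _ do (rewrite big_ord_recl tnth0;
    under eq_bigr do rewrite tnthS).
  rewrite integral_realZl//; last 2 first.
  - exact: (mprod _ (fun k => phi (lift ord0 k))).
  - by move=> z; exact: prodr_ge0.
  rewrite mulrC EFinM; apply: lee_wpmul2l; first by rewrite lee_fin.
  exact: (IH (fun k => phi (lift ord0 k))).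
rewrite integral_realZl// big_ord_recl mulrC EFinM.
by apply: lee_wpmul2l; rewrite ?lee_fin.
Qed.

End exponential_moments.

Section coordinate_vectors.
Variables (R : realType) (h : nat).

Lemma dot_delta (v : 'cV[R]_h) i : dot (delta_mx i 0) v = v i 0.
Proof.
rewrite dotE (bigD1 i) //= big1 ?addr0 => [|j /negbTE ji]; rewrite mxE.
  by rewrite !eqxx mul1r.
by rewrite ji mul0r.
Qed.

Lemma l2norm_delta (i : 'I_h) : l2norm (delta_mx i 0 : 'cV[R]_h) = 1.
Proof.
rewrite /l2norm (bigD1 i) //= big1 ?addr0 => [|j /negbTE ji]; rewrite mxE.
  by rewrite !eqxx expr1n sqrtr1.
by rewrite ji expr0n.
Qed.

Lemma expR_linf_le (v : 'cV[R]_h) (t : R) : (0 < h)%N -> 0 < t ->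
  expR (t * linf v) <= \sum_i (expR (t * v i 0) + expR (- (t * v i 0))).
Proof.
move=> h0 t0; set S := \sum_i _.
have HS i : expR (t * `|v i 0|) <= S.
  rewrite /S (bigD1 i) //= -[leLHS]addr0; apply: lerD; last first.
    by apply: sumr_ge0 => j _; rewrite addr_ge0// expR_ge0.
  by case: (ger0P (v i 0)) => _; rewrite ?mulrN ?lerDl ?lerDr expR_ge0.
(* The maximum in [linf] starts from 0, so the value 0 has to be dominated as well. *)
have S1 : 1 <= S.
  apply: le_trans (HS (Ordinal h0)); rewrite -[leLHS]expR0 ler_expR.
  by rewrite mulr_ge0// ltW.
have S0 : 0 < S by rewrite (lt_le_trans _ S1).
rewrite -[S]lnK ?posrE// ler_expR mulrC -ler_pdivlMr//.
apply: linf_le => [|i]; first by rewrite divr_ge0 ?ln_ge0// ltW.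
by rewrite ler_pdivlMr// mulrC -ler_expR lnK ?posrE.
Qed.

End coordinate_vectors.

Section signed_sums.
Variables (R : realType) (h : nat).
Local Notation T := (borel_cV R h).
Variables (mu : probability T R) (Gamma : R).
Hypothesis mu_mgf : subgaussian mu Gamma.

Definition ssum n (A : {set 'I_n}) (z : n.-tuple T) : 'cV[R]_h :=
  \sum_k sgset R A k *: (tnth z k : 'cV[R]_h).

Lemma dot_ssum n (A : {set 'I_n}) (z : n.-tuple T) (a : 'cV[R]_h) :
  dot a (ssum A z) = \sum_k dot (sgset R A k *: a) (tnth z k : 'cV[R]_h).
Proof. by rewrite /ssum dot_sum; apply: eq_bigr => k _; rewrite dotZl. Qed.

Lemma measurable_dot_ssum n (A : {set 'I_n}) (a : 'cV[R]_h) :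
  measurable_fun [set: n.-tuple T] (fun z => dot a (ssum A z)).
Proof.
rewrite (_ : (fun z => _) = (fun z : n.-tuple T =>
    \sum_k dot (sgset R A k *: a) ((tnth z k : 'cV[R]_h) - 0))); last first.
  by apply/funext => z; rewrite dot_ssum; apply: eq_bigr => k _; rewrite subr0.
apply: measurable_sum => k.
exact: (measurableT_comp (measurable_dotB _ _) (measurable_tnth k)).
Qed.

(** The points are not centred: the mean survives through the sum of the signs, which is averaged
    over the patterns only later. *)
Lemma ssum_mgf n (A : {set 'I_n}) (a : 'cV[R]_h) :
  (\int[power mu n]_z (expR (dot a (ssum A z)))%:E <=
   (expR ((\sum_k sgset R A k) * dot a (mean mu) +
          n%:R * (l2norm a ^+ 2 * Gamma ^+ 2 / 2)))%:E)%E.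
Proof.
pose c (k : 'I_n) := expR (sgset R A k * dot a (mean mu) +
  l2norm a ^+ 2 * Gamma ^+ 2 / 2).
pose phi (k : 'I_n) (x : T) :=
  expR (sgset R A k * dot a (mean mu)) *
  expR (dot (sgset R A k *: a) ((x : 'cV[R]_h) - mean mu)).
have -> : (\sum_k sgset R A k) * dot a (mean mu) +
    n%:R * (l2norm a ^+ 2 * Gamma ^+ 2 / 2) = \sum_(k < n)
    (sgset R A k * dot a (mean mu) + l2norm a ^+ 2 * Gamma ^+ 2 / 2).
  by rewrite big_split /= -mulr_suml sumr_const card_ord mulr_natl.
rewrite expR_sum; under eq_integral => z _.
  rewrite dot_ssum expR_sum (eq_bigr (fun k => phi k (tnth z k))).
    over.
  move=> k _; rewrite /phi -expRD; congr expR.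
  by rewrite dotB dotZl dotZl; ring.
apply: power_integral_prod_le => k.
- by apply: measurable_funM => //; exact: measurable_expR_dotB.
- by move=> x; rewrite mulr_ge0// expR_ge0.
- exact: expR_ge0.
rewrite integral_realZl ?expR_ge0//; last exact: measurable_expR_dotB.
rewrite expRD EFinM; apply: lee_wpmul2l; first by rewrite lee_fin expR_ge0.
apply: (le_trans (mu_mgf _)); rewrite lee_fin ler_expR l2normZ.
by rewrite /sgset; case: ifP; rewrite ?normrN1 ?normr1 mul1r.
Qed.

End signed_sums.

Section gaussian_linearization.
Variable R : realType.

(** Completing the square leaves a multiple of the normal density of mean [b / k] and variance
    [k^-1]. *)
Lemma gauss_exp_moment (c b : R) : 2 * c < 1 ->
  (\int[lebesgue_measure]_g (normal_pdf 0 1 g * expR (c * g ^+ 2 + b * g))%:E =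
   ((Num.sqrt (1 - 2 * c))^-1 * expR (b ^+ 2 / (2 * (1 - 2 * c))))%:E)%E.
Proof.
move=> c1; set k := 1 - 2 * c.
have k0 : 0 < k by rewrite /k; lra.
pose s := (Num.sqrt k)^-1.
have s0 : 0 < s by rewrite invr_gt0 sqrtr_gt0.
have s2 : s ^+ 2 = k^-1 by rewrite exprVn sqr_sqrtr// ltW.
have pi0 := pi_gt0 R.
pose K := s * expR (b ^+ 2 / (2 * k)).
have K0 : 0 <= K by rewrite mulr_ge0 ?expR_ge0// ltW.
transitivity (\int[lebesgue_measure]_g (K%:E * (normal_pdf (b / k) s g)%:E))%E; last first.
  rewrite ge0_integralZl_EFin//; last by apply/measurable_EFinP; exact: measurable_normal_pdf.
  - by rewrite integral_normal_pdf ?gt_eqF// mule1.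
  - by move=> x _; rewrite lee_fin normal_pdf_ge0.
apply: eq_integral => g _; rewrite -EFinM; congr EFin.
rewrite !normal_pdfE ?oner_eq0 ?gt_eqF// /normal_fun /normal_peak.
rewrite subr0 expr1n mul1r s2.
have -> : Num.sqrt (k^-1 * pi *+ 2) = s * Num.sqrt (pi *+ 2).
  rewrite /s -sqrtrV ?ltW// -sqrtrM ?invr_ge0 ?ltW//.
  by congr Num.sqrt; rewrite -mulrnAr.
rewrite invfM [RHS](_ : _ = (Num.sqrt (pi *+ 2))^-1 *
    (expR (b ^+ 2 / (2 * k)) * expR (- (g - b / k) ^+ 2 / (k^-1 *+ 2)))).
  rewrite -mulrA; congr (_ * _); rewrite -!expRD; congr expR.
  rewrite (_ : c = (1 - k) / 2); last by rewrite /k; field.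
  by field; rewrite gt_eqF.
have sq0 : 0 < Num.sqrt (pi *+ 2) :> R by rewrite sqrtr_gt0 mulrn_wgt0.
by rewrite /K; field; rewrite !gt_eqF.
Qed.

(* [expR (theta * V ^+ 2)] is a Gaussian average of [expR (t * V)], [t] of
   variance [2 theta]; the coordinates are treated one after the other. *)
Lemma gauss_square_moment d (Omega : measurableType d) (P : probability Omega R)
    (h : nat) (V : 'I_h -> Omega -> R) (v theta : R) (b : 'I_h -> R) :
  (forall i, measurable_fun setT (V i)) -> 0 <= theta -> 2 * (v * theta) < 1 ->
  (forall a : 'I_h -> R, \int[P]_w (expR (\sum_i a i * V i w))%:E <=
     (expR (\sum_i (v * a i ^+ 2 / 2 + b i * a i)))%:E)%E ->
  (\int[P]_w (expR (theta * \sum_i V i w ^+ 2))%:E <=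
   (\prod_i ((Num.sqrt (1 - 2 * (v * theta)))^-1 *
             expR (theta * b i ^+ 2 / (1 - 2 * (v * theta)))))%:E)%E.
Proof.
move=> mV t0 k1 HV; set k := 1 - 2 * (v * theta).
have k0 : 0 < k by rewrite /k; lra.
pose K i := (Num.sqrt k)^-1 * expR (theta * b i ^+ 2 / k).
(* Hybrid again: coordinates below [j] already carry squares, the others are linear with parameters
   [a] that stay universally quantified, ready to be made random. *)
pose e (j : nat) (a : 'I_h -> R) (i : 'I_h) w :=
  if (i < j)%N then theta * V i w ^+ 2 else a i * V i w.
pose u (j : nat) (a : 'I_h -> R) (i : 'I_h) :=
  if (i < j)%N then K i else expR (v * a i ^+ 2 / 2 + b i * a i).
have me j a i : measurable_fun setT (e j a i).
  rewrite /e; case: (i < j)%N; last exact: measurable_funM.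
  by apply: measurable_funM => //; exact: measurable_funX.
have u0 j a i : 0 <= u j a i.
  by rewrite /u; case: ifP => _; rewrite ?expR_ge0// mulr_ge0 ?expR_ge0// invr_ge0 sqrtr_ge0.
suff H j : (j <= h)%N -> forall a,
    (\int[P]_w (expR (\sum_i e j a i w))%:E <= (\prod_i u j a i)%:E)%E.
  have := H h (leqnn _) (fun=> 0); rewrite (_ : \prod_i u _ _ _ = \prod_i K i).
    apply: le_trans; rewrite le_eqVlt; apply/orP; left; apply/eqP.
    apply: eq_integral => w _; congr (expR _)%:E; rewrite mulr_sumr.
    by apply: eq_bigr => i _; rewrite /e ltn_ord.
  by apply: eq_bigr => i _; rewrite /u ltn_ord.
elim: j => [_ a|j IH jh a].
  apply: le_trans (le_trans (HV a) _).
    rewrite le_eqVlt; apply/orP; left; apply/eqP; apply: eq_integral => w _.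
    by congr (expR _)%:E; apply: eq_bigr => i _; rewrite /e ltn0.
  by rewrite expR_sum lee_fin /u.
pose m : 'I_h := Ordinal jh.
have ej i w a' : (forall l, l != m -> a' l = a l) -> i != m ->
    e j.+1 a i w = e j a' i w.
  move=> a'E im; rewrite /e ltnS leq_eqVlt (_ : (i == j :> nat) = false) /=.
    by rewrite a'E.
  exact: negbTE.
have uj i a' : (forall l, l != m -> a' l = a l) -> i != m ->
    u j.+1 a i = u j a' i.
  move=> a'E im; rewrite /u ltnS leq_eqVlt (_ : (i == j :> nat) = false) /=.
    by rewrite a'E.
  exact: negbTE.
(* With [g] standard Gaussian, averaging over this parameter produces [expR (theta * V m w ^+ 2)].
   Tonelli then puts the [g] integral outside, where the induction hypothesis applies at fixed
   [g]. *)
pose a_ (g : R) (i : 'I_h) := if i == m then Num.sqrt (2 * theta) * g else a i.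
have aE g l : l != m -> a_ g l = a l by rewrite /a_ => /negbTE ->.
pose W w := expR (\sum_(i | i != m) e j.+1 a i w).
have mW : measurable_fun setT W.
  have -> : W = fun w => expR (\sum_i (if i != m then e j.+1 a i w else 0)).
    by apply/funext => w; rewrite /W big_mkcond.
  by apply: measurableT_comp => //; apply: measurable_sum => i; case: (i != m).
pose q := Num.sqrt (2 * theta).
have q2 : q ^+ 2 = 2 * theta by rewrite sqr_sqrtr// mulr_ge0.
pose f (p : Omega * R) := W p.1 * (normal_pdf 0 1 p.2 * expR (0 * p.2 ^+ 2 + (q * V m p.1) * p.2)).
have f0 p : 0 <= f p by rewrite !mulr_ge0 ?expR_ge0 ?normal_pdf_ge0.
have mf : measurable_fun setT f.
  apply: measurable_funM; first exact: (measurableT_comp mW).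
  apply: measurable_funM.
    exact: (measurableT_comp (measurable_normal_pdf 0 1)).
  apply: measurableT_comp => //; apply: measurable_funD.
    by apply: measurable_funM => //; apply: measurable_funX.
  apply: measurable_funM => //; apply: measurable_funM => //.
  exact: (measurableT_comp (mV m)).
have E1 w : ((expR (\sum_i e j.+1 a i w))%:E =
    \int[lebesgue_measure]_g (f (w, g))%:E)%E.
  rewrite /f /=.
  under eq_integral do rewrite EFinM.
  rewrite ge0_integralZl_EFin ?expR_ge0//; last 2 first.
  - by move=> g _; rewrite lee_fin mulr_ge0 ?normal_pdf_ge0 ?expR_ge0.
  - apply/measurable_EFinP; apply: measurable_funM.
      exact: measurable_normal_pdf.
    apply: measurableT_comp => //; apply: measurable_funD; first by apply: measurable_funM.
    exact: measurable_funM.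
  rewrite gauss_exp_moment ?mulr0 ?ltr01// subr0 sqrtr1 invr1 mul1r mulr1 -EFinM.
  rewrite /W -expRD; congr (expR _)%:E; rewrite (bigD1 m) //= addrC; congr (_ + _).
  by rewrite /e /= ltnSn exprMn q2; field.
under eq_integral do rewrite E1.
rewrite (@fubini_tonelli _ _ _ _ _ P lebesgue_measure (fun p => (f p)%:E)); last 2 first.
- exact/measurable_EFinP.
- by move=> p; rewrite lee_fin.
pose C := \prod_(i | i != m) u j.+1 a i.
have C0 : 0 <= C by exact: prodr_ge0.
apply: (@le_trans _ _ (\int[lebesgue_measure]_g
    (C%:E * (normal_pdf 0 1 g * expR ((v * theta) * g ^+ 2 + (b m * q) * g))%:E))%E).
  apply: ge0_le_integral => //.
  - by move=> g _; apply: integral_ge0 => w _; rewrite lee_fin.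
  - apply: (@measurable_fun_fubini_tonelli_G _ _ _ _ _ P (fun p => (f p)%:E)).
      exact/measurable_EFinP.
    by move=> p; rewrite lee_fin.
  - apply: measurable_funeM; apply/measurable_EFinP; apply: measurable_funM.
      exact: measurable_normal_pdf.
    apply: measurableT_comp => //; apply: measurable_funD.
      by apply: measurable_funM => //; exact: measurable_funX.
    exact: measurable_funM.
  move=> g _.
  have -> : (\int[P]_w (f (w, g))%:E =
      \int[P]_w (normal_pdf 0 1 g * expR (\sum_i e j (a_ g) i w))%:E)%E.
    apply: eq_integral => w _; rewrite /f /= mulrCA; congr (_ * _)%:E.
    rewrite /W -expRD; congr expR; rewrite [RHS](bigD1 m) //= addrC; congr (_ + _).
      by apply: eq_bigr => i im; apply: ej => // l; exact: aE.
    by rewrite /e /= ltnn /a_ eqxx mul0r add0r -/q; ring.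
  rewrite integral_realZl ?normal_pdf_ge0//; last 1 first.
  - by apply: measurableT_comp => //; apply: measurable_sum => i; exact: me.
  have := IH (ltnW jh) (a_ g).
  move=> /(lee_wpmul2l (_ : (0 <= (normal_pdf 0 1 g)%:E)%E)) => /(_ _).
  rewrite lee_fin normal_pdf_ge0 => /(_ erefl)/le_trans; apply.
  rewrite -!EFinM lee_fin mulrCA ler_wpM2l ?normal_pdf_ge0// (bigD1 m) //= mulrC.
  rewrite le_eqVlt; apply/orP; left; apply/eqP; congr (_ * _).
    by apply: eq_bigr => i im; rewrite -(@uj i (a_ g))// => l; exact: aE.
  rewrite /u /= ltnn /a_ eqxx -/q exprMn q2; congr expR; by field.
rewrite ge0_integralZl_EFin//; last 2 first.
- by move=> g _; rewrite lee_fin mulr_ge0 ?normal_pdf_ge0 ?expR_ge0.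
- apply/measurable_EFinP; apply: measurable_funM.
    exact: measurable_normal_pdf.
  apply: measurableT_comp => //; apply: measurable_funD.
    by apply: measurable_funM => //; exact: measurable_funX.
  exact: measurable_funM.
rewrite gauss_exp_moment// -EFinM lee_fin -/k (bigD1 m) //= mulrC.
rewrite le_eqVlt; apply/orP; left; apply/eqP; congr (_ * _).
rewrite /u /= ltnSn /K; congr (_ * expR _).
by rewrite exprMn q2; field; rewrite gt_eqF.
Qed.

End gaussian_linearization.

Section signed_sum_square.
Variables (R : realType) (h : nat).
Local Notation T := (borel_cV R h).
Variables (mu : probability T R) (Gamma : R).
Hypothesis mu_mgf : subgaussian mu Gamma.
Hypothesis mean_le : l2norm (mean mu) <= Gamma.

(** The same linearisation for the scalar sum of signs, with [sum_expR_signs] as the linear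
    estimate. *)
Lemma sum_expR_signs_sqr n (eta : R) : 0 <= eta -> 2 * (n%:R * eta) < 1 ->
  \sum_(A : {set 'I_n}) expR (eta * (\sum_k sgset R A k) ^+ 2) <=
  2 ^+ n * (Num.sqrt (1 - 2 * (n%:R * eta)))^-1.
Proof.
move=> e0 e1; set q := Num.sqrt (2 * eta).
have q2 : q ^+ 2 = 2 * eta by rewrite sqr_sqrtr// mulr_ge0.
pose r (A : {set 'I_n}) := \sum_k sgset R A k.
have mexp (c b : R) : measurable_fun setT
    (fun g : R => normal_pdf 0 1 g * expR (c * g ^+ 2 + b * g)).
  apply: measurable_funM; first exact: measurable_normal_pdf.
  apply: measurableT_comp => //; apply: measurable_funD.
    by apply: measurable_funM => //; exact: measurable_funX.
  exact: measurable_funM.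
have pe0 (c b g : R) : 0 <= normal_pdf 0 1 g * expR (c * g ^+ 2 + b * g).
  by rewrite mulr_ge0 ?normal_pdf_ge0 ?expR_ge0.
have E (A : {set 'I_n}) : ((expR (eta * r A ^+ 2))%:E =
    \int[lebesgue_measure]_g (normal_pdf 0 1 g * expR (0 * g ^+ 2 + (q * r A) * g))%:E)%E.
  rewrite gauss_exp_moment ?mulr0 ?ltr01// subr0 sqrtr1 invr1 mul1r mulr1.
  by congr (expR _)%:E; rewrite exprMn q2; field.
rewrite -lee_fin -sumEFin (eq_bigr _ (fun A _ => E A)) -ge0_integral_sum//; last 2 first.
- by move=> A; apply/measurable_EFinP; exact: mexp.
- by move=> A g _; rewrite lee_fin.
apply: (@le_trans _ _ (\int[lebesgue_measure]_g ((2 ^+ n)%:E *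
    (normal_pdf 0 1 g * expR ((n%:R * eta) * g ^+ 2 + 0 * g))%:E)%E)%E).
  apply: ge0_le_integral => //.
  - by move=> g _; rewrite sume_ge0// => A _; rewrite lee_fin.
  - by apply: emeasurable_sum => A; apply/measurable_EFinP; exact: mexp.
  - by apply: measurable_funeM; apply/measurable_EFinP; exact: mexp.
  move=> g _; rewrite sumEFin -EFinM lee_fin -mulr_sumr [leRHS]mulrCA.
  rewrite ler_wpM2l ?normal_pdf_ge0//.
  have := sum_expR_signs n (q * g).
  rewrite (eq_bigr (fun A => expR (0 * g ^+ 2 + q * r A * g))); last first.
    by move=> A _; congr expR; rewrite /r mul0r add0r mulrAC.
  move/le_trans; apply; rewrite le_eqVlt; apply/orP; left; apply/eqP.
  by congr (_ * expR _); rewrite exprMn q2; field.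
rewrite ge0_integralZl_EFin//; last 2 first.
- by move=> g _; rewrite lee_fin.
- by apply/measurable_EFinP; exact: mexp.
by rewrite gauss_exp_moment// expr0n mul0r expR0 mulr1.
Qed.

Lemma measurable_l2norm_ssum n (A : {set 'I_n}) :
  measurable_fun [set: n.-tuple T] (fun z => l2norm (ssum A z) ^+ 2).
Proof.
rewrite (_ : (fun z => _) = fun z => \sum_i (dot (delta_mx i 0) (ssum A z)) ^+ 2).
  by apply: measurable_sum => i; apply: measurable_funX; exact: measurable_dot_ssum.
by apply/funext => z; rewrite l2norm_sqr; apply: eq_bigr => i _; rewrite dot_delta.
Qed.

(** Two Gaussian steps: the fluctuation of the points gives one factor per coordinate and leaves the
    drift, the sum of signs times the mean. Its square enters with coefficient at most [eta], and
    averaging over signs gives the last factor. *)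
Lemma sum_ssum_square n (theta : R) :
  let v := n%:R * Gamma ^+ 2 in
  let eta := theta * Gamma ^+ 2 / (1 - 2 * (v * theta)) in
  0 <= theta -> 2 * (v * theta) < 1 -> 2 * (n%:R * eta) < 1 ->
  (\sum_(A : {set 'I_n}) \int[power mu n]_z (expR (theta * l2norm (ssum A z) ^+ 2))%:E
   <= (2 ^+ n * ((Num.sqrt (1 - 2 * (v * theta)))^-1 ^+ h *
       (Num.sqrt (1 - 2 * (n%:R * eta)))^-1))%:E)%E.
Proof.
move=> v eta t0 v1 e1; set k := 1 - 2 * (v * theta).
have k0 : 0 < k by rewrite /k; lra.
have s0 : 0 <= (Num.sqrt k)^-1 ^+ h by rewrite exprn_ge0// invr_ge0 sqrtr_ge0.
have eta0 : 0 <= eta by rewrite divr_ge0 ?(ltW k0)// mulr_ge0// sqr_ge0.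
have HA (A : {set 'I_n}) :
    (\int[power mu n]_z (expR (theta * l2norm (ssum A z) ^+ 2))%:E <=
     ((Num.sqrt k)^-1 ^+ h * expR (eta * (\sum_k sgset R A k) ^+ 2))%:E)%E.
  set r := \sum_k sgset R A k.
  have VE (a : 'I_h -> R) (z : n.-tuple T) : \sum_i a i * ssum A z i 0 =
      dot (\col_i a i) (ssum A z).
    by rewrite dotE; apply: eq_bigr => i _; rewrite mxE.
  have := @gauss_square_moment _ _ _ (power mu n) h (fun i z => ssum A z i 0)
    v theta (fun i => r * mean mu i 0) _ t0 v1.
  move=> /(_ _)/(_ _)/le_trans; under eq_integral do rewrite -l2norm_sqr.
  apply.
  - move=> i; rewrite (_ : (fun z => _) = fun z => dot (delta_mx i 0) (ssum A z)).
      exact: measurable_dot_ssum.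
    by apply/funext => z; rewrite dot_delta.
  - move=> a; under eq_integral do rewrite VE.
    apply: (le_trans (ssum_mgf mu_mgf A _)).
    rewrite lee_fin ler_expR -/r l2norm_sqr dotE.
    rewrite le_eqVlt; apply/orP; left; apply/eqP.
    rewrite big_split /= [RHS]addrC; congr (_ + _); last first.
      rewrite [RHS](_ : _ = v / 2 * \sum_i a i ^+ 2).
        by under eq_bigr do rewrite mxE; rewrite /v; ring.
      by rewrite mulr_sumr; apply: eq_bigr => i _; ring.
    by rewrite mulr_sumr; apply: eq_bigr => i _; rewrite mxE; ring.
  rewrite lee_fin big_split /= prodr_const card_ord ler_wpM2l//.
  rewrite -expR_sum ler_expR -/k.
  rewrite (_ : \sum_i _ = theta * r ^+ 2 / k * l2norm (mean mu) ^+ 2); last first.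
    by rewrite l2norm_sqr mulr_sumr; apply: eq_bigr => i _; rewrite exprMn; ring.
  rewrite /eta -/k (_ : theta * Gamma ^+ 2 / k * r ^+ 2 = theta * r ^+ 2 / k * Gamma ^+ 2); last by ring.
  apply: ler_wpM2l; first by rewrite divr_ge0 ?(ltW k0)// mulr_ge0// sqr_ge0.
  by rewrite ler_sqr ?nnegrE ?l2norm_ge0// (le_trans (l2norm_ge0 (mean mu))).
apply: (le_trans (lee_sum _ (fun A _ => HA A))).
rewrite sumEFin lee_fin -mulr_sumr mulrCA ler_wpM2l//.
exact: sum_expR_signs_sqr.
Qed.

End signed_sum_square.

(** * Bounds on the mean deviation *)

Section logarithms.
Variable R : realType.

Lemma ln2_ge : 2^-1 <= ln 2 :> R.
Proof.
have := @le_ln1Dx R (- 2^-1) ltac:(lra).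
rewrite (_ : 1 + - 2^-1 = 2^-1); last by field.
by rewrite lnV ?posrE// lerN2.
Qed.

Lemma invsqrt_le_expR (x c : R) : 0 < x -> x^-1 <= 1 + 2 * c ->
  (Num.sqrt x)^-1 <= expR c.
Proof.
move=> x0 xc; have s0 : 0 <= (Num.sqrt x)^-1 by rewrite invr_ge0 sqrtr_ge0.
rewrite -ler_sqr ?nnegrE ?expR_ge0// exprVn sqr_sqrtr ?(ltW x0)//.
apply: (le_trans xc); rewrite expr2 -expRD.
by apply: le_trans (expR_ge1Dx _); lra.
Qed.

Lemma sqrt2_expR : Num.sqrt 2 = expR (ln 2 / 2) :> R.
Proof.
have e : 2 = expR (ln 2 / 2) ^+ 2 :> R.
  by rewrite expr2 -expRD -splitr lnK ?posrE.
by rewrite [in LHS]e sqrtr_sqr ger0_norm ?expR_ge0.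
Qed.

End logarithms.

Section mean_deviation_l2.
Variables (R : realType) (h : nat).
Local Notation T := (borel_cV R h).
Variables (F : set (T -> R)) (B : R) (mu : probability T R) (Gamma : R) (p : nat).
Hypothesis F_cst0 : F (fun=> 0).
Hypothesis B0 : 0 < B.
Hypothesis F_lip : forall f, F f ->
  forall x y, `|f x - f y| <= B * l2norm ((x : 'cV[R]_h) - y).
Hypothesis F_0 : forall f, F f -> f (0 : 'cV[R]_h) = 0.
Hypothesis F_contraction : forall n (z : n.-tuple T) lam (f : {set 'I_n} -> T -> R),
  0 <= lam -> (forall A, F (f A)) ->
  \sum_A expR (lam * `|\sum_k sgset R A k * f A (tnth z k)|) <=
  Num.sqrt 2 ^+ p * \sum_A expR (lam * B * l2norm (ssum A z)).
Hypothesis mu_int : forall i : 'I_h,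
  mu.-integrable setT (fun x => ((x : 'cV[R]_h) i 0)%:E).
Hypothesis mu_mgf : subgaussian mu Gamma.
Hypothesis Gamma0 : 0 < Gamma.
Hypothesis mean_le : l2norm (mean mu) <= Gamma.

Lemma mean_dev_l2 n (I : R) : (0 < n)%N ->
  (\int[power mu n]_z (dev F mu z)%:E = I%:E)%E ->
  I <= 2 * Gamma * B * Num.sqrt (6 * p.+1%:R * ln 2 + 5 * h%:R / 4) * Num.sqrt n%:R.
Proof.
move=> n0 devI; have n1 : 0 < n%:R :> R by rewrite ltr0n.
have l2 := ln2_ge R.
(* The terms are the logarithmic costs of the layers ([sqrt 2] each), of the coordinates and of the
   mean. [lam] is tuned so that linearising the norm, at cost [(lam * B) ^+ 2 / (4 * theta)], costs
   [a1] once more; hence [M = expR (2 * a1)]. *)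
pose a1 : R := p%:R / 2 * ln 2 + h%:R / 6 + 1 / 4.
have p0 : 0 <= p%:R :> R by []; have h0 : 0 <= h%:R :> R by [].
have pl : 0 <= p%:R * ln 2 :> R by rewrite mulr_ge0//; lra.
have a10 : 0 < a1 by rewrite /a1; lra.
set sa := Num.sqrt a1; have sa0 : 0 < sa by rewrite sqrtr_gt0.
set sn := Num.sqrt n%:R; have sn0 : 0 < sn by rewrite sqrtr_gt0.
have sa2 : sa ^+ 2 = a1 by rewrite sqr_sqrtr// ltW.
have sn2 : sn ^+ 2 = n%:R by rewrite sqr_sqrtr// ltW.
pose lam := sa / (2 * sn * Gamma * B).
have den0 : 0 < 2 * sn * Gamma * B by rewrite !mulr_gt0.
have lam0 : 0 < lam by rewrite divr_gt0.
(* chosen so that [1 - 2 * v * theta = 3 / 4] with [v = 2 * n * Gamma ^+ 2] *)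
pose theta := (16 * n%:R * Gamma ^+ 2)^-1.
have th0 : 0 < theta by rewrite invr_gt0 !mulr_gt0// exprn_gt0.
have lamB : (lam * B) ^+ 2 / (4 * theta) = a1.
  by rewrite /lam /theta -sa2 -sn2; field; rewrite !gt_eqF.
have dn : n.*2%:R = 2 * n%:R :> R by rewrite -mul2n natrM.
have vth : n.*2%:R * Gamma ^+ 2 * theta = 1 / 8.
  by rewrite /theta dn; field; rewrite !gt_eqF.
have ethe : n.*2%:R * (theta * Gamma ^+ 2 / (1 - 2 * (1 / 8))) = 1 / 6.
  by rewrite /theta dn; field; rewrite !gt_eqF//; lra.
pose M := expR (2 * a1).
pose K := Num.sqrt 2 ^+ p * expR a1.
have K0 : 0 <= K by rewrite mulr_ge0 ?expR_ge0// exprn_ge0// sqrtr_ge0.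
pose Q (A : {set 'I_(n.*2)}) (z : n.*2.-tuple T) := K * expR (theta * l2norm (ssum A z) ^+ 2).
have mE (A : {set 'I_(n.*2)}) : measurable_fun setT
    (fun z : n.*2.-tuple T => expR (theta * l2norm (ssum A z) ^+ 2)).
  by apply: measurableT_comp => //; apply: measurable_funM => //; exact: measurable_l2norm_ssum.
have bound : minn_average R n * lam * I <= ln M.
  apply: (expected_dev_bound F_cst0 (ltW B0) F_lip F_0 mu_int mu_mgf (Q := Q)) => //.
  - by rewrite -[leLHS]expR0 ler_expR; lra.
  - by move=> A; apply: measurable_funM => //; exact: mE.
  - by move=> A z; rewrite mulr_ge0// expR_ge0.
  - move=> z; apply: (sum_expR_rad_le F_cst0 F_lip F_0 (ltW lam0)) => f Ff.
    apply: (le_trans (F_contraction z (ltW lam0) Ff)).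
    rewrite /Q -mulr_sumr /K -[leRHS]mulrA ler_wpM2l ?exprn_ge0 ?sqrtr_ge0//.
    rewrite mulr_sumr ler_sum// => A _; rewrite -expRD ler_expR -lamB.
    set x := l2norm _; rewrite -subr_ge0.
    rewrite (_ : _ - _ = (2 * theta * x - lam * B) ^+ 2 / (4 * theta)); last first.
      by field; rewrite gt_eqF.
    by rewrite divr_ge0 ?sqr_ge0// mulr_ge0// ltW.
  - rewrite (eq_bigr (fun A : {set 'I_(n.*2)} =>
      (K%:E * \int[power mu n.*2]_z (expR (theta * l2norm (ssum A z) ^+ 2))%:E)%E)); last first.
      by move=> A _; rewrite integral_realZl// => z; exact: expR_ge0.
    rewrite -ge0_sume_distrr; last first.
      by move=> A _; apply: integral_ge0 => z _; rewrite lee_fin expR_ge0.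
    have v1 : 2 * (n.*2%:R * Gamma ^+ 2 * theta) < 1 by rewrite vth; lra.
    have := @sum_ssum_square R h mu Gamma mu_mgf mean_le n.*2 theta (ltW th0) v1.
    rewrite /= vth ethe => /(_ _)/(lee_wpmul2l _)-/(_ K%:E) H.
    apply: le_trans; first by apply: H; rewrite ?lee_fin//; lra.
    have N4 : 2 ^+ n.*2 = 4 ^+ n :> R.
      by rewrite -mul2n exprM; congr (_ ^+ _); lra.
    rewrite -EFinM lee_fin N4 mulrCA ler_wpM2l ?exprn_ge0// /M.
    have s1 : (Num.sqrt (1 - 2 * (1 / 8)))^-1 <= expR (1 / 6) :> R.
      rewrite (_ : 1 - _ = 3 / 4); last by lra.
      by apply: invsqrt_le_expR; rewrite ?invf_div; lra.
    have s2 : (Num.sqrt (1 - 2 * (1 / 6)))^-1 <= expR (1 / 4) :> R.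
      rewrite (_ : 1 - _ = 2 / 3); last by lra.
      by apply: invsqrt_le_expR; rewrite ?invf_div; lra.
    have -> : expR (2 * a1) = K * (expR (1 / 6) ^+ h * expR (1 / 4)).
      rewrite /K sqrt2_expR -!expRM_natr -!expRD; congr expR.
      by rewrite /a1; field.
    rewrite ler_wpM2l// ler_pM//.
    - by rewrite lerXn2r ?nnegrE ?expR_ge0// invr_ge0 sqrtr_ge0.
have al := @minn_average_ge R n 0 n0.
have {}al : 3 / 4 <= minn_average R n.
  by apply: le_trans al; rewrite double0 bin1 expr1; lra.
rewrite expRK in bound.
have I0 : 0 <= I.
  rewrite -lee_fin -devI; apply: integral_ge0 => z _; rewrite lee_fin.
  exact: (dev_ge0 F_cst0 (ltW B0) F_lip mu_int).
have I1 : I <= 8 / 3 * a1 / lam.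
  rewrite ler_pdivlMr//.
  have := ler_wpM2r (mulr_ge0 (ltW lam0) I0) al; rewrite mulrA; lra.
apply: (le_trans I1).
have -> : 8 / 3 * a1 / lam = 2 * Gamma * B * (8 / 3 * sa) * sn.
  by rewrite /lam -sa2; field; rewrite !gt_eqF.
have G0 : 0 <= 2 * Gamma * B by rewrite !mulr_ge0// ltW.
rewrite ler_wpM2r ?(ltW sn0)// ler_wpM2l//.
have sa80 : 0 <= 8 / 3 * sa by rewrite mulr_ge0// ltW.
(* The factor [8 / 3] is [2 / (3 / 4)]. After squaring, the claim holds term by term: [32 / 9 <= 6]
   for the layers, [32 / 27 <= 5 / 4] for [h], and [16 / 9 <= 6 * ln 2]. *)
rewrite -(ger0_norm sa80) -sqrtr_sqr ler_wsqrtr// exprMn sa2 /a1.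
by rewrite -natr1; lra.
Qed.

End mean_deviation_l2.

(** Jensen's inequality in logarithmic form, with the same tangent line as in
    [expected_dev_bound]. *)
Lemma integral_le_ln (R : realType) d (T : measurableType d)
    (P : probability T R) (u w : T -> R) (t M : R) :
  measurable_fun setT u -> measurable_fun setT w -> (forall x, 0 <= u x) ->
  0 < t -> (forall x, expR (t * u x) <= w x) ->
  (\int[P]_x (w x)%:E <= M%:E)%E ->
  (\int[P]_x (u x)%:E <= (ln M / t)%:E)%E.
Proof.
move=> mu mw u0 t0 uw wM.
have w0 x : 0 <= w x by rewrite (le_trans _ (uw x)) ?expR_ge0.
have M1 : 1 <= M.
  rewrite -lee_fin -(integral_probability_cst P 1) (le_trans _ wM)//.
  apply: le_integral_real => // x; rewrite (le_trans _ (uw x))//.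
  by rewrite -[leLHS]expR0 ler_expR mulr_ge0// ltW.
have M0 : 0 < M by rewrite (lt_le_trans _ M1).
have lM : 0 <= ln M by rewrite ln_ge0.
have : (\int[P]_x (t * u x + 1)%:E <= \int[P]_x (ln M + M^-1 * w x)%:E)%E.
  apply: le_integral_real.
  - by apply: measurable_funD => //; exact: measurable_funM.
  - by apply: measurable_funD => //; exact: measurable_funM.
  - by move=> x; rewrite addr_ge0// mulr_ge0// ltW.
  move=> x; have := expR_ge1Dx (t * u x - ln M).
  rewrite expRD expRN lnK ?posrE// => H.
  have := ler_wpM2r (_ : 0 <= M^-1) (uw x); rewrite invr_ge0 ltW// => /(_ erefl).
  by lra.
have iM0 : 0 <= M^-1 by rewrite invr_ge0 ltW.
have tu0 x : 0 <= t * u x by rewrite mulr_ge0// ltW.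
have Mw0 x : 0 <= M^-1 * w x by rewrite mulr_ge0.
rewrite (integral_realD _ (measurable_funM (measurable_cst t) mu)
  (measurable_cst (1 : R)) tu0 (fun=> ler01)).
rewrite (integral_realD _ (measurable_cst (ln M))
  (measurable_funM (measurable_cst M^-1) mw) (fun=> lM) Mw0).
rewrite !integral_realZl ?(ltW t0)// !integral_probability_cst => H.
have {}H : (t%:E * \int[P]_x (u x)%:E + 1%:E <= (ln M)%:E + 1%:E)%E.
  apply: (le_trans H); apply: leeD2l.
  rewrite (_ : 1%:E = (M^-1)%:E * M%:E)%E; first by apply: lee_wpmul2l; rewrite ?lee_fin.
  by rewrite -EFinM mulVf// gt_eqF.
move: H; rewrite leeD2rE// => H.
by rewrite EFinM lee_pdivlMr// muleC.
Qed.

(** * Sup norm: direct maximal inequality *)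

Section mean_deviation_linf.
Variables (R : realType) (h : nat).
Local Notation T := (borel_cV R h).
Variables (F : set (T -> R)) (B : R) (mu : probability T R) (Gamma : R).
Hypothesis h0 : (0 < h)%N.
Hypothesis F_cst0 : F (fun=> 0).
Hypothesis B0 : 0 < B.
Hypothesis F_lip_linf : forall f, F f ->
  forall x y, `|f x - f y| <= B * linf ((x : 'cV[R]_h) - y).
Hypothesis mu_int : forall i : 'I_h,
  mu.-integrable setT (fun x => ((x : 'cV[R]_h) i 0)%:E).
Hypothesis mu_mgf : subgaussian mu Gamma.
Hypothesis Gamma0 : 0 < Gamma.

Let F_lip f : F f ->
  forall x y, `|f x - f y| <= B * l2norm ((x : 'cV[R]_h) - y).
Proof.
move=> Ff x y; rewrite (le_trans (F_lip_linf Ff _ _))//.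
by rewrite ler_wpM2l ?linf_l2norm// ltW.
Qed.

Let coord_exp (s : R) j (v : 'cV[R]_h) : expR (s * v j 0) = expR (dot (s *: delta_mx j 0) v).
Proof. by rewrite dotZl dot_delta. Qed.

Let mcoord_exp (s : R) j (m : 'cV[R]_h) :
  measurable_fun setT (fun x : T => expR (s * ((x : 'cV[R]_h) - m) j 0)).
Proof.
by under eq_fun do rewrite coord_exp; exact: measurable_expR_dotB.
Qed.

Let coord_mgf (s : R) j :
  (\int[mu]_x (expR (s * ((x : 'cV[R]_h) - mean mu) j 0))%:E <=
   (expR (s ^+ 2 * Gamma ^+ 2 / 2))%:E)%E.
Proof.
under eq_integral do rewrite coord_exp.
apply: (le_trans (mu_mgf _)); rewrite l2normZ l2norm_delta mulr1.
by rewrite real_normK ?num_real.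
Qed.

(** Majorant of [expR (t * linf (x - m))] by [expR_linf_le], with explicit moments. *)
Let E (t : R) (m : 'cV[R]_h) (x : T) : R :=
  \sum_j (expR (t * ((x : 'cV[R]_h) - m) j 0) + expR (- t * ((x : 'cV[R]_h) - m) j 0)).

Let mE t m : measurable_fun setT (E t m).
Proof. by apply: measurable_sum => j; apply: measurable_funD; exact: mcoord_exp. Qed.

Let E_ge0 t m x : 0 <= E t m x.
Proof. by apply: sumr_ge0 => j _; rewrite addr_ge0// expR_ge0. Qed.

Let integral_E (t : R) : (\int[mu]_x (E t (mean mu) x)%:E <=
  (expR (t ^+ 2 * Gamma ^+ 2 / 2) * (2 * h%:R))%:E)%E.
Proof.
rewrite integral_real_sum; last 2 first.
- by move=> j; apply: measurable_funD; exact: mcoord_exp.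
- by move=> j x; rewrite addr_ge0// expR_ge0.
set c := expR _.
apply: (@le_trans _ _ (\sum_(j < h) (c + c)%:E)%E).
  apply: lee_sum => j _; rewrite (integral_realD _ (mcoord_exp _ _ _)
    (mcoord_exp _ _ _) (fun=> expR_ge0 _) (fun=> expR_ge0 _)).
  rewrite EFinD; apply: leeD; first exact: coord_mgf.
  by rewrite /c -(sqrrN t); exact: coord_mgf.
by rewrite sumEFin sumr_const card_ord lee_fin -mulr_natr; lra.
Qed.

(** Each [f x - expect f] is at most [B] times the mean distance from [x] to a copy [y]. The
    exponential moment of that distance splits at the mean into a factor for [x] and a sub-Gaussian
    factor for [y]. *)
Lemma dev_le_linf n (z : n.-tuple T) (t : R) : 0 < t ->
  dev F mu z <= \sum_i (B / t *
    ln (expR (t ^+ 2 * Gamma ^+ 2 / 2) * E t (mean mu) (tnth z i))).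
Proof.
move=> t0; apply: (supF_le F_cst0) => f Ff; apply: ler_sum => i _.
set x : T := tnth z i; set c := expR _.
have mlinf : measurable_fun setT (fun y : T => linf ((x : 'cV[R]_h) - y)).
  apply: (@lipschitz_measurable1 _ _ _ 1) => y y'; rewrite mul1r.
  rewrite (le_trans _ (linf_l2norm _))//.
  have H (u v : 'cV[R]_h) : linf u - linf v <= linf (u - v).
    rewrite lerBlDr; apply: linf_le => [|j]; first by rewrite addr_ge0// linf_ge0.
    rewrite -[u](subrK v) mxE (le_trans (ler_normD _ _))// lerD ?le_linf//.
    by rewrite (le_trans (le_linf _ j))// addrK.
  have linfN (u : 'cV[R]_h) : linf (- u) <= linf u.
    by apply: linf_le => [|j]; rewrite ?linf_ge0// mxE normrN le_linf.
  have e (a b : 'cV[R]_h) : (x : 'cV[R]_h) - a - (x - b) = b - a.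
    by rewrite opprB addrC addrA subrK.
  have H' (a b : 'cV[R]_h) : linf ((x : 'cV[R]_h) - a) - linf ((x : 'cV[R]_h) - b) <= linf (b - a).
    by rewrite (le_trans (H _ _))// e.
  rewrite ler_norml; apply/andP; split; first by rewrite lerNl opprB H'.
  by rewrite (le_trans _ (linfN _))// opprB H'.
rewrite -lee_fin.
apply: (le_trans (sub_expect_le F_lip mu_int (D := fun y => B * linf ((x : 'cV[R]_h) - y)) Ff _ _ _)).
- exact: measurable_funM.
- by move=> y; rewrite mulr_ge0 ?linf_ge0// ltW.
- by move=> y; rewrite (le_trans (ler_norm _))// F_lip_linf.
rewrite (integral_realZl _ mlinf (fun=> linf_ge0 _) (ltW B0)).
rewrite mulrAC -mulrA EFinM; apply: lee_wpmul2l; first by rewrite lee_fin ltW.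
have swap (a b : 'cV[R]_h) j : (a - b) j 0 = - (b - a) j 0.
  by rewrite -opprB mxE.
have EC : (fun y => E t y x) = E t x.
  apply/funext => y; apply: eq_bigr => j _; rewrite addrC.
  by rewrite (swap x y) mulrNN mulNr mulrN.
apply: (integral_le_ln (u := fun y : T => linf ((x : 'cV[R]_h) - y)) (w := fun y : T => E t y x) (t := t)) => //.
- by rewrite EC; exact: mE.
- by move=> y; exact: linf_ge0.
- move=> y; apply: (le_trans (expR_linf_le _ h0 t0)).
  by apply: ler_sum => j _; rewrite mulNr.
have one (s : R) j : (\int[mu]_y (expR (s * ((x : 'cV[R]_h) - y) j 0))%:E <=
    (expR (s ^+ 2 * Gamma ^+ 2 / 2) * expR (s * ((x : 'cV[R]_h) - mean mu) j 0))%:E)%E.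
  have -> : (fun y : T => (expR (s * ((x : 'cV[R]_h) - y) j 0))%:E) =
      fun y : T => (expR (s * ((x : 'cV[R]_h) - mean mu) j 0) *
                expR (- s * ((y : 'cV[R]_h) - mean mu) j 0))%:E.
    by apply/funext => y; rewrite -expRD; congr (expR _)%:E; rewrite !mxE; ring.
  rewrite (integral_realZl _ (mcoord_exp _ _ _) (fun=> expR_ge0 _) (expR_ge0 _)).
  rewrite [X in (_ <= X%:E)%E]mulrC EFinM.
  apply: lee_wpmul2l; first by rewrite lee_fin expR_ge0.
  by rewrite -(sqrrN s); exact: coord_mgf.
have mone (s : R) j : measurable_fun setT (fun y : T => expR (s * ((x : 'cV[R]_h) - y) j 0)).
  under eq_fun do rewrite swap mulrN -mulNr; exact: mcoord_exp.
rewrite integral_real_sum; last 2 first.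
- by move=> j; apply: measurable_funD; exact: mone.
- by move=> j y; rewrite addr_ge0// expR_ge0.
rewrite mulr_sumr -sumEFin; apply: lee_sum => j _.
rewrite (integral_realD _ (mone _ _) (mone _ _) (fun=> expR_ge0 _) (fun=> expR_ge0 _)).
rewrite mulrDr EFinD; apply: leeD; first exact: one.
by rewrite /c -(sqrrN t); exact: one.
Qed.

Lemma mean_dev_few n (I : R) : (\int[power mu n]_z (dev F mu z)%:E = I%:E)%E ->
  I <= n%:R * (2 * Gamma * B * Num.sqrt (ln (2 * h%:R))).
Proof.
move=> devI; set l := ln (2 * h%:R).
have h1 : 1 <= h%:R :> R by rewrite ler1n.
have l0 : 0 < l by rewrite /l ln_gt0//; lra.
set s := Num.sqrt l; have s0 : 0 < s by rewrite sqrtr_gt0.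
have s2 : s ^+ 2 = l by rewrite sqr_sqrtr// ltW.
(* This balances [t ^+ 2 * Gamma ^+ 2] with [ln (2 * h)], so each point costs [B / t * (2 * l)]. *)
pose t := s / Gamma; have t0 : 0 < t by rewrite divr_gt0.
have tG : t ^+ 2 * Gamma ^+ 2 = l by rewrite /t -s2; field; rewrite gt_eqF.
set c := expR (t ^+ 2 * Gamma ^+ 2 / 2).
have E1 x : 1 <= E t (mean mu) x.
  have := expR_linf_le ((x : 'cV[R]_h) - mean mu) h0 t0.
  under [in leRHS]eq_bigr do rewrite -mulNr.
  apply: le_trans; rewrite -[leLHS]expR0 ler_expR mulr_ge0 ?linf_ge0//.
  exact: ltW.
have c1 : 1 <= c by rewrite -[leLHS]expR0 ler_expR divr_ge0// mulr_ge0// sqr_ge0.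
have cE1 x : 1 <= c * E t (mean mu) x.
  by rewrite -[leLHS]mulr1 ler_pM// ltW// (lt_le_trans ltr01).
have mcE : measurable_fun setT (fun x => c * E t (mean mu) x).
  by apply: measurable_funM => //; exact: mE.
pose u x := ln (c * E t (mean mu) x).
have mu' : measurable_fun setT u.
  exact: (measurableT_comp (@measurable_ln _)).
have u0 x : 0 <= u x by rewrite ln_ge0.
have mtn (f : T -> R) i : measurable_fun setT f ->
    measurable_fun setT (fun z : n.-tuple T => f (tnth z i)).
  by move=> mf; exact: (measurableT_comp mf (measurable_tnth i)).
have one i : (\int[power mu n]_z (u (tnth z i))%:E <= (ln (expR l * (2 * h%:R)) / 1)%:E)%E.
  apply: (integral_le_ln (w := fun z : n.-tuple T => c * E t (mean mu) (tnth z i))) => //.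
  - exact: (mtn u).
  - exact: (mtn (fun x => c * E t (mean mu) x)).
  - by move=> z; rewrite mul1r /u lnK// posrE (lt_le_trans ltr01).
  rewrite integral_realZl ?expR_ge0//; last exact: (mtn (E t (mean mu))).
  have e : expR l * (2 * h%:R) = c * (c * (2 * h%:R)).
    by rewrite [RHS]mulrA /c -expRD tG -splitr.
  rewrite e EFinM; apply: lee_wpmul2l; first by rewrite lee_fin expR_ge0.
  pose phi (k : 'I_n) x := if k == i then E t (mean mu) x else 1.
  pose d (k : 'I_n) := if k == i then c * (2 * h%:R) else 1.
  have phiE (z : n.-tuple T) : E t (mean mu) (tnth z i) = \prod_k phi k (tnth z k).
    rewrite (bigD1 i) //= big1 ?mulr1 => [|k /negbTE ki]; last by rewrite /phi ki.
    by rewrite /phi eqxx.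
  have -> : c * (2 * h%:R) = \prod_k d k.
    rewrite (bigD1 i) //= big1 ?mulr1 => [|k /negbTE ki]; last by rewrite /d ki.
    by rewrite /d eqxx.
  under eq_integral do rewrite phiE.
  apply: power_integral_prod_le.
  - by move=> k; rewrite /phi; case: (k == i) => //; exact: mE.
  - by move=> k x; rewrite /phi; case: (k == i).
  - by move=> k; rewrite /d; case: (k == i) => //; rewrite mulr_ge0 ?expR_ge0// mulr_ge0.
  move=> k; rewrite /phi /d; case: (k == i); first exact: integral_E.
  by rewrite integral_probability_cst.
have Bt : 0 <= B / t by rewrite divr_ge0// ltW.
have mS : measurable_fun setT (fun z : n.-tuple T => \sum_i (B / t * u (tnth z i))).
  by apply: measurable_sum => i; apply: measurable_funM => //; exact: (mtn u).
have mdev : measurable_fun setT (fun z : n.-tuple T => dev F mu z).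
  exact: lipschitz_measurable (@dev_lipschitz _ _ _ F_cst0 _ (ltW B0) F_lip _ mu_int n).
have : (\int[power mu n]_z (dev F mu z)%:E <=
    \int[power mu n]_z (\sum_i (B / t * u (tnth z i)))%:E)%E.
  apply: le_integral_real => // z.
    exact: (dev_ge0 F_cst0 (ltW B0) F_lip mu_int).
  exact: dev_le_linf.
rewrite devI integral_real_sum; last 2 first.
- by move=> i; apply: measurable_funM => //; exact: (mtn u).
- by move=> i z; rewrite mulr_ge0.
move=> /le_trans/(_ (lee_sum _ _)).
move=> /(_ (fun=> (B / t * (2 * l))%:E))/(_ _).
rewrite sumEFin sumr_const card_ord lee_fin => H.
apply: (le_trans (H _)) => [i _|].
  rewrite (integral_realZl _ (mtn u i mu') (fun=> u0 _) Bt) [leRHS]EFinM.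
  apply: lee_wpmul2l; first by rewrite lee_fin.
  apply: (le_trans (one i)); rewrite lee_fin divr1 lnM ?posrE ?expR_gt0//; last by lra.
  by rewrite expRK -/l; lra.
rewrite -[leLHS]mulr_natl le_eqVlt; apply/orP; left; apply/eqP.
by rewrite /t -s2; field; rewrite !gt_eqF.
Qed.

End mean_deviation_linf.

Section mean_deviation_linf_bound.
Variables (R : realType) (h : nat).
Local Notation T := (borel_cV R h).
Variables (F : set (T -> R)) (B : R) (mu : probability T R) (Gamma : R) (p : nat).
Hypothesis h0 : (0 < h)%N.
Hypothesis p0 : (0 < p)%N.
Hypothesis F_cst0 : F (fun=> 0).
Hypothesis B0 : 0 < B.
Hypothesis F_lip_linf : forall f, F f ->
  forall x y, `|f x - f y| <= B * linf ((x : 'cV[R]_h) - y).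
Hypothesis F_0 : forall f, F f -> f (0 : 'cV[R]_h) = 0.
Hypothesis F_contraction : forall n (z : n.-tuple T) lam (f : {set 'I_n} -> T -> R),
  0 <= lam -> (forall A, F (f A)) ->
  \sum_A expR (lam * `|\sum_k sgset R A k * f A (tnth z k)|) <=
  Num.sqrt 2 ^+ p * \sum_A expR (lam * B * linf (ssum A z)).
Hypothesis mu_int : forall i : 'I_h,
  mu.-integrable setT (fun x => ((x : 'cV[R]_h) i 0)%:E).
Hypothesis mu_mgf : subgaussian mu Gamma.
Hypothesis Gamma0 : 0 < Gamma.
Hypothesis mean_le : l2norm (mean mu) <= Gamma.

Let F_lip f : F f ->
  forall x y, `|f x - f y| <= B * l2norm ((x : 'cV[R]_h) - y).
Proof.
move=> Ff x y; rewrite (le_trans (F_lip_linf Ff _ _))//.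
by rewrite ler_wpM2l ?linf_l2norm// ltW.
Qed.

(** Half of the radicand in the final bound, [p.+1] being the depth. *)
Let D : R := p.+1%:R * ln 2 + ln h%:R.

Let h1 : 1 <= h%:R :> R.
Proof. by rewrite ler1n. Qed.

Let lnh0 : 0 <= ln h%:R :> R.
Proof. exact: ln_ge0. Qed.

Let D_ge : 2 * ln 2 <= D.
Proof.
have l2 := ln2_ge R; have p1 : 1 <= p%:R :> R by rewrite ler1n.
have : 1 * ln 2 <= p%:R * ln 2 :> R by rewrite ler_wpM2r//; lra.
by have := lnh0; rewrite /D -(natr1 p); lra.
Qed.

(** The total moment for the [lam] used below: 2 for the two signs of a coordinate, [sqrt 2] per
    layer, [expR (D / 2)] for the fluctuation, and the last factor for the mean by
    [sum_expR_sqr_le]. Equality holds for [h = 1]. *)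
Lemma sum_ssum_linf_le :
  2 * Num.sqrt 2 ^+ p * (expR (D / 2) * (h%:R - 1 + expR (D / 2))) <=
  expR (3 / 2 * D + ln 2 / 2).
Proof.
set e : R := expR (p.+1%:R * (ln 2 / 2)).
set s : R := Num.sqrt h%:R.
have l2 := ln2_ge R; have p1 : 1 <= p%:R :> R by rewrite ler1n.
have lp : 1 * ln 2 <= p%:R * ln 2 :> R by rewrite ler_wpM2r//; lra.
have s2 : s ^+ 2 = h%:R by rewrite sqr_sqrtr.
have hp : 0 < h%:R :> R by rewrite ltr0n.
have s0 : 0 < s by rewrite sqrtr_gt0.
have s1 : 1 <= s by rewrite -sqrtr1 ler_wsqrtr.
have sE : s = expR (ln h%:R / 2).
  rewrite -[LHS]lnK ?posrE//; congr expR.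
  by rewrite -s2 lnXn// mulr2n; lra.
have eE : expR (D / 2) = e * s by rewrite sE -expRD; congr expR; rewrite /D; lra.
have e2 : 2 <= e.
  rewrite -[leLHS]lnK ?posrE// ler_expR -(natr1 p); lra.
(* With [h = s ^+ 2] the difference of the two sides is [(s - 1) * (e * s - s - 1)]; [2 <= e] comes
   from having at least one hidden layer. *)
have key : h%:R - 1 + e * s <= e * h%:R.
  have : 0 <= (s - 1) * (e * s - s - 1).
    rewrite mulr_ge0 ?subr_ge0//.
    have : 2 * s <= e * s by rewrite ler_wpM2r// ltW.
    lra.
  by rewrite -s2; lra.
have -> : expR (3 / 2 * D + ln 2 / 2) = 2 * Num.sqrt 2 ^+ p * ((e * s) * (e * h%:R)).
  transitivity (expR (ln 2) * expR (ln 2 / 2 * p%:R) *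
      (e * expR (ln h%:R / 2) * (e * expR (ln h%:R))) : R).
    by rewrite /e -!expRD; congr expR; rewrite /D -(natr1 p); field.
  by rewrite expRM_natr -sqrt2_expR sE !lnK ?posrE.
rewrite eE ler_wpM2l ?mulr_ge0 ?exprn_ge0 ?sqrtr_ge0//.
by rewrite ler_wpM2l// mulr_ge0 ?expR_ge0// ltW.
Qed.

(* [lam] is such that [n (lam B Gamma) ^+ 2 = D / 2]. *)
Lemma mean_dev_many n (I alpha : R) : (0 < n)%N ->
  0 < alpha -> alpha <= minn_average R n -> 3 / 2 * D + ln 2 / 2 <= 2 * alpha * D ->
  (\int[power mu n]_z (dev F mu z)%:E = I%:E)%E ->
  I <= 2 * Gamma * B * Num.sqrt (2 * D) * Num.sqrt n%:R.
Proof.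
move=> n0 a0 al aD devI; have n1 : 0 < n%:R :> R by rewrite ltr0n.
have l2 := ln2_ge R; have D0 : 0 < D by have := D_ge; lra.
set sd := Num.sqrt (2 * D); have sd0 : 0 < sd by rewrite sqrtr_gt0 mulr_gt0.
set sn := Num.sqrt n%:R; have sn0 : 0 < sn by rewrite sqrtr_gt0.
have sd2 : sd ^+ 2 = 2 * D by rewrite sqr_sqrtr// mulr_ge0// ltW.
have sn2 : sn ^+ 2 = n%:R by rewrite sqr_sqrtr// ltW.
pose lam := sd / (2 * sn * Gamma * B).
have den0 : 0 < 2 * sn * Gamma * B by rewrite !mulr_gt0.
have lam0 : 0 < lam by rewrite divr_gt0.
set lB := lam * B; have lB0 : 0 < lB by rewrite mulr_gt0.
have lBD : n%:R * lB ^+ 2 * Gamma ^+ 2 = D / 2.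
  rewrite /lB /lam -sn2 (_ : D = sd ^+ 2 / 2); last by rewrite sd2; field.
  by field; rewrite !gt_eqF.
have dn : n.*2%:R = 2 * n%:R :> R by rewrite -mul2n natrM.
pose M := expR (3 / 2 * D + ln 2 / 2).
pose K : R := Num.sqrt 2 ^+ p.
have K0 : 0 <= K by rewrite exprn_ge0// sqrtr_ge0.
pose W (s : R) (A : {set 'I_(n.*2)}) j (z : n.*2.-tuple T) :=
  expR (dot (s *: delta_mx j 0) (ssum A z)).
have mW s A j : measurable_fun setT (W s A j).
  by apply: measurableT_comp => //; exact: measurable_dot_ssum.
have W0 s A j z : 0 <= W s A j z by exact: expR_ge0.
pose S (A : {set 'I_(n.*2)}) (z : n.*2.-tuple T) := \sum_j (W lB A j z + W (- lB) A j z).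
have mS A : measurable_fun setT (S A).
  by apply: measurable_sum => j; exact: measurable_funD.
have S0 A z : 0 <= S A z by rewrite sumr_ge0// => j _; rewrite addr_ge0.
pose Q (A : {set 'I_(n.*2)}) (z : n.*2.-tuple T) := K * S A z.
have bound : minn_average R n * lam * I <= ln M.
  apply: (expected_dev_bound F_cst0 (ltW B0) F_lip F_0 mu_int mu_mgf (Q := Q)) => //.
  - by rewrite -[leLHS]expR0 ler_expR; lra.
  - by move=> A; apply: measurable_funM.
  - by move=> A z; rewrite mulr_ge0.
  - move=> z; apply: (sum_expR_rad_le F_cst0 F_lip F_0 (ltW lam0)) => f Ff.
    apply: (le_trans (F_contraction z (ltW lam0) Ff)).
    rewrite /Q -mulr_sumr ler_wpM2l// ler_sum// => A _.
    rewrite (le_trans (expR_linf_le _ h0 lB0))// ler_sum// => j _.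
    by rewrite /W !dotZl !dot_delta mulNr.
  - have WE s (A : {set 'I_(n.*2)}) j : (\int[power mu n.*2]_z (W s A j z)%:E <=
        (expR (n%:R * s ^+ 2 * Gamma ^+ 2) * expR ((s * mean mu j 0) * \sum_k sgset R A k))%:E)%E.
      apply: (le_trans (ssum_mgf mu_mgf A _)); rewrite lee_fin -expRD ler_expR.
      rewrite dotZl dot_delta l2normZ l2norm_delta mulr1 real_normK ?num_real// dn.
      by rewrite le_eqVlt; apply/orP; left; apply/eqP; field.
    have sumW s j : \sum_(A : {set 'I_(n.*2)}) expR ((s * mean mu j 0) * \sum_k sgset R A k) <=
        4 ^+ n * expR (n%:R * s ^+ 2 * mean mu j 0 ^+ 2).
      apply: (le_trans (sum_expR_signs _ _)).
      have -> : 2 ^+ n.*2 = 4 ^+ n :> R by rewrite -mul2n exprM; congr (_ ^+ _); lra.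
      rewrite ler_wpM2l ?exprn_ge0// ler_expR dn.
      by rewrite le_eqVlt; apply/orP; left; apply/eqP; field.
    have m2 : \sum_j mean mu j 0 ^+ 2 <= Gamma ^+ 2.
      by rewrite -l2norm_sqr ler_sqr ?nnegrE ?l2norm_ge0// ltW.
    have nl0 : 0 <= n%:R * lB ^+ 2 by rewrite mulr_ge0// sqr_ge0.
    have sumj := sum_expR_sqr_le nl0 Gamma0 m2; rewrite lBD in sumj.
    pose w s (A : {set 'I_(n.*2)}) j := expR (D / 2) * expR ((s * mean mu j 0) * \sum_k sgset R A k).
    apply: (@le_trans _ _ (\sum_(A : {set 'I_(n.*2)}) (K * \sum_j (w lB A j + w (- lB) A j))%:E)%E).
      apply: lee_sum => A _; rewrite (integral_realZl _ (mS A) (S0 A) K0) EFinM.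
      apply: lee_wpmul2l; first by rewrite lee_fin.
      rewrite integral_real_sum; last 2 first.
      + by move=> j; exact: measurable_funD.
      + by move=> j z; rewrite addr_ge0.
      rewrite -sumEFin; apply: lee_sum => j _.
      rewrite (integral_realD _ (mW _ _ _) (mW _ _ _) (W0 _ _ _) (W0 _ _ _)) EFinD.
      by rewrite /w -lBD; apply: leeD; [exact: WE|rewrite -(sqrrN lB); exact: WE].
    rewrite sumEFin lee_fin -mulr_sumr exchange_big /=.
    apply: (@le_trans _ _ (K * \sum_j (2 * (4 ^+ n * expR (D / 2)) * expR (n%:R * lB ^+ 2 * mean mu j 0 ^+ 2)))).
      rewrite ler_wpM2l// ler_sum// => j _; rewrite big_split /= -!mulr_sumr -mulrDr.
      have := lerD (sumW lB j) (sumW (- lB) j); rewrite sqrrN.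
      move=> /(ler_wpM2l (expR_ge0 (D / 2)))/le_trans; apply.
      by lra.
    rewrite -mulr_sumr.
    have c0 : 0 <= K * (2 * (4 ^+ n * expR (D / 2))).
      by rewrite !mulr_ge0 ?expR_ge0// exprn_ge0.
    rewrite mulrA (le_trans (ler_wpM2l c0 sumj))//.
    have := ler_wpM2l (exprn_ge0 n (ler0n R 4)) sum_ssum_linf_le.
    by apply: le_trans; rewrite -/K; lra.
rewrite expRK in bound.
have I0 : 0 <= I.
  rewrite -lee_fin -devI; apply: integral_ge0 => z _; rewrite lee_fin.
  exact: (dev_ge0 F_cst0 (ltW B0) F_lip mu_int).
have lI0 : 0 <= lam * I by rewrite mulr_ge0// ltW.
have I1 : lam * I <= 2 * D.
  rewrite -(ler_pM2l a0); have := ler_wpM2r lI0 al; rewrite mulrA.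
  by have := bound; lra.
have -> : 2 * Gamma * B * sd * sn = 2 * D / lam.
  by rewrite /lam -sd2; field; rewrite !gt_eqF.
by rewrite ler_pdivlMr// mulrC.
Qed.

Lemma mean_dev_linf n (I : R) : (0 < n)%N ->
  (\int[power mu n]_z (dev F mu z)%:E = I%:E)%E ->
  I <= 2 * Gamma * B * Num.sqrt (2 * p.+1%:R * ln 2 + 2 * ln h%:R) * Num.sqrt n%:R.
Proof.
move=> n0 devI; have l2 := ln2_ge R.
have -> : 2 * p.+1%:R * ln 2 + 2 * ln h%:R = 2 * D by rewrite /D; lra.
(* [minn_average R n] is too small for [mean_dev_many] when [n <= 2], and, if
   [D = 2 * ln 2], when [n <= 4]. *)
have few : n%:R * ln (2 * h%:R) <= 2 * D ->
    I <= 2 * Gamma * B * Num.sqrt (2 * D) * Num.sqrt n%:R.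
  move=> H.
  apply: (le_trans (mean_dev_few h0 F_cst0 B0 F_lip_linf mu_int mu_mgf Gamma0 devI)).
  set l := ln _ in H *.
  have -> : n%:R * (2 * Gamma * B * Num.sqrt l) =
      2 * Gamma * B * Num.sqrt (n%:R * l) * Num.sqrt n%:R.
    rewrite sqrtrM// -{1}(sqr_sqrtr (ler0n R n)); ring.
  by rewrite ler_wpM2r ?sqrtr_ge0// ler_wpM2l ?ler_wsqrtr// !mulr_ge0// ltW.
have ln2h : ln (2 * h%:R) = ln 2 + ln h%:R :> R by rewrite lnM ?posrE// ltr0n.
have p1 : 1 <= p%:R :> R by rewrite ler1n.
have lp : 1 * ln 2 <= p%:R * ln 2 :> R by rewrite ler_wpM2r//; lra.
have DE : D = p%:R * ln 2 + ln 2 + ln h%:R by rewrite /D -(natr1 p); lra.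
have [n2|n3] := leqP n 2.
  apply: few; rewrite ln2h DE.
  have n2R : n%:R <= 2 :> R by rewrite (ler_nat R n 2).
  have : n%:R * (ln 2 + ln h%:R) <= 2 * (ln 2 + ln h%:R) :> R.
    by rewrite ler_wpM2r// addr_ge0//; lra.
  by lra.
(* [mean_dev_many] asks for [alpha] at least [3 / 4 + ln 2 / (4 * D)], here at most [5 / 6]; from
   [n = 3] on the average is at least [1 - 10 / 64 = 27 / 32]. *)
have [big|] := leP (3 * ln 2) D.
  apply: (mean_dev_many (alpha := 27 / 32) n0) => //; [|lra].
  have := @minn_average_ge R n 2 n3.
  by rewrite (_ : 'C(2.*2.+1, 3) = 10%N)//; lra.
move=> Dsmall; rewrite DE in Dsmall.
have hp1 : (h = 1 /\ p = 1)%N.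
  have [h2|h2] := leqP 2 h.
    have : ln 2 <= ln h%:R :> R by rewrite ler_ln ?posrE ?ltr0n// (ler_nat R 2 h).
    by move=> hh; move: Dsmall; rewrite ltNge => /negP[]; lra.
  have [p2|p2] := leqP 2 p; last first.
    by split; apply/eqP; rewrite eqn_leq; apply/andP; split.
  have p2R : 2 <= p%:R :> R by rewrite (ler_nat R 2 p).
  have : 2 * ln 2 <= p%:R * ln 2 :> R by rewrite ler_wpM2r//; lra.
  by move=> pp; move: Dsmall; rewrite ltNge => /negP[]; have := lnh0; lra.
have [hE pE] := hp1.
have lnh : ln h%:R = 0 :> R by rewrite hE ln1.
have DE' : D = 2 * ln 2 by rewrite DE lnh pE; lra.
have [n4|n5] := leqP n 4.
  apply: few; rewrite ln2h lnh DE' addr0.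
  have n4R : n%:R <= 4 :> R by rewrite (ler_nat R n 4).
  have : n%:R * ln 2 <= 4 * ln 2 :> R by rewrite ler_wpM2r//; lra.
  by lra.
(* For [D = 2 * ln 2] exactly [7 / 8] is required, and [1 - 126 / 1024] exceeds it from [n = 5]
   on. *)
apply: (mean_dev_many (alpha := 7 / 8) n0) => //; [|by rewrite DE'; lra].
have := @minn_average_ge R n 4 n5.
by rewrite (_ : 'C(4.*2.+1, 5) = 126%N)//; lra.
Qed.

End mean_deviation_linf_bound.

(** * Empirical distance *)

Section empirical_measure.
Context (R : realType) d (T : measurableType d) (n : nat) (x : 'I_n -> T).
Local Open Scope ereal_scope.

Lemma ge0_integral_empirical (g : T -> \bar R) :
  measurable_fun setT g -> (forall y, 0 <= g y) ->
  \int[empirical x]_y g y = (n%:R^-1)%:E * \sum_(i < n) g (x i).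
Proof.
move=> mg g0.
pose m k : {measure set T -> \bar R} :=
  if insub k is Some i then dirac (x i) else mzero.
have n0 : (0 <= n%:R^-1 :> R)%R by rewrite invr_ge0.
pose c : {nonneg R} := NngNum n0.
rewrite (@eq_measure_integral _ _ _ _ (mscale c (msum m n)))/=; last first.
  move=> A mA _; rewrite /empirical /mscale/= /msum; congr (_ * _).
  by apply: eq_bigr => i _; rewrite /m valK.
rewrite ge0_integral_mscale//; congr (_ * _).
rewrite ge0_integral_measure_sum//; apply: eq_bigr => i _.
by rewrite /m valK integral_dirac// diracT mul1e.
Qed.

Lemma integral_empirical (f : T -> R) : measurable_fun setT f ->
  \int[empirical x]_y (f y)%:E = (n%:R^-1 * \sum_(i < n) f (x i))%:E.
Proof.
move=> mf; have mfE : measurable_fun setT (EFin \o f) by exact/measurable_EFinP.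
rewrite integralE ge0_integral_empirical//; last exact: measurable_funepos.
rewrite ge0_integral_empirical//; last exact: measurable_funeneg.
under eq_bigr => i _ do rewrite funeposE /= -EFin_max.
under [X in _ - _ * X]eq_bigr => i _ do rewrite funenegE /= -EFin_max.
rewrite !sumEFin -!EFinM -EFinB; congr EFin.
rewrite -mulrBr -sumrB; congr (_ * _)%R; apply: eq_bigr => i _.
have [a0|/ltW a0] := leP 0%R (f (x i)).
  by rewrite max_r ?oppr_le0// subr0.
by rewrite max_l ?oppr_ge0// sub0r opprK.
Qed.

End empirical_measure.

Section distance_deviation.
Variables (R : realType) (h : nat).
Local Notation T := (borel_cV R h).
Variables (F : set (T -> R)) (B : R) (mu nu : probability T R).
Hypothesis F_cst0 : F (fun=> 0).
Hypothesis B0 : 0 <= B.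
Hypothesis F_lip : forall f, F f ->
  forall x y, `|f x - f y| <= B * l2norm ((x : 'cV[R]_h) - y).
Hypothesis F_0 : forall f, F f -> f (0 : 'cV[R]_h) = 0.
Hypothesis F_opp : forall f, F f -> F (fun x => - f x).
Hypothesis mu_int : forall i : 'I_h,
  mu.-integrable setT (fun x => ((x : 'cV[R]_h) i 0)%:E).
Hypothesis nu_int : forall i : 'I_h,
  nu.-integrable setT (fun x => ((x : 'cV[R]_h) i 0)%:E).

(** [K] makes the second supremum finite and [C] then makes the first one finite, so the difference
    of extended reals is genuine. *)
Lemma ereal_sup_dist (a b : (T -> R) -> R) (C K : R) :
  (forall f, F f -> 0 <= a f) -> (forall f, F f -> 0 <= b f <= K) ->
  (forall f, F f -> `|a f - b f| <= C) ->
  (`| ereal_sup [set (a f)%:E | f in F] - ereal_sup [set (b f)%:E | f in F] |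
   <= C%:E)%E.
Proof.
move=> a0 bK ab.
have sup_ge (c : (T -> R) -> R) : (forall f, F f -> 0 <= c f) ->
    (0 <= ereal_sup [set (c f)%:E | f in F])%E.
  move=> c0; apply: (@le_trans _ _ (c (fun=> 0))%:E); first by rewrite lee_fin c0.
  by apply: ereal_sup_ubound; exists (fun=> 0).
have shift_le (c e : (T -> R) -> R) : (forall f, F f -> c f <= e f + C) ->
    (ereal_sup [set (c f)%:E | f in F] <= ereal_sup [set (e f)%:E | f in F] + C%:E)%E.
  move=> ce; apply: ge_ereal_sup => _ [f Ff <-].
  apply: (@le_trans _ _ ((e f)%:E + C%:E)%E); first by rewrite -EFinD lee_fin ce.
  by apply: leeD2r; apply: ereal_sup_ubound; exists f.
have Sb0 := sup_ge b (fun f Ff => proj1 (andP (bK f Ff))).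
have SbK : (ereal_sup [set (b f)%:E | f in F] <= K%:E)%E.
  by apply: ge_ereal_sup => _ [f Ff <-]; rewrite lee_fin; case/andP: (bK f Ff).
have Sa0 := sup_ge a a0.
have Sab := @shift_le a b _; have Sba := @shift_le b a _.
have {}Sab := Sab (fun f Ff => ltac:(by have := ab f Ff; rewrite ler_norml => /andP[]; lra)).
have {}Sba := Sba (fun f Ff => ltac:(by have := ab f Ff; rewrite ler_norml => /andP[]; lra)).
move: Sa0 Sb0 SbK Sab Sba.
case: (ereal_sup [set (b f)%:E | f in F]) => [sb| |]//.
case: (ereal_sup [set (a f)%:E | f in F]) => [sa| |]// _ _ _.
rewrite -!EFinD abse_EFin !lee_fin ler_norml => ? ?.
by apply/andP; split; lra.
Qed.

Lemma nn_distance_dist n m (x : n.-tuple T) (y : m.-tuple T) :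
  (0 < n)%N -> (0 < m)%N ->
  (`| nn_distance F mu nu -
      nn_distance F (empirical (tnth x)) (empirical (tnth y)) |
   <= (n%:R^-1 * dev F mu x + m%:R^-1 * dev F nu y)%:E)%E.
Proof.
move=> n0 m0; rewrite /nn_distance.
pose avg N (z : N.-tuple T) (f : T -> R) := N%:R^-1 * \sum_(i < N) f (tnth z i).
pose a f := `|expect mu f - expect nu f|.
pose b f := `|avg n x f - avg m y f|.
have -> : [set `| \int[mu]_z (f z)%:E - \int[nu]_z (f z)%:E |%E | f in F] =
    [set (a f)%:E | f in F].
  apply: eq_imagel => f Ff.
  by rewrite (expectE F_lip mu_int Ff) (expectE F_lip nu_int Ff).
have -> : [set `| \int[empirical (tnth x)]_z (f z)%:E -
    \int[empirical (tnth y)]_z (f z)%:E |%E | f in F] = [set (b f)%:E | f in F].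
  apply: eq_imagel => f Ff; have mf := lipschitz_measurable1 (F_lip Ff).
  by rewrite !integral_empirical.
have avg_le N (z : N.-tuple T) f : F f ->
    `|avg N z f| <= N%:R^-1 * \sum_(i < N) B * l2norm (tnth z i : 'cV[R]_h).
  move=> Ff; rewrite normrM ger0_norm ?invr_ge0// ler_wpM2l ?invr_ge0//.
  rewrite (le_trans (ler_norm_sum _ _ _))// ler_sum// => i _.
  exact: (F_bound F_lip F_0).
have dist N (z : N.-tuple T) (rho : probability T R) f : (0 < N)%N ->
    (forall i : 'I_h, rho.-integrable setT (fun x => ((x : 'cV[R]_h) i 0)%:E)) ->
    F f -> `|avg N z f - expect rho f| <= N%:R^-1 * dev F rho z.
  move=> N0 rho_int Ff.
  have -> : avg N z f - expect rho f = N%:R^-1 * \sum_i (f (tnth z i) - expect rho f).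
    rewrite sumrB sumr_const card_ord mulrBr -(mulr_natl (expect rho f)) mulKf//.
    by rewrite pnatr_eq0 -lt0n.
  rewrite normrM ger0_norm ?invr_ge0// ler_wpM2l ?invr_ge0//.
  exact: (abs_dev B0 F_lip rho_int F_opp).
apply: (@ereal_sup_dist a b _ (n%:R^-1 * (\sum_(i < n) B * l2norm (tnth x i : 'cV[R]_h)) +
  m%:R^-1 * (\sum_(i < m) B * l2norm (tnth y i : 'cV[R]_h)))) => f Ff.
- exact: normr_ge0.
- by rewrite normr_ge0 (le_trans (ler_normB _ _))// lerD// avg_le.
rewrite (le_trans (ler_dist_dist _ _))//.
have := dist n x mu f n0 mu_int Ff; have := dist m y nu f m0 nu_int Ff.
rewrite !ler_norml => /andP[? ?] /andP[? ?]; apply/andP; split; lra.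
Qed.

End distance_deviation.

(* The two deviations need not be independent: convexity of [expR] reduces the
   weighted sum to its two terms. *)
Lemma convex_tail (R : realType) d (Omega : measurableType d)
    (P : probability Omega R) (U V : Omega -> R) (w c K : R) :
  measurable_fun setT U -> measurable_fun setT V -> 0 <= w -> w <= 1 ->
  (\int[P]_x (expR (U x))%:E <= K%:E)%E -> (\int[P]_x (expR (V x))%:E <= K%:E)%E ->
  let E := [set x | (1 - w) * U x + w * V x <= c] in
  measurable E /\ ((1 - K * expR (- c))%:E <= P E)%E.
Proof.
move=> mU mV w0 w1 UK VK E; have w1' : 0 <= 1 - w by rewrite subr_ge0.
pose g x := (1 - w) * U x + w * V x.
have mg : measurable_fun setT g.
  by apply: measurable_funD; exact: measurable_funM.
have mE : measurable E.
  rewrite (_ : E = setT `&` g @^-1` `]-oo, c]); first exact: mg.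
  by rewrite setTI; apply/seteqP; split => x; rewrite /= in_itv.
split=> //; have mEC := measurableC mE.
have mexp (f : Omega -> R) : measurable_fun setT f ->
    measurable_fun setT (fun x => expR (f x)) by exact: measurableT_comp.
have tail : ((expR c)%:E * P (~` E) <= K%:E)%E.
  have -> : ((expR c)%:E * P (~` E) =
      \int[P]_x (expR c * (\1_(~` E) x : R))%:E)%E.
    by rewrite integral_realZl ?expR_ge0// integral_indic// setIT.
  apply: (@le_trans _ _ (\int[P]_x ((1 - w) * expR (U x) + w * expR (V x))%:E)%E).
    apply: le_integral_real.
    - by apply: measurable_funM.
    - by apply: measurable_funD; apply: measurable_funM => //; exact: mexp.
    - by move=> x; rewrite mulr_ge0 ?expR_ge0.
    move=> x; rewrite indicE; have [xE|xE] := boolP (x \in ~` E).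
      rewrite mulr1 (le_trans _ (expR_convex _ _ w0 w1))// ler_expR.
      by move: xE; rewrite inE /E /= => /negP; rewrite -ltNge => /ltW.
    by rewrite mulr0 addr_ge0// mulr_ge0// expR_ge0.
  rewrite integral_realD; [|exact: measurable_funM (mexp _ mU)
    |exact: measurable_funM (mexp _ mV)|by move=> x; rewrite mulr_ge0 ?expR_ge0..].
  rewrite !integral_realZl//; try exact: mexp; try by move=> x; exact: expR_ge0.
  apply: (@le_trans _ _ ((1 - w)%:E * K%:E + w%:E * K%:E)%E).
    by apply: leeD; apply: lee_wpmul2l; rewrite ?lee_fin.
  by rewrite -!EFinM -EFinD lee_fin; lra.
have PE := probability_setC P mEC; rewrite setCK in PE.
have fPE : P (~` E) \is a fin_num by exact: fin_num_measure.
rewrite PE -(fineK fPE) -EFinB lee_fin lerD2l lerN2.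
move: tail; rewrite -(fineK fPE) -EFinM lee_fin expRN.
by rewrite ler_pdivlMr ?expR_gt0// mulrC.
Qed.

(** * Tail bound for the two samples *)

Section sample_deviation.
Variables (R : realType) (h : nat).
Local Notation T := (borel_cV R h).
Variables (F : set (T -> R)) (B Gamma W : R) (mu : probability T R).
Context (dO : measure_display) (Omega : measurableType dO) (P : probability Omega R).
Hypothesis F_cst0 : F (fun=> 0).
Hypothesis B0 : 0 < B.
Hypothesis F_lip : forall f, F f ->
  forall x y, `|f x - f y| <= B * l2norm ((x : 'cV[R]_h) - y).
Hypothesis mu_int : forall i : 'I_h,
  mu.-integrable setT (fun x => ((x : 'cV[R]_h) i 0)%:E).
Hypothesis mu_mgf : subgaussian mu Gamma.

Lemma measurable_sample_dev n (Z : 'I_n -> Omega -> T) :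
  (forall i, measurable_fun setT (Z i)) ->
  measurable_fun setT (fun w => dev F mu [tuple Z i w | i < n]).
Proof.
move=> mZ; apply: (measurableT_comp _ (measurable_mktuple mZ)).
exact: lipschitz_measurable (@dev_lipschitz _ _ _ F_cst0 _ (ltW B0) F_lip _ mu_int n).
Qed.

(** Normalising by [sqrt n] frees the bound of the sample size, since
    [n * (t * B / sqrt n) ^+ 2 = (t * B) ^+ 2]; both samples then share the constant [K] that
    [convex_tail] requires. *)
Lemma sample_dev_mgf n (Z : 'I_n -> Omega -> T) (t : R) : (0 < n)%N ->
  (forall i, measurable_fun setT (Z i)) -> iid P mu Z -> 0 <= t ->
  (forall I, (\int[power mu n]_z (dev F mu z)%:E = I%:E)%E -> I <= W * Num.sqrt n%:R) ->
  (\int[P]_w (expR (t * (dev F mu [tuple Z i w | i < n] / Num.sqrt n%:R)))%:E <=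
   (expR (t * W + t ^+ 2 * B ^+ 2 * h%:R * Gamma ^+ 2))%:E)%E.
Proof.
move=> n0 mZ iZ t0 HW; set s := Num.sqrt n%:R.
have s0 : 0 < s by rewrite sqrtr_gt0 ltr0n.
have s2 : s ^+ 2 = n%:R by rewrite sqr_sqrtr.
have c0 : 0 <= t / s by rewrite divr_ge0// ltW.
have dL := @dev_lipschitz _ _ _ F_cst0 _ (ltW B0) F_lip _ mu_int n.
have mdev := lipschitz_measurable dL.
have d0 (z : n.-tuple T) : 0 <= dev F mu z.
  exact: (dev_ge0 F_cst0 (ltW B0) F_lip mu_int).
have [I [HI _]] := concentration mu_int (ltW B0) dL d0 mu_mgf.
have gL : tuple_lipschitz (t / s * B) (fun z : n.-tuple T => t / s * dev F mu z).
  by move=> z z'; rewrite -mulrBr normrM (ger0_norm c0) -[leRHS]mulrA ler_wpM2l//.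
have [J [HJ HJ']] := concentration mu_int (mulr_ge0 c0 (ltW B0)) gL
  (fun z => mulr_ge0 c0 (d0 z)) mu_mgf.
have JE : J = t / s * I.
  by apply: EFin_inj; rewrite -HJ integral_realZl// HI.
rewrite (iid_ge0_integral (f := fun z => (expR (t * (dev F mu z / s)))%:E) mZ iZ)//.
- apply: le_trans (le_trans HJ' _).
    rewrite le_eqVlt; apply/orP; left; apply/eqP; apply: eq_integral => z _.
    by congr (expR _)%:E; ring.
  rewrite lee_fin ler_expR lerD//.
    by rewrite JE mulrAC -mulrA ler_wpM2l// ler_pdivrMr// HW.
  rewrite le_eqVlt; apply/orP; left; apply/eqP.
  by rewrite -s2; field; rewrite gt_eqF.
- by apply/measurable_EFinP; apply: measurableT_comp => //; do 2 apply: measurable_funM => //.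
Qed.

End sample_deviation.

Section samples.
Context (R : realType) (d dO : measure_display) (T : measurableType d)
  (Omega : measurableType dO).
Variables (P : probability Omega R) (mu nu : probability T R) (n m : nat).
Variables (X : 'I_n -> {mfun Omega >-> T}) (Y : 'I_m -> {mfun Omega >-> T}).
Hypothesis XY : iid_samples P mu nu X Y.

Let joint_law (A : 'I_n -> set T) (C : 'I_m -> set T) :
  (forall i, measurable (A i)) -> (forall j, measurable (C j)) ->
  (P [set w | (forall i, A i (X i w)) /\ (forall j, C j (Y j w))] =
   (\prod_i mu (A i)) * \prod_j nu (C j))%E.
Proof.
move=> mA mC; case: XY => lX lY ind.
pose S (s : 'I_n + 'I_m) := match s with inl i => A i | inr j => C j end.
have mS s : measurable (S s) by case: s.
have := ind [set: _]%SET S (fun s _ => mS s).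
rewrite (eq_bigl xpredT) => [|s]; last by rewrite inE.
rewrite big_sumType /=.
rewrite (eq_bigr (fun i => mu (A i))) => [|i _]; last exact: lX.
rewrite [X in (_ * X)%E](eq_bigr (fun j => nu (C j))) => [<-|j _]; last exact: lY.
congr (P _); apply/seteqP; split => w /=.
  by move=> [HA HC] [i|j] _ /=; [exact: HA|exact: HC].
by move=> H; split => [i|j]; [apply: (H (inl i))|apply: (H (inr j))]; rewrite /= inE.
Qed.

Lemma iid_samples_left : iid P mu (fun i w => X i w).
Proof.
move=> A mA; have := joint_law mA (fun=> measurableT).
rewrite [X in (_ * X)%E]big1 ?mule1 => [<-|j _]; last exact: probability_setT.
by congr (P _); apply/seteqP; split => w /=; [split|case].
Qed.

Lemma iid_samples_right : iid P nu (fun j w => Y j w).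
Proof.
move=> C mC; have := joint_law (fun=> measurableT) mC.
rewrite [X in (X * _)%E]big1 ?mul1e => [<-|j _]; last exact: probability_setT.
by congr (P _); apply/seteqP; split => w /=; [split|case].
Qed.

End samples.

Section two_samples.
Variables (R : realType) (h : nat).
Local Notation T := (borel_cV R h).
Variables (F : set (T -> R)) (B Gamma W : R) (mu nu : probability T R).
Context (dO : measure_display) (Omega : measurableType dO) (P : probability Omega R).
Hypothesis h0 : (0 < h)%N.
Hypothesis F_cst0 : F (fun=> 0).
Hypothesis B0 : 0 < B.
Hypothesis Gamma0 : 0 < Gamma.
Hypothesis F_lip : forall f, F f ->
  forall x y, `|f x - f y| <= B * l2norm ((x : 'cV[R]_h) - y).
Hypothesis F_0 : forall f, F f -> f (0 : 'cV[R]_h) = 0.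
Hypothesis F_opp : forall f, F f -> F (fun x => - f x).
Hypothesis mean_dev : forall rho : probability T R,
  (forall i : 'I_h, rho.-integrable setT (fun x => ((x : 'cV[R]_h) i 0)%:E)) ->
  subgaussian rho Gamma -> l2norm (mean rho) <= Gamma ->
  forall n I, (0 < n)%N -> (\int[power rho n]_z (dev F rho z)%:E = I%:E)%E ->
  I <= W * Num.sqrt n%:R.

Lemma P_uB_subgaussian (rho : probability T R) : P_uB Gamma rho ->
  [/\ forall i : 'I_h, rho.-integrable setT (fun x => ((x : 'cV[R]_h) i 0)%:E),
    subgaussian rho Gamma & l2norm (mean rho) <= Gamma].
Proof.
case=> _ rho_int rho_mean [tau [tau0 tauG rho_mgf]]; split=> // a.
apply: (le_trans (rho_mgf a)); rewrite lee_fin ler_expR.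
rewrite ler_wpM2r// ler_wpM2l ?sqr_ge0// ler_sqr// nnegrE ltW//.
Qed.

Lemma two_samples_bound n m (X : 'I_n -> {mfun Omega >-> T})
    (Y : 'I_m -> {mfun Omega >-> T}) (delta : R) :
  (0 < n)%N -> (0 < m)%N -> P_uB Gamma mu -> P_uB Gamma nu ->
  iid_samples P mu nu X Y -> 0 < delta -> delta < 1 ->
  with_prob_ge P (1 - delta) [set omega |
    (`| nn_distance F mu nu - nn_distance F (empirical (fun i => X i omega))
          (empirical (fun j => Y j omega)) |
     <= ((W + 2 * Gamma * B * Num.sqrt (h%:R * ln (1 / delta))) *
         ((Num.sqrt n%:R)^-1 + (Num.sqrt m%:R)^-1))%:E)%E].
Proof.
move=> n0 m0 /P_uB_subgaussian[mu_int mu_mgf mu_mean]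
  /P_uB_subgaussian[nu_int nu_mgf nu_mean] XY delta0 delta1.
set l := ln (1 / delta).
have l0 : 0 < l by rewrite ln_gt0// div1r invf_gt1.
have h1 : 0 < h%:R :> R by rewrite ltr0n.
set q := Num.sqrt (h%:R * l); have q0 : 0 < q by rewrite sqrtr_gt0 mulr_gt0.
have q2 : q ^+ 2 = h%:R * l by rewrite sqr_sqrtr// mulr_ge0// ltW.
set sn := Num.sqrt n%:R; have sn0 : 0 < sn by rewrite sqrtr_gt0 ltr0n.
set sm := Num.sqrt m%:R; have sm0 : 0 < sm by rewrite sqrtr_gt0 ltr0n.
have sn2 : sn ^+ 2 = n%:R by rewrite sqr_sqrtr.
have sm2 : sm ^+ 2 = m%:R by rewrite sqr_sqrtr.
(* The Chernoff optimum: it minimises [t ^+ 2 * B ^+ 2 * h * Gamma ^+ 2 - 2 * t * Gamma * B * q],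
   with minimum [- l = ln delta]. *)
pose t := q / (h%:R * Gamma * B).
have t0 : 0 < t by rewrite divr_gt0// !mulr_gt0.
pose K := expR (t * W + t ^+ 2 * B ^+ 2 * h%:R * Gamma ^+ 2).
pose DX w := dev F mu [tuple X i w | i < n].
pose DY w := dev F nu [tuple Y j w | j < m].
have mDX : measurable_fun setT DX.
  exact: (measurable_sample_dev F_cst0 B0 F_lip mu_int).
have mDY : measurable_fun setT DY.
  exact: (measurable_sample_dev F_cst0 B0 F_lip nu_int).
have eX : (\int[P]_w (expR (t * (DX w / sn)))%:E <= K%:E)%E.
  apply: (sample_dev_mgf F_cst0 B0 F_lip mu_int mu_mgf) => //.
  - exact: iid_samples_left XY.
  - exact: ltW.
  - by move=> I; exact: mean_dev.
have eY : (\int[P]_w (expR (t * (DY w / sm)))%:E <= K%:E)%E.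
  apply: (sample_dev_mgf F_cst0 B0 F_lip nu_int nu_mgf) => //.
  - exact: iid_samples_right XY.
  - exact: ltW.
  - by move=> I; exact: mean_dev.
(* With this weight, [DX / n + DY / m] is [sn^-1 + sm^-1] times the convex combination of [DX / sn]
   and [DY / sm]. *)
pose w0 := sm^-1 / (sn^-1 + sm^-1).
have r0 : 0 < sn^-1 + sm^-1 by rewrite addr_gt0 ?invr_gt0.
have w00 : 0 <= w0 by rewrite divr_ge0 ?invr_ge0 ?ltW.
have w01 : w0 <= 1 by rewrite ler_pdivrMr// mul1r lerDr invr_ge0 ltW.
have mU (D : Omega -> R) s : measurable_fun setT D ->
    measurable_fun setT (fun w => t * (D w / s)).
  by move=> mD; do 2 apply: measurable_funM => //.
have [mE PE] := convex_tail (t * (W + 2 * Gamma * B * q)) (mU DX sn mDX)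
  (mU DY sm mDY) w00 w01 eX eY.
set E := [set _ | _] in mE PE.
exists E; last first.
  apply: le_trans PE; rewrite lee_fin lerD2l lerN2 /K -expRD.
  have -> : t * W + t ^+ 2 * B ^+ 2 * h%:R * Gamma ^+ 2 +
      - (t * (W + 2 * Gamma * B * q)) = - l.
    have -> : l = q ^+ 2 / h%:R by rewrite q2 mulrAC mulfV ?mul1r// gt_eqF.
    by rewrite /t; field; rewrite !gt_eqF.
  by rewrite expRN /l lnK ?posrE ?divr_gt0// div1r invrK.
split=> // w; rewrite /E /= => Ew.
have tn N (Z : 'I_N -> {mfun Omega >-> T}) :
    (fun i => Z i w) = tnth [tuple Z i w | i < N].
  by apply/funext => i; rewrite tnth_mktuple.
rewrite (tn n X) (tn m Y).
apply: (le_trans (nn_distance_dist F_cst0 (ltW B0) F_lip F_0 F_opp mu_int nu_int _ _ n0 m0)).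
rewrite lee_fin -/(DX w) -/(DY w) -sn2 -sm2.
have {}Ew : t * ((1 - w0) * (DX w / sn) + w0 * (DY w / sm)) <= t * (W + 2 * Gamma * B * q).
  by apply: le_trans Ew; rewrite le_eqVlt; apply/orP; left; apply/eqP; ring.
rewrite ler_pM2l// in Ew.
rewrite (_ : _ + _ = ((1 - w0) * (DX w / sn) + w0 * (DY w / sm)) * (sn^-1 + sm^-1)).
  by rewrite ler_wpM2r// ltW.
by rewrite /w0; field; rewrite ?gt_eqF// ?addr_gt0.
Qed.

End two_samples.

(** * Network classes *)

Section network_class.
Variables (R : realType) (p : nat) (k : nat -> nat) (sigma : nat -> R -> R).
Variables (L M c : nat -> R) (norm : forall n, 'cV[R]_n -> R).
Variable ok : forall i, 'M[R]_(k i.+1, k i) -> Prop.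
Variable ok_out : 'cV[R]_(k p) -> Prop.
Hypothesis L0 : forall i, (i < p)%N -> 0 <= L i.
Hypothesis M0 : forall i, (i <= p)%N -> 0 <= M i.
Hypothesis c0 : forall i, (i < p)%N -> 0 <= c i.
Hypothesis sigma0 : forall i, (i < p)%N -> sigma i 0 = 0.
Hypothesis sigma_homo : forall i, (i < p)%N -> {homo sigma i : x y / x <= y}.
Hypothesis sigma_lip : forall i, (i < p)%N ->
  forall x y, `|sigma i x - sigma i y| <= L i * `|x - y|.
Hypothesis unit_bound : forall i, (i < p)%N ->
  forall (W : 'M[R]_(k i.+1, k i)) N (a : 'I_N -> R) (v : 'I_N -> 'cV[R]_(k i)),
  ok W -> exists w : 'cV[R]_(k i),
    (forall u, c i * `|dot w u| <= M i * norm u) /\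
    norm (\sum_j a j *: map_mx (sigma i) (W *m v j))
      <= c i * `|\sum_j a j * sigma i (dot w (v j))|.
Hypothesis norm_mul : forall i, (i < p)%N ->
  forall W : 'M[R]_(k i.+1, k i), ok W -> forall v, norm (W *m v) <= M i * norm v.
Hypothesis norm_map : forall i, (i < p)%N -> forall u v : 'cV[R]_(k i.+1),
  norm (map_mx (sigma i) u - map_mx (sigma i) v) <= L i * norm (u - v).
Hypothesis norm_out : forall w, ok_out w -> forall v, `|dot w v| <= M p * norm v.
Hypothesis ok0 : forall i, (i < p)%N -> ok (0 : 'M[R]_(k i.+1, k i)).
Hypothesis ok_out0 : ok_out 0.
Hypothesis ok_outN : forall w, ok_out w -> ok_out (- w).

Let params (W : weights R k) (w : 'cV[R]_(k p)) :=
  (forall i, (i < p)%N -> ok (W i)) /\ ok_out w.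
Let B := (\prod_(i < p.+1) M i) * \prod_(i < p) L i.
Let F := nn_class p.+1 k sigma params.

Let dot0 n (v : 'cV[R]_n) : dot 0 v = 0.
Proof. by rewrite -(scale0r (0 : 'cV[R]_n)) dotZl mul0r. Qed.

Let BE : B = M p * \prod_(i < p) (M i * L i).
Proof. by rewrite /B big_ord_recr /= big_split /= mulrA (mulrC (M p)). Qed.

Lemma nn_class_cst0 : F (fun=> 0).
Proof.
exists (fun i => 0), 0; split; first by split.
by apply/funext => x; rewrite /network dot0.
Qed.

Lemma nn_class_opp f : F f -> F (fun x => - f x).
Proof.
case=> W [w [[okW okw] ->]]; exists W, (- w); split; first by split=> //; exact: ok_outN.
by apply/funext => x; rewrite /network -(scaleN1r w) dotZl mulN1r.
Qed.

Lemma nn_class_0 f : F f -> f 0 = 0.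
Proof.
case=> W [w [_ ->]]; rewrite /network /=.
suff -> : layer sigma W 0 p = 0 by rewrite /dot mulmx0 mxE.
suff H i : (i <= p)%N -> layer sigma W 0 i = 0 by exact: H.
elim: i => [//|i IH ip] /=; rewrite IH ?(ltnW ip)// mulmx0.
by apply/matrixP => a b; rewrite !mxE sigma0.
Qed.

Lemma nn_class_lipschitz f : F f -> forall x y, `|f x - f y| <= B * norm (x - y).
Proof.
case=> W [w [[okW okw] ->]] x y; rewrite BE.
apply: network_lipschitz => //.
- by move=> i ip; exact: M0 (ltnW ip).
- exact: M0.
- by move=> i ip; apply: norm_mul => //; exact: okW.
- exact: norm_out.
Qed.

Lemma nn_class_contraction n (z : 'I_n -> 'cV[R]_(k 0%N)) lam
    (f : {set 'I_n} -> 'cV[R]_(k 0%N) -> R) :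
  0 <= lam -> (forall A, F (f A)) ->
  \sum_A expR (lam * `|\sum_j sgset R A j * f A (z j)|) <=
  Num.sqrt 2 ^+ p * \sum_A expR (lam * B * norm (\sum_j sgset R A j *: z j)).
Proof.
move=> lam0 Ff; rewrite BE.
have /choice[W HW] : forall A, exists W : weights R k, exists w : 'cV[R]_(k p),
    params W w /\ f A = @network R p.+1 k sigma W w by [].
have /choice[w Hw] := HW.
rewrite (eq_bigr (fun A => expR (lam * `|\sum_j sgset R A j *
    dot (w A) (layer sigma (W A) (z j) p)|))); last first.
  by move=> A _; rewrite (Hw A).2.
apply: (peeling_network L0 (fun i ip => M0 (ltnW ip)) c0 sigma0 sigma_homo sigma_lip unit_bound) => //.
- exact: M0.
- by move=> A; exact: (Hw A).1.1.
- by move=> A; apply: norm_out; exact: (Hw A).1.2.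
Qed.

End network_class.

Section lipschitz_activation.
Variables (R : realType) (s : R -> R) (L : R).

Lemma assumptionA_lipschitz : assumptionA s L ->
  forall x y, `|s x - s y| <= L * `|x - y|.
Proof. by case=> _ _ _ _ H x y; exact: (H (x, y)). Qed.

Lemma homogeneous0 :
  (forall alpha x, 0 < alpha -> s (alpha * x) = alpha * s x) -> s 0 = 0.
Proof. by move=> /(_ 2 0); rewrite mulr0 => /(_ ltac:(lra)); lra. Qed.

End lipschitz_activation.

Lemma with_prob_ge_sub (R : realType) d (Omega : measurableType d)
    (P : probability Omega R) q (G G' : set Omega) :
  G `<=` G' -> with_prob_ge P q G -> with_prob_ge P q G'.
Proof. by move=> GG' [E [mE EG] PE]; exists E => //; split=> //; exact: subset_trans GG'. Qed.

Theorem theorem3 (R : realType) (d : nat) (k : nat -> nat) (n m : nat)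
  (sigma : nat -> R -> R) (L MF M1 : nat -> R) (Gamma delta : R)
  (mu nu : probability (borel_cV R (k 0%N)) R)
  (dO : measure_display) (Omega : measurableType dO) (P : probability Omega R)
  (X : 'I_n -> {mfun Omega >-> borel_cV R (k 0%N)})
  (Y : 'I_m -> {mfun Omega >-> borel_cV R (k 0%N)}) :
  (2 <= d)%N ->
  (forall i, (i < d)%N -> (1 <= k i)%N) ->
  (1 <= n)%N -> (1 <= m)%N ->
  (forall i, (i < d)%N -> 0 < MF i) ->
  (forall i, (i < d)%N -> 0 < M1 i) ->
  (forall i, (i < d.-1)%N -> assumptionA (sigma i) (L i)) ->
  (forall i, (i < d.-1)%N -> assumptionB (sigma i)) ->
  0 < Gamma -> P_uB Gamma mu -> P_uB Gamma nu ->
  iid_samples P mu nu X Y ->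
  0 < delta -> delta < 1 ->
  4 * Num.sqrt (ln (1 / delta)) <=
    Num.sqrt (6 * (k 0%N)%:R) * (minn n m)%:R
      * Num.sqrt (m%:R^-1 + n%:R^-1) ->
  ((forall i, (i < d.-1)%N ->
      forall alpha x : R, 0 < alpha -> sigma i (alpha * x) = alpha * sigma i x) ->
    with_prob_ge P (1 - delta) [set omega |
      (`| nn_distance (nn_class d k sigma (params_F d k MF)) mu nu
          - nn_distance (nn_class d k sigma (params_F d k MF))
              (empirical (fun i => X i omega))
              (empirical (fun j => Y j omega)) |
       <= (2 * Gamma * (\prod_(i < d) MF i) * (\prod_(i < d.-1) L i)
           * (Num.sqrt (6 * d%:R * ln 2 + 5 * (k 0%N)%:R / 4)
              + Num.sqrt (2 * (k 0%N)%:R * ln (1 / delta)))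
           * ((Num.sqrt n%:R)^-1 + (Num.sqrt m%:R)^-1))%:E)%E])
  /\
  ((forall i, (i < d.-1)%N -> sigma i 0 = 0) ->
    with_prob_ge P (1 - delta) [set omega |
      (`| nn_distance (nn_class d k sigma (params_1oo d k M1)) mu nu
          - nn_distance (nn_class d k sigma (params_1oo d k M1))
              (empirical (fun i => X i omega))
              (empirical (fun j => Y j omega)) |
       <= (2 * Gamma * (\prod_(i < d) M1 i) * (\prod_(i < d.-1) L i)
           * (Num.sqrt (2 * d%:R * ln 2 + 2 * ln (k 0%N)%:R)
              + Num.sqrt (2 * (k 0%N)%:R * ln (1 / delta)))
           * ((Num.sqrt n%:R)^-1 + (Num.sqrt m%:R)^-1))%:E)%E]).
Proof.
(* With [d = p.+1], [p] counts the hidden layers, and index [p] belongs to the output weights. *)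
case: d => // p p1 k_gt0 n0 m0 MF0 M10 sA _ G0 mu_uB nu_uB XY delta0 delta1 _.
rewrite ltnS in p1; rewrite /= in sA *.
have h0 : (0 < k 0)%N by exact: k_gt0.
have L0 i : (i < p)%N -> 0 < L i by case/sA.
have PL0 : 0 < \prod_(i < p) L i by apply: prodr_gt0 => i _; exact: L0.
have s_homo i : (i < p)%N -> {homo sigma i : x y / x <= y} by case/sA.
have s_lip i : (i < p)%N -> forall x y, `|sigma i x - sigma i y| <= L i * `|x - y|.
  by move=> /sA; exact: assumptionA_lipschitz.
(* Concentration yields [h] where the claim has [2 * h] under the root. *)
have widen (B A : R) : 0 < B -> (A + 2 * Gamma * B * Num.sqrt ((k 0)%:R * ln (1 / delta))) *
    ((Num.sqrt n%:R)^-1 + (Num.sqrt m%:R)^-1) <=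
    (A + 2 * Gamma * B * Num.sqrt (2 * (k 0)%:R * ln (1 / delta))) *
    ((Num.sqrt n%:R)^-1 + (Num.sqrt m%:R)^-1).
  move=> B0; rewrite ler_wpM2r ?addr_ge0 ?invr_ge0 ?sqrtr_ge0// lerD2l.
  rewrite ler_wpM2l ?mulr_ge0 ?(ltW G0) ?(ltW B0)// ler_wsqrtr// ler_wpM2r ?ler_peMl ?ler1n//.
  by rewrite ln_ge0// div1r invf_ge1 ?posrE// ltW.
split => [s_hom|s_0].
- pose B := (\prod_(i < p.+1) MF i) * \prod_(i < p) L i.
  have B0 : 0 < B by apply: mulr_gt0 => //; apply: prodr_gt0 => i _; exact: MF0.
  have s_0 i : (i < p)%N -> sigma i 0 = 0 by move=> ip; apply: homogeneous0; exact: s_hom.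
  set F := nn_class _ _ _ _.
  pose ok i (W : 'M[R]_(k i.+1, k i)) := frobenius W <= MF i.
  pose ok_out (w : 'cV[R]_(k p)) := l2norm w <= MF p.
  have MF0' i : (i <= p)%N -> 0 <= MF i by move=> ip; exact/ltW/MF0.
  have F_cst0 : F (fun=> 0).
    apply: (@nn_class_cst0 R p k sigma ok ok_out).
      move=> i ip; rewrite /ok /frobenius big1 ?sqrtr0 ?MF0' ?(ltnW ip)//.
      by move=> a _; rewrite big1// => b _; rewrite mxE expr0n.
    by rewrite /ok_out l2norm0 MF0'.
  have F_opp f : F f -> F (fun x => - f x).
    apply: (@nn_class_opp R p k sigma ok ok_out) => w.
    by rewrite /ok_out l2normN.
  have F_0 f : F f -> f 0 = 0 by exact: (@nn_class_0 R p k sigma ok ok_out).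
  have out w : ok_out w -> forall v, `|dot w v| <= MF p * l2norm v.
    by move=> okw v; rewrite (le_trans (dot_le _ _))// ler_wpM2r ?l2norm_ge0.
  have F_lip f : F f -> forall x y, `|f x - f y| <= B * l2norm (x - y).
    apply: (@nn_class_lipschitz R p k sigma L MF (@l2norm R) ok ok_out) => //.
    + by move=> i /L0/ltW.
    + by move=> i ip W okW v; rewrite (le_trans (l2norm_mulmx _ _))// ler_wpM2r ?l2norm_ge0.
    + by move=> i ip u v; apply: l2norm_map; [exact: s_lip|exact/ltW/L0].
  (* The second [MF] instantiates [c]: the unit is a normalised row, and the size of the matrix
     stays outside. *)
  have F_con N (z : 'I_N -> 'cV[R]_(k 0)) := @nn_class_contraction R p k sigma L MF MF
    (@l2norm R) ok ok_out (fun i ip => ltW (L0 i ip)) MF0' (fun i ip => MF0' i (ltnW ip))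
    s_0 s_homo s_lip (fun i ip W _ a v okW => unit_bound_frobenius a v (s_0 i ip)
      (s_hom i ip) (MF0' i (ltnW ip)) okW) out N z.
  pose W := 2 * Gamma * B * Num.sqrt (6 * p.+1%:R * ln 2 + 5 * (k 0)%:R / 4).
  apply: with_prob_ge_sub (two_samples_bound (W := W) h0 F_cst0 B0 G0 F_lip F_0 F_opp
    _ n0 m0 mu_uB nu_uB XY delta0 delta1).
    move=> omega /= /le_trans; apply; rewrite lee_fin (le_trans (widen B W B0))//.
    by rewrite le_eqVlt; apply/orP; left; apply/eqP; rewrite /W /B; ring.
  move=> rho rho_int rho_mgf rho_mean N I N0; rewrite /W.
  apply: (mean_dev_l2 F_cst0 B0 F_lip F_0 _ rho_int rho_mgf G0 rho_mean N0).
  by move=> N' z; exact: F_con.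
- pose B := (\prod_(i < p.+1) M1 i) * \prod_(i < p) L i.
  have B0 : 0 < B by apply: mulr_gt0 => //; apply: prodr_gt0 => i _; exact: M10.
  set F := nn_class _ _ _ _.
  pose ok i (W : 'M[R]_(k i.+1, k i)) := norm_1oo W <= M1 i.
  pose ok_out (w : 'cV[R]_(k p)) := l1norm w <= M1 p.
  have M10' i : (i <= p)%N -> 0 <= M1 i by move=> ip; exact/ltW/M10.
  have F_cst0 : F (fun=> 0).
    apply: (@nn_class_cst0 R p k sigma ok ok_out).
      move=> i ip; rewrite /ok /norm_1oo; apply: bigmax_le => [|a _].
        exact: M10' (ltnW ip).
      by rewrite big1 ?M10' ?(ltnW ip)// => b _; rewrite mxE normr0.
    by rewrite /ok_out /l1norm big1 ?M10'// => a _; rewrite mxE normr0.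
  have F_opp f : F f -> F (fun x => - f x).
    apply: (@nn_class_opp R p k sigma ok ok_out) => w; rewrite /ok_out /l1norm.
    by under [in X in _ -> X]eq_bigr do rewrite mxE normrN.
  have F_0 f : F f -> f 0 = 0 by exact: (@nn_class_0 R p k sigma ok ok_out).
  have out w : ok_out w -> forall v, `|dot w v| <= M1 p * linf v.
    by move=> okw v; rewrite (le_trans (dot_le_linf _ _))// ler_wpM2r ?linf_ge0.
  have F_lip f : F f -> forall x y, `|f x - f y| <= B * linf (x - y).
    apply: (@nn_class_lipschitz R p k sigma L M1 (@linf R) ok ok_out) => //.
    + by move=> i /L0/ltW.
    + by move=> i ip W okW v; rewrite (le_trans (linf_mulmx _ _))// ler_wpM2r ?linf_ge0.
    + by move=> i ip u v; apply: linf_map; [exact: s_lip|exact/ltW/L0].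
  (* Here [c] is 1, the unit being a row of the matrix itself. *)
  have F_con N (z : 'I_N -> 'cV[R]_(k 0)) := @nn_class_contraction R p k sigma L M1 (fun=> 1)
    (@linf R) ok ok_out (fun i ip => ltW (L0 i ip)) M10' (fun i ip => ler01)
    s_0 s_homo s_lip (fun i ip W _ a v okW => unit_bound_1oo (sigma i) a v
      (M10' i (ltnW ip)) okW) out N z.
  have F_lip2 f : F f -> forall x y, `|f x - f y| <= B * l2norm (x - y).
    move=> Ff x y; rewrite (le_trans (F_lip f Ff x y))//.
    by rewrite ler_wpM2l ?linf_l2norm// ltW.
  pose W := 2 * Gamma * B * Num.sqrt (2 * p.+1%:R * ln 2 + 2 * ln (k 0)%:R).
  apply: with_prob_ge_sub (two_samples_bound (W := W) h0 F_cst0 B0 G0 F_lip2 F_0 F_opp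
    _ n0 m0 mu_uB nu_uB XY delta0 delta1).
    move=> omega /= /le_trans; apply; rewrite lee_fin (le_trans (widen B W B0))//.
    by rewrite le_eqVlt; apply/orP; left; apply/eqP; rewrite /W /B; ring.
  move=> rho rho_int rho_mgf rho_mean N I N0; rewrite /W.
  apply: (mean_dev_linf h0 p1 F_cst0 B0 F_lip F_0 _ rho_int rho_mgf G0 rho_mean N0).
  by move=> N' z; exact: F_con.
Qed.
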